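(* Let $R=\mathbb C[[x,y]]^G$ be a cyclic quotient surface singularity with maximal ideal $\mathfrak m$. Then the following are equivalent: (1) $G=\frac1n(1,a)$, where $a$ divides $n+1$. (2) $\tau_{\mathrm{CM}(R)}(R)=\mathfrak m$. (3) $\mathrm{tr}_R(M)=\mathfrak m$ for every nonzero Ulrich $R$-module $M$.
   Context: Modules are finitely generated. A cyclic quotient surface singularity over $\mathbb C$ is a ring $\mathbb C[[x,y]]^G$ where $G=\frac1n(1,a)\subseteq GL(2,\mathbb C)$ is the cyclic group generated by $\begin{pmatrix}\zeta_n&0\\0&\zeta_n^a\end{pmatrix}$, with $\zeta_n$ a primitive $n$-th root of unity, $1\le a\le n-1$ and $\gcd(a,n)=1$. A module $M$ is maximal Cohen--Macaulay (MCM) if $\mathrm{depth}\,M\ge\dim R$; an MCM module $M$ is Ulrich if its Hilbert--Samuel multiplicity $e(M)$ equals its minimal number of generators $\mu(M)$. For an $R$-module $M$, $\mathrm{tr}_R(M)=\sum_{f\in\mathrm{Hom}_R(M,R)}f(M)$. The test ideal associated to MCM modules is $\tau_{\mathrm{CM}(R)}(R)=\bigcap_M \mathrm{tr}_R(M)$, the intersection over all nonzero maximal Cohen--Macaulay $R$-modules $M$. *)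

(* Defs.v *)
From HB Require Import structures.
From mathcomp Require Import all_boot all_order all_algebra.
From mathcomp Require Import complex.
From mathcomp Require Import all_classical all_reals all_analysis.

Set Implicit Arguments.
Unset Strict Implicit.
Unset Printing Implicit Defensive.

Import Order.TTheory GRing.Theory Num.Theory.
Import numFieldNormedType.Exports.

Local Open Scope classical_set_scope.
Local Open Scope ring_scope.

Section Modules.
Context {A : comNzRingType}.

Definition submodule (M : lmodType A) (N : set M) : Prop :=
  GRing.submod_closed [in N].

Definition span (M : lmodType A) (X : set M) : set M :=
  smallest (@submodule M) X.

(* I N: the submodule generated by the products a *: u. *)
Definition smul (M : lmodType A) (I : set A) (N : set M) : set M :=
  span [set a *: u | a in I & u in N].

Definition finitely_generated (M : lmodType A) : Prop :=
  exists s : seq M, span [set` s] = setT.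

Definition nonzero_module (M : lmodType A) : Prop := exists u : M, u != 0.

Definition min_generators (M : lmodType A) : nat :=
  infimum 0%N [set size s | s in [set s : seq M | span [set` s] = setT]].

(* The length of M/N, read on chains of submodules of M containing N; it is 0
   by convention when these chains have unbounded length. *)
Definition colength (M : lmodType A) (N : set M) : nat :=
  supremum 0%N [set n | exists P : nat -> set M,
    [/\ forall i, (i <= n)%N -> submodule (P i) /\ N `<=` P i
      & forall i, (i < n)%N -> P i `<` P i.+1]].

(* The sum of the submodules f(M) of A. *)
Definition trace_ideal (M : lmodType A) : set A :=
  span (M := A^o) (\bigcup_(f in [set: {linear M -> A^o}]) range f).

End Modules.

Section LocalRings.
Variable A : comNzRingType.

(* The nonunits: the maximal ideal when A is local. *)
Definition maximal_ideal : set A := [set x | ~ exists y, x * y = 1].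

Definition prime_ideal (P : set A) : Prop :=
  idealr_closed [in P] /\ prime_idealr_closed [in P].

Definition krull_dim : nat :=
  supremum 0%N [set n | exists P : nat -> set A,
    [/\ forall i, (i <= n)%N -> prime_ideal (P i)
      & forall i, (i < n)%N -> P i `<` P i.+1]].

(* s is an M-regular sequence in the maximal ideal: s_i is a nonzerodivisor on
   M/(s_0, ..., s_(i-1))M, and M is different from (s)M. *)
Definition regular_sequence (M : lmodType A) (s : seq A) : Prop :=
  [/\ [set` s] `<=` maximal_ideal,
      forall i, (i < size s)%N -> forall u : M,
        smul [set` take i s] setT (nth 0 s i *: u) ->
        smul [set` take i s] setT u
    & smul [set` s] [set: M] != setT].

(* Only meaningful for M nonzero: the zero module, of infinite depth, has no
   regular sequence in the above sense. *)
Definition depth (M : lmodType A) : nat :=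
  supremum 0%N [set size s | s in regular_sequence M].

Definition MCM (M : lmodType A) : Prop :=
  finitely_generated M /\ (nonzero_module M -> (krull_dim <= depth M)%N).

(* e(M) = lim_n d! length(M / m^n M) / n^d, for d the dimension of A. *)
Definition multiplicity (R : realType) (M : lmodType A) : R :=
  lim ((fun n : nat => (krull_dim`!)%:R *
          (colength (iter n (smul maximal_ideal) [set: M]))%:R
          / n%:R ^+ krull_dim : R) @ \oo).

Definition Ulrich (R : realType) (M : lmodType A) : Prop :=
  MCM M /\ multiplicity R M = (min_generators M)%:R.

Definition test_ideal_CM : set A := [set x |
  forall M : lmodType A, MCM M -> nonzero_module M -> trace_ideal M x].

End LocalRings.

Arguments maximal_ideal : clear implicits.
Arguments krull_dim : clear implicits.
Arguments test_ideal_CM : clear implicits.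

(* coef2 f i j is the coefficient of x^i y^j. *)
Record series2 (K : Type) := Series2 { coef2 : nat -> nat -> K }.

HB.instance Definition _ (K : Type) := [isNew for @coef2 K].

Section Series2.
Variable K : comNzRingType.
Implicit Types f g h : series2 K.

HB.instance Definition _ := [Choice of series2 K by <:].

Lemma series2P f g : (forall i j, coef2 f i j = coef2 g i j) -> f = g.
Proof.
case: f g => [f] [g] /= fg; congr Series2.
by apply/funext => i; apply/funext => j.
Qed.

Definition zero2 : series2 K := Series2 (fun _ _ => 0).
Definition opp2 f : series2 K := Series2 (fun i j => - coef2 f i j).
Definition add2 f g : series2 K :=
  Series2 (fun i j => coef2 f i j + coef2 g i j).
Definition one2 : series2 K :=
  Series2 (fun i j => ((i == 0%N) && (j == 0%N))%:R).
Definition mul2 f g : series2 K :=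
  Series2 (fun i j => \sum_(k < i.+1) \sum_(l < j.+1)
    coef2 f k l * coef2 g (i - k) (j - l)).

Lemma add2A : associative add2.
Proof. by move=> f g h; apply: series2P => i j /=; rewrite addrA. Qed.
Lemma add2C : commutative add2.
Proof. by move=> f g; apply: series2P => i j /=; rewrite addrC. Qed.
Lemma add02 : left_id zero2 add2.
Proof. by move=> f; apply: series2P => i j /=; rewrite add0r. Qed.
Lemma addN2 : left_inverse zero2 opp2 add2.
Proof. by move=> f; apply: series2P => i j /=; rewrite addNr. Qed.

HB.instance Definition _ := GRing.isZmodule.Build (series2 K)
  add2A add2C add02 addN2.

Definition trunc2 (n : nat) f : {poly {poly K}} :=
  \poly_(i < n) \poly_(j < n) coef2 f i j.

Lemma coef_trunc2 n f i j : (i < n)%N -> (j < n)%N ->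
  (trunc2 n f)`_i`_j = coef2 f i j.
Proof. by move=> ltin ltjn; rewrite coef_poly ltin coef_poly ltjn. Qed.

Lemma coef_mul2 n f g (p q : {poly {poly K}}) :
    (forall i j, (i < n)%N -> (j < n)%N -> p`_i`_j = coef2 f i j) ->
    (forall i j, (i < n)%N -> (j < n)%N -> q`_i`_j = coef2 g i j) ->
  forall i j, (i < n)%N -> (j < n)%N -> (p * q)`_i`_j = coef2 (mul2 f g) i j.
Proof.
move=> pf qg i j ltin ltjn; rewrite coefM coef_sum /=.
apply: eq_bigr => k _; rewrite coefM; apply: eq_bigr => l _.
have lek : (k <= i)%N by rewrite -ltnS.
have lel : (l <= j)%N by rewrite -ltnS.
rewrite pf ?(leq_ltn_trans lek) ?(leq_ltn_trans lel) //.
by rewrite qg // (leq_ltn_trans (leq_subr _ _)).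
Qed.

Lemma mul2C : commutative mul2.
Proof.
move=> f g; apply: series2P => i j; pose n := (i + j).+1.
have ltin : (i < n)%N by rewrite ltnS leq_addr.
have ltjn : (j < n)%N by rewrite ltnS leq_addl.
rewrite -(coef_mul2 (coef_trunc2 f) (coef_trunc2 g) ltin ltjn).
by rewrite -(coef_mul2 (coef_trunc2 g) (coef_trunc2 f) ltin ltjn) mulrC.
Qed.

Lemma mul2A : associative mul2.
Proof.
move=> f g h; apply: series2P => i j; pose n := (i + j).+1.
have ltin : (i < n)%N by rewrite ltnS leq_addr.
have ltjn : (j < n)%N by rewrite ltnS leq_addl.
have tr := @coef_trunc2 n.
rewrite -(coef_mul2 (tr f) (coef_mul2 (tr g) (tr h)) ltin ltjn).
by rewrite -(coef_mul2 (coef_mul2 (tr f) (tr g)) (tr h) ltin ltjn) mulrA.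
Qed.

Lemma mul12 : left_id one2 mul2.
Proof.
move=> f; apply: series2P => i j /=.
rewrite big_ord_recl [X in _ + X]big1 ?addr0 => [|k _]; last first.
  by rewrite big1 // => l _; rewrite mul0r.
rewrite big_ord_recl [X in _ + X]big1 ?addr0 => [|l _]; last by rewrite mul0r.
by rewrite /= mul1r !subn0.
Qed.

Lemma mul2Dl : left_distributive mul2 add2.
Proof.
move=> f g h; apply: series2P => i j /=; rewrite -big_split.
apply: eq_bigr => k _; rewrite -big_split.
by apply: eq_bigr => l _; rewrite mulrDl.
Qed.

Lemma one2_neq0 : one2 != zero2.
Proof.
by apply/eqP => /(congr1 (fun f => coef2 f 0 0))/eqP; rewrite /= oner_eq0.
Qed.

HB.instance Definition _ := GRing.Zmodule_isComNzRing.Build (series2 K)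
  mul2A mul2C mul12 mul2Dl one2_neq0.

(* The linear substitution f(x, y) |-> f(g00 x + g01 y, g10 x + g11 y).  The
   coefficient of x^i y^j in (g00 x + g01 y)^k (g10 x + g11 y)^l, where
   k + l = i + j, is read after setting x = 'X and y = 1. *)
Definition linsubst (g : 'M[K]_2) f : series2 K :=
  Series2 (fun i j => \sum_(k < (i + j).+1) coef2 f k (i + j - k) *
    ((g 0 0 *: 'X + (g 0 1)%:P) ^+ k *
     (g 1 0 *: 'X + (g 1 1)%:P) ^+ (i + j - k))`_i).

Definition invariants (G : set 'M[K]_2) : {pred series2 K} :=
  [in [set f | forall s, G s -> linsubst s f = f]].

(* The group 1/n(1,a), generated by diag(z, z^a) for z a primitive n-th root
   of unity (whence natural exponents suffice). *)
Definition cyclic_gen (z : K) (a : nat) : 'M[K]_2 :=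
  diag_mx (\row_(i < 2) if i == 0 then z else z ^+ a).

Definition cyclic_group (z : K) (a : nat) : set 'M[K]_2 :=
  range (fun k : nat => cyclic_gen z a ^+ k).

Lemma cyclic_genX z a k : cyclic_gen z a ^+ k = cyclic_gen (z ^+ k) a.
Proof.
elim: k => [|k IHk].
  apply/matrixP => i j; rewrite !expr0 !mxE expr1n.
  by case: (_ == _); case: (_ == _).
rewrite exprS IHk -[_ * _]/(_ *m _) mulmx_diag; congr diag_mx.
apply/rowP => i; rewrite !mxE.
by case: (_ == _); rewrite ?exprS ?exprMn.
Qed.

Lemma coef_linsubst_cyclic_gen z a f i j :
  coef2 (linsubst (cyclic_gen z a) f) i j = z ^+ (i + a * j) * coef2 f i j.
Proof.
rewrite /= !mxE /= !mulr1n !mulr0n polyC0 addr0 scale0r add0r.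
have lti : (i < (i + j).+1)%N by rewrite ltnS leq_addr.
have cE k : ((z *: 'X) ^+ k * (z ^+ a)%:P ^+ (i + j - k) : {poly K})`_i
    = z ^+ k * z ^+ (a * (i + j - k)) * (i == k)%:R.
  by rewrite exprZn -polyC_exp coefMC coefZ coefXn -exprM mulrAC.
under eq_bigr do rewrite cE.
rewrite (bigD1 (Ordinal lti)) //= eqxx mulr1 addKn -exprD mulrC.
rewrite big1 ?addr0 // => k; rewrite -val_eqE /= eq_sym => /negPf ->.
by rewrite !mulr0.
Qed.

Lemma invariants_cyclicP z a f :
  reflect (forall i j, z ^+ (i + a * j) * coef2 f i j = coef2 f i j)
          (f \in invariants (cyclic_group z a)).
Proof.
apply: (iffP idP) => [|fz].
  rewrite unfold_in inE /= => inv i j.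
  rewrite -coef_linsubst_cyclic_gen inv //.
  by exists 1%N => //; rewrite expr1.
rewrite unfold_in inE /= => _ [k _ <-]; apply: series2P => i j.
rewrite cyclic_genX coef_linsubst_cyclic_gen -exprM mulnC exprM.
by elim: k => [|k IHk]; rewrite ?expr0 ?mul1r // exprSr -mulrA fz.
Qed.

Lemma invariants_subring z a :
  subring_closed (invariants (cyclic_group z a)).
Proof.
split=> [|f g /invariants_cyclicP fz /invariants_cyclicP gz
         |f g /invariants_cyclicP fz /invariants_cyclicP gz];
  apply/invariants_cyclicP => i j /=.
- by case: i j => [|i] [|j]; rewrite ?mulr0 ?muln0 ?mul1r.
- by rewrite mulrBr fz gz.
rewrite mulr_sumr; apply: eq_bigr => k _; rewrite mulr_sumr.
apply: eq_bigr => l _; rewrite -[in RHS]fz -[in RHS]gz.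
have lek : (k <= i)%N by rewrite -ltnS.
have lel : (l <= j)%N by rewrite -ltnS.
rewrite mulrACA -exprD; congr (z ^+ _ * _).
by rewrite addnACA -mulnDr !subnKC.
Qed.

HB.instance Definition _ z a := GRing.isSubringClosed.Build (series2 K)
  (invariants (cyclic_group z a)) (invariants_subring z a).

(* K[[x,y]]^G for G generated by diag(z, z^a). *)
Record cyclic_quotient (z : K) (a : nat) := CyclicQuotient {
  cq_val : series2 K;
  cq_valP : cq_val \in invariants (cyclic_group z a)
}.

HB.instance Definition _ z a := [isSub for @cq_val z a].
HB.instance Definition _ z a := [Choice of cyclic_quotient z a by <:].
HB.instance Definition _ z a :=
  [SubChoice_isSubComNzRing of cyclic_quotient z a by <:].

End Series2.

(* Main.v *)
Require Import Defs.
From HB Require Import structures.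
From mathcomp Require Import all_boot all_order all_algebra.
From mathcomp Require Import complex.
From mathcomp Require Import all_classical all_reals all_analysis.
From mathcomp Require Import zify ring lra.

(** Write S for the ring of power series in x and y, with x^i y^j of weight
    i + a j modulo n, and W_t for the space of series whose monomials have
    weight t.  Then A = W_0 is the ring of invariants, with maximal ideal m, and
    the W_t are A-modules.

    The modules.  The maximal Cohen-Macaulay modules are the direct sums of
    modules W_t (MCM_decomposition, MCM_eigenmodule).  Indeed Hom_A(S, M) is a
    graded module over S, finitely generated because S is finite over A, and x,
    y form a regular sequence on it because x^n, y^n form one on M.  So it is
    free with a homogeneous basis, and M is its part of weight 0.  That any
    maximal Cohen-Macaulay M has x^n, y^n as a regular sequence, as well as the
    equality dim A = 2, rests on the fact that a prime strictly containing a
    nonzero prime is m (prime_height).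

    The traces.  A map from W_t to A is the multiplication by a series (W_hom).
    Hence the trace of a sum of modules W_t is contained in the space of series
    all of whose monomials are divisible by a monomial of one of the weights t
    (trace_coef), and it contains m if all nonconstant invariant monomials have
    a divisor of weight t (trace_covers).

    The multiplicities.  Let v_0, ..., v_e be the lattice points on the compact
    boundary of the convex hull of the nonconstant invariant monomials, given
    by the Hirzebruch-Jung continued fraction of n / (n - a).  Two consecutive
    ones span parallelograms of area n, each of which contains one monomial of
    weight t; the monomials of W_t outside m^k W_t fill, up to O(k), a triangle
    of such parallelograms in each of the e cones.  So e(W_t) = e for all t
    (multiplicityE), while W_t has at most e minimal generators
    (size_outside1_le), and W_0 has one.

    The equivalence.  If n + 1 = a b then every nonconstant invariant monomial
    x^i y^j has divisors of all weights: there are enough if i >= a - 1,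
    likewise if j >= b - 1 since y + b x defines the same weights up to a unit,
    and otherwise i + a j < n, which is excluded (divisors_cover).  So all traces contain m, and
    that of W_1 is m; this is condition (2).  Next, a trace that is not
    contained in m belongs to a module with A as a summand, which has too few
    generators to be Ulrich since e >= 2; hence (2) implies (3).  Finally, if a
    does not divide n + 1, write n = s a + r with 0 <= r < a.  The module W_t
    for t = - (r + 1) has e generators, so it is Ulrich, but x^r y^s is an
    invariant monomial without divisor of weight t (special_weight), so that it
    is not in the trace and (3) fails. *)

Set Implicit Arguments.
Unset Strict Implicit.
Unset Printing Implicit Defensive.

Import Order.TTheory GRing.Theory Num.Theory.

(** * Lattice points *)

(** The sequence v_i = (p i, q i), 0 <= i <= e, of the lattice points on the
    compact boundary of the convex hull of the nonconstant invariant monomials: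
    consecutive ones form a basis of the lattice (their determinant is n), and
    v_(i-1) + v_(i+1) is a multiple of v_i, at least twice. *)
Record boundary (n a e : nat) (p q : nat -> nat) : Prop := Boundary {
  bd_p0 : p 0 = n;
  bd_q0 : q 0 = 0;
  bd_p1 : p 1 = n - a;
  bd_q1 : q 1 = 1;
  bd_e : 1 < e;
  bd_pe : p e = 0;
  bd_p_lt : forall i, i < e -> p i.+1 < p i;
  bd_q_lt : forall i, i < e -> q i < q i.+1;
  bd_det : forall i, i < e -> p i * q i.+1 = n + p i.+1 * q i;
  bd_weight : forall i, i <= e -> n %| p i + a * q i;
  bd_convex : forall i, i.+1 < e -> exists c, [/\ 1 < c,
    p i + p i.+2 = c * p i.+1 & q i + q i.+2 = c * q i.+1]
}.

(** The Hirzebruch-Jung algorithm: v_(i+1) = c v_i - v_(i-1), with c the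
    quotient of p (i-1) by p i rounded up, until p vanishes. *)
Lemma boundary_exists n a : 0 < a < n ->
  exists e p q, boundary n a e p q.
Proof.
move=> /andP[a0 an].
pose step (s : (nat * nat) * (nat * nat)) := let: ((p, q), (p', q')) := s in
  let c := (p + p').-1 %/ p' in ((p', q'), (c * p' - p, c * q' - q)).
pose st i := iter i step ((n, 0), (n - a, 1)).
pose p i := (st i).1.1; pose q i := (st i).1.2.
have stS i : (st i).2 = (st i.+1).1.
  by rewrite /st iterS; case: (iter i _ _) => [[? ?] [? ?]].
have p2 i : (st i).2.1 = p i.+1 by rewrite stS.
have q2 i : (st i).2.2 = q i.+1 by rewrite stS.
pose c i := (p i + p i.+1).-1 %/ p i.+1.
have pSS i : p i.+2 = c i * p i.+1 - p i.
  by rewrite -p2 /st iterS -/(st i) /c -p2 /p; case: (st i) => [[? ?] [? ?]].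
have qSS i : q i.+2 = c i * q i.+1 - q i.
  by rewrite -q2 /st iterS -/(st i) /c -p2 -q2 /p /q; case: (st i) => [[? ?] [? ?]].
have p0 : p 0 = n by [].
have q0 : q 0 = 0 by [].
have p1 : p 1 = n - a by [].
have q1 : q 1 = 1 by [].
pose Inv i := [/\ p i.+1 < p i, q i < q i.+1, p i * q i.+1 = n + p i.+1 * q i,
  n %| p i + a * q i & n %| p i.+1 + a * q i.+1].
have conv i : Inv i -> 0 < p i.+1 -> [/\ 1 < c i,
    p i + p i.+2 = c i * p i.+1, q i + q i.+2 = c i * q i.+1 & p i.+2 < p i.+1].
  move=> [pp qq _ _ _] p0'.
  have [c1 cp cp'] : [/\ 1 < c i, p i <= c i * p i.+1 & c i * p i.+1 < p i + p i.+1].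
    have := divn_eq (p i + p i.+1).-1 (p i.+1).
    have := ltn_pmod (p i + p i.+1).-1 p0'; rewrite -/(c i).
    move: (c i) (_ %% _) => d r rd mE; split; try lia.
    by case: d mE => [|[|d]]; lia.
  by rewrite pSS qSS; split=> //; nia.
have invS i : Inv i -> 0 < p i.+1 -> Inv i.+1.
  move=> Ii p0'; have [c1 pE qE plt] := conv i Ii p0'.
  case: Ii => pp qq det w1 w2; split=> //; first by nia.
    by nia.
  have : n %| (p i + a * q i) + (p i.+2 + a * q i.+2).
    by rewrite addnACA -mulnDr pE qE mulnCA -mulnDr dvdn_mull.
  by rewrite dvdn_addr.
have inv0 : Inv 0.
  rewrite /Inv p0 q0 p1 q1; split; try lia; rewrite ?muln0 ?addn0 ?dvdnn //.
  by rewrite muln1 subnK // ltnW.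
have exe : exists e, p e == 0.
  have H k : (forall i, i <= k -> p i != 0) -> Inv k /\ p k + k <= n.
    elim: k => [|k IHk] pk; first by rewrite addn0 p0.
    have [|Ik pkn] := IHk; first by move=> i ik; apply: pk; lia.
    have pk1 : 0 < p k.+1 by rewrite lt0n; apply: pk.
    by split; [exact: invS|case: Ik; lia].
  case: (boolP [exists i : 'I_n.+1, p i == 0]) => [/existsP[i pi]|/existsPn np].
    by exists i.
  have [|_] := H n; last by have := np ord_max; rewrite /= -lt0n; lia.
  by move=> i ik; apply: (np (Ordinal (ik : i < n.+1))).
case: (ex_minnP exe) => e /eqP pe emin.
have pos i : i < e -> 0 < p i by move=> ie; rewrite lt0n; apply: contraTN ie => /emin; rewrite -leqNgt.
have Ii i : i < e -> Inv i.
  by elim: i => // i IHi ie; apply: invS; [apply: IHi; lia|exact: pos].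
have e1 : 1 < e.
  by case: e pe {emin pos Ii} => [|[|//]]; rewrite ?p0 ?p1; lia.
exists e, p, q; split=> //; try by move=> i /Ii[].
- case=> [_|i ie]; first by rewrite p0 q0 muln0 addn0 dvdnn.
  by case: (Ii i ie).
- move=> i ie; exists (c i); have [||c1 pE qE _] := conv i; rewrite ?pos //.
  by apply: Ii; lia.
Qed.

(** ** Monomials in the powers of the maximal ideal *)

Section Powers.
Variables (n a : nat).

(** Membership of a monomial in m^k W_t, where t is a weight and m is generated
    by the nonconstant monomials of weight 0. *)
Fixpoint in_power t k x y : bool :=
  if k is k'.+1 then
    [exists u : 'I_x.+1, exists v : 'I_y.+1,
      [&& 0 < u + v, n %| u + a * v & in_power t k' (x - u) (y - v)]]
  else x + a * y == t %[mod n].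

Lemma in_powerS t k x y : reflect (exists u v, [/\ u <= x, v <= y, 0 < u + v,
    n %| u + a * v & in_power t k (x - u) (y - v)]) (in_power t k.+1 x y).
Proof.
apply: (iffP existsP) => [[u /existsP[v /and3P[uv0 uvn E]]]|[u [v [ux vy uv0 uvn E]]]].
  by exists u, v; rewrite !leq_ord.
exists (Ordinal (ux : u < x.+1)); apply/existsP.
by exists (Ordinal (vy : v < y.+1)); apply/and3P.
Qed.

Lemma in_power_weight t k x y : in_power t k x y -> x + a * y = t %[mod n].
Proof.
elim: k x y => [|k IHk] x y; first by move/eqP.
move=> /in_powerS[u [v [ux vy _ /dvdnP[m uvm] /IHk <-]]].
have -> : x + a * y = (x - u + a * (y - v)) + (u + a * v).
  by rewrite addnACA -mulnDr !subnK.
by rewrite uvm addnC modnMDl.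
Qed.

Lemma in_power_add t k x y u v : n %| u + a * v -> in_power t k x y ->
  in_power t k (x + u) (y + v).
Proof.
move=> uvn; elim: k x y => [|k IHk] x y.
  rewrite /= mulnDr addnACA => /eqP <-; have /dvdnP[m ->] := uvn.
  by rewrite addnC modnMDl.
move=> /in_powerS[u' [v' [ux vy uv0 uvn' E]]]; apply/in_powerS; exists u', v'.
by rewrite -!addnBAC // IHk //; split=> //; lia.
Qed.

Lemma in_powerW t k x y : in_power t k.+1 x y -> in_power t k x y.
Proof.
move=> /in_powerS[u [v [ux vy _ uvn /(in_power_add uvn)]]].
by rewrite !subnK.
Qed.

Lemma in_power_le t k l x y : l <= k -> in_power t k x y -> in_power t l x y.
Proof.
by move=> /subnK <-; elim: (k - l) => // d IHd /in_powerW.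
Qed.

Lemma in_power_mul t k x y u v m : n %| u + a * v -> 0 < u + v ->
  in_power t k x y -> in_power t (m + k) (x + m * u) (y + m * v).
Proof.
move=> uvn uv0 E; elim: m => [|m IHm]; first by rewrite !mul0n !addn0.
rewrite addSn; apply/in_powerS; exists u, v; split=> //; try lia.
have -> : x + m.+1 * u - u = x + m * u by lia.
by have -> : y + m.+1 * v - v = y + m * v by lia.
Qed.

Lemma in_power_x t k x y : 0 < n -> x + a * y = t %[mod n] -> n * k <= x -> in_power t k x y.
Proof.
move=> n0 wt nkx; have -> : x = (x - n * k) + k * n by lia.
rewrite -[y]addn0 -(muln0 k) -[k]addn0 -/(_ + _) -{2}[k]addn0.
have := @in_power_mul t 0 (x - n * k) y n 0 k; rewrite muln0 !addn0; apply => //.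
rewrite /= -wt -[in X in _ == X %[mod n]](subnK nkx).
by rewrite [n * k]mulnC addnAC [X in _ == X %[mod n]]addnC modnMDl.
Qed.

Lemma in_power_y t k x y : 0 < n -> x + a * y = t %[mod n] -> n * k <= y -> in_power t k x y.
Proof.
move=> n0 wt nky; have -> : y = (y - n * k) + k * n by lia.
have := @in_power_mul t 0 x (y - n * k) 0 n k; rewrite muln0 !addn0; apply => //.
  by rewrite add0n dvdn_mull.
rewrite /= -wt -[in X in _ == X %[mod n]](subnK nky).
rewrite mulnDr addnA [X in _ == X %[mod n]]addnC mulnCA.
by rewrite [n * (a * k)]mulnC modnMDl.
Qed.

(** As x^n and y^n are invariant, a monomial of W_t outside m^k W_t has both
    exponents less than n k. *)
Definition outside t k : seq (nat * nat) :=
  [seq xy <- [seq (x, y) | x <- iota 0 (n * k), y <- iota 0 (n * k)] |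
    (xy.1 + a * xy.2 == t %[mod n]) && ~~ in_power t k xy.1 xy.2].

Lemma outside_uniq t k : uniq (outside t k).
Proof.
by apply/filter_uniq/allpairs_uniq; rewrite ?iota_uniq // => -[? ?] [? ?] _ _ [-> ->].
Qed.

Lemma mem_outside t k x y : 0 < n -> ((x, y) \in outside t k) =
  (x + a * y == t %[mod n]) && ~~ in_power t k x y.
Proof.
move=> n0; rewrite mem_filter /=; apply/andP/idP => [[]//|/[dup] H ->]; split=> //.
case/andP: H => /eqP wt nE; apply/allpairsP; exists (x, y); rewrite !mem_iota /= !add0n.
split=> //; rewrite ltnNge; apply: contra nE; [exact: in_power_x|exact: in_power_y].
Qed.

(** The monomials outside m W_t generate W_t over the invariants. *)
Lemma outside1_divides t x y : 0 < n -> x + a * y = t %[mod n] -> exists x' y',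
  [/\ (x', y') \in outside t 1, x' <= x, y' <= y & n %| (x - x') + a * (y - y')].
Proof.
move=> n0; have [m] := ubnP (x + y); elim: m x y => // m IHm x y xym wt.
have [/in_powerS[u [v [ux vy uv0 uvn E]]]|nE] := boolP (in_power t 1 x y).
  have [||x' [y' [xyo xx yy d]]] := IHm (x - u) (y - v); first by lia.
    exact: (@in_power_weight t 0).
  exists x', y'; split=> //.
  - exact: leq_trans xx (leq_subr _ _).
  - exact: leq_trans yy (leq_subr _ _).
  have -> : x - x' = (x - u - x') + u by clear -xx ux; lia.
  have -> : y - y' = (y - v - y') + v by clear -yy vy; lia.
  by rewrite mulnDr addnACA dvdn_add.
exists x, y; rewrite mem_outside // wt eqxx nE; split=> //.
by rewrite !subnn muln0.
Qed.

Definition triangle k : seq (nat * nat) :=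
  [seq (A, B) | A <- iota 0 k, B <- iota 0 (k - A)].

Lemma triangle_uniq k : uniq (triangle k).
Proof.
apply: allpairs_uniq_dep => [|A _|]; [exact: iota_uniq|exact: iota_uniq|].
by move=> [A B] [A' B'] _ _ /= [-> ->].
Qed.

Lemma mem_triangle k A B : ((A, B) \in triangle k) = (A + B < k).
Proof.
apply/allpairsPdep/idP => [[A' [B' []]]|ABk].
  by rewrite !mem_iota /= => A'k B'k [-> ->]; lia.
by exists A, B; rewrite !mem_iota; split=> //; lia.
Qed.

Lemma size_triangle k : 2 * size (triangle k) = k * k.+1.
Proof.
rewrite size_allpairs_dep sumnE big_map.
under eq_bigr do rewrite size_iota.
rewrite -[X in iota 0 X]subn0 -/(index_iota 0 k).
elim: k => [|k IHk]; first by rewrite big_nil.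
rewrite big_nat_recl // subn0 mulnDr.
under eq_bigr do rewrite subSS.
by rewrite IHk; lia.
Qed.

End Powers.

(** ** Counting by cells *)

Section Cones.
Variables (n a e : nat) (p q : nat -> nat).
Hypothesis bd : boundary n a e p q.
Hypothesis n_gt0 : 0 < n.

Lemma p_mono i j : i <= j -> j <= e -> p j <= p i.
Proof.
move=> /subnK <-; elim: (j - i) => // d IHd; rewrite addSn => le_e.
exact: leq_trans (ltnW (bd_p_lt bd le_e)) (IHd (ltnW le_e)).
Qed.

Lemma q_mono i j : i <= j -> j <= e -> q i <= q j.
Proof.
move=> /subnK <-; elim: (j - i) => // d IHd; rewrite addSn => le_e.
exact: leq_trans (IHd (ltnW le_e)) (ltnW (bd_q_lt bd le_e)).
Qed.

Lemma p_mono_lt i j : i < j -> j <= e -> p j < p i.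
Proof.
move=> ij je; apply: leq_ltn_trans (p_mono ij je) _.
by apply: (bd_p_lt bd); lia.
Qed.

Lemma q_mono_lt i j : i < j -> j <= e -> q i < q j.
Proof.
move=> ij je; apply: leq_trans (q_mono ij je).
by apply: (bd_q_lt bd); lia.
Qed.

Lemma exists_cone x y : exists i, y * p i.+1 <= x * q i.+1.
Proof.
exists e.-1; rewrite prednK ?(bd_pe bd) ?muln0 //.
by have := bd_e bd; lia.
Qed.

(** The index of the cone spanned by two consecutive points that contains
    (x, y); the cone is open on the side of the first ray. *)
Definition cone x y := ex_minn (exists_cone x y).

Lemma coneP x y : [/\ cone x y < e, y * p (cone x y).+1 <= x * q (cone x y).+1
  & x * q (cone x y) <= y * p (cone x y)].
Proof.
rewrite /cone; case: ex_minnP => i iP imin; split=> //.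
  have : i <= e.-1.
    apply: imin; rewrite prednK ?(bd_pe bd) ?muln0 //.
    by have := bd_e bd; lia.
  by have := bd_e bd; lia.
case: i iP imin => [|i] iP imin; first by rewrite (bd_q0 bd) muln0.
by rewrite leqNgt; apply/negP => /ltnW/imin; rewrite ltnn.
Qed.

Lemma cone_eq x y i : i < e -> y * p i.+1 <= x * q i.+1 -> x * q i < y * p i ->
  cone x y = i.
Proof.
move=> ie le1 lt2; rewrite /cone; case: ex_minnP => j jP jmin.
apply/eqP; rewrite eqn_leq jmin //= leqNgt; apply/negP => ji.
have := p_mono ji (ltnW ie); have := q_mono ji (ltnW ie); nia.
Qed.

(** n times the coordinates of (x, y) in the basis of its cone. *)
Definition coordX x y i := x * q i.+1 - y * p i.+1.
Definition coordY x y i := y * p i - x * q i.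

Lemma coord_x x y i : i < e -> y * p i.+1 <= x * q i.+1 -> x * q i <= y * p i ->
  n * x = coordX x y i * p i + coordY x y i * p i.+1.
Proof.
move=> ie le1 le2; have := bd_det bd ie; rewrite /coordX /coordY.
have := subnK le1; have := subnK le2.
move: (_ - _) (_ - _) => Y X; nia.
Qed.

Lemma coord_y x y i : i < e -> y * p i.+1 <= x * q i.+1 -> x * q i <= y * p i ->
  n * y = coordX x y i * q i + coordY x y i * q i.+1.
Proof.
move=> ie le1 le2; have := bd_det bd ie; rewrite /coordX /coordY.
have := subnK le1; have := subnK le2.
move: (_ - _) (_ - _) => Y X; nia.
Qed.

(** By Cramer's rule and the weights of v_i and v_(i+1), a coordinate is modulo
    n a fixed multiple of the weight.  Thus a point is determined by its weight
    and by the integral parts of its coordinates. *)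
Lemma coordX_mod t x y i : i < e -> y * p i.+1 <= x * q i.+1 ->
  x + a * y = t %[mod n] -> coordX x y i = t * q i.+1 %[mod n].
Proof.
move=> ie le1 xyt; apply/eqP; rewrite -(eqn_modDr (y * (p i.+1 + a * q i.+1))).
have /dvdnP[m wE] := bd_weight bd ie.
have -> : coordX x y i + y * (p i.+1 + a * q i.+1) = (x + a * y) * q i.+1.
  by rewrite mulnDr addnA /coordX subnK // mulnDl; lia.
by rewrite wE mulnA [X in _ == X %[mod n]]addnC modnMDl -modnMml xyt modnMml.
Qed.

Lemma coordY_mod t x y i : i < e -> x * q i <= y * p i ->
  x + a * y = t %[mod n] -> coordY x y i + t * q i = 0 %[mod n].
Proof.
move=> ie le2 xyt.
have /dvdnP[m wE] := bd_weight bd (ltnW ie).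
rewrite -modnDmr -modnMml -xyt modnMml modnDmr.
have -> : coordY x y i + (x + a * y) * q i = y * (p i + a * q i).
  by rewrite mulnDl addnA /coordY subnK // mulnDr; lia.
by rewrite wE mulnA modnMl mod0n.
Qed.

(** The cell of a point is a translate of the parallelogram spanned by v_i and
    v_(i+1) by an integral combination of these points.  Its area is n, and it
    contains one point of each weight. *)
Definition cell x y := (cone x y, coordX x y (cone x y) %/ n, coordY x y (cone x y) %/ n).

Lemma cell_inj t x y x' y' : x + a * y = t %[mod n] -> x' + a * y' = t %[mod n] ->
  cell x y = cell x' y' -> x = x' /\ y = y'.
Proof.
move=> wt wt' [ii' XX YY].
have [ie le1 le2] := coneP x y; have [_ le1' le2'] := coneP x' y'.
rewrite -ii' in le1' le2' XX YY; set i := cone x y in ie le1 le2 le1' le2' XX YY.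
have eX : coordX x y i = coordX x' y' i.
  rewrite (divn_eq (coordX x y i) n) XX (coordX_mod ie le1 wt).
  by rewrite -(coordX_mod ie le1' wt') -divn_eq.
have eY : coordY x y i = coordY x' y' i.
  rewrite (divn_eq (coordY x y i) n) YY.
  have : coordY x y i == coordY x' y' i %[mod n].
    rewrite -(eqn_modDr (t * q i)) (coordY_mod ie le2 wt).
    by rewrite (coordY_mod ie le2' wt').
  by move=> /eqP ->; rewrite -divn_eq.
have := coord_x ie le1 le2; have := coord_y ie le1 le2.
rewrite eX eY -(coord_x ie le1' le2') -(coord_y ie le1' le2').
by move=> /eqP; rewrite eqn_pmul2l // => /eqP -> /eqP; rewrite eqn_pmul2l // => /eqP ->.
Qed.

(** The point is given by Cramer's rule, the weight prescribing the fractional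
    parts of its coordinates.  The shift of B keeps the point off the first ray,
    which belongs to the previous cone. *)
Lemma cell_surj t i A B : i < e ->
  exists x y, x + a * y = t %[mod n] /\ cell x y = (i, A, B.+1).
Proof.
move=> ie; have det := bd_det bd ie.
have /dvdnP[m w] := bd_weight bd (ltnW ie); have /dvdnP[m' w'] := bd_weight bd ie.
set P := p i in det w; set Q := q i in det w.
set P' := p i.+1 in det w'; set Q' := q i.+1 in det w'.
pose X := n * A + (t * Q') %% n; pose Y := n * B.+1 + (t * Q * n.-1) %% n.
pose k1 := (t * Q') %/ n; pose k2 := (t * Q * n.-1) %/ n.
have XE : X + k1 * n = n * A + t * Q'.
  by rewrite /X -addnA; congr (_ + _); rewrite addnC -divn_eq.
have YE : Y + k2 * n = n * B.+1 + t * Q * n.-1.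
  by rewrite /Y -addnA; congr (_ + _); rewrite addnC -divn_eq.
have nE : n = n.-1.+1 by rewrite prednK.
have divX : n %| X * P + Y * P'.
  have : n %| (X * P + Y * P') + n * (k1 * P + k2 * P').
    have -> : (X * P + Y * P') + n * (k1 * P + k2 * P') =
       (X + k1 * n) * P + (Y + k2 * n) * P' by lia.
    rewrite XE YE.
    have -> : (n * A + t * Q') * P + (n * B.+1 + t * Q * n.-1) * P' =
       n * (A * P + t + B.+1 * P' + t * Q * P').
      transitivity (n * (A * P + B.+1 * P') + t * (P * Q') + t * Q * P' * n.-1); first by lia.
      rewrite det [in t * Q * P' * n.-1]nE /=; move: n.-1 nE => n1 ->; lia.
    exact: dvdn_mulr.
  by rewrite dvdn_addl // dvdn_mulr.
have divY : n %| X * Q + Y * Q'.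
  have : n %| (X * Q + Y * Q') + n * (k1 * Q + k2 * Q').
    have -> : (X * Q + Y * Q') + n * (k1 * Q + k2 * Q') =
       (X + k1 * n) * Q + (Y + k2 * n) * Q' by lia.
    rewrite XE YE.
    have -> : (n * A + t * Q') * Q + (n * B.+1 + t * Q * n.-1) * Q' =
       n * (A * Q + B.+1 * Q' + t * Q * Q').
      by move: n.-1 nE => n1 ->; lia.
    exact: dvdn_mulr.
  by rewrite dvdn_addl // dvdn_mulr.
have [x xE] := dvdnP divX; have [y yE] := dvdnP divY.
have XyE : x * Q' = y * P' + X.
  apply/eqP; rewrite -(eqn_pmul2l n_gt0); apply/eqP.
  transitivity ((x * n) * Q'); first by lia.
  rewrite -xE; transitivity ((y * n) * P' + n * X); last by lia.
  rewrite -yE; transitivity (X * (P * Q') + Y * P' * Q'); first by lia.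
  by rewrite det; lia.
have YxE : y * P = x * Q + Y.
  apply/eqP; rewrite -(eqn_pmul2l n_gt0); apply/eqP.
  transitivity ((y * n) * P); first by lia.
  rewrite -yE; transitivity ((x * n) * Q + n * Y); last by lia.
  rewrite -xE; transitivity (Y * (P * Q') + X * Q * P); first by lia.
  by rewrite det; lia.
have Y0 : 0 < Y by rewrite /Y mulnS; lia.
exists x, y; split; last first.
  have cE : cone x y = i.
    by apply: cone_eq => //; rewrite -/P -/P' -/Q -/Q'; lia.
  rewrite /cell cE /coordX /coordY -/P -/P' -/Q -/Q' XyE YxE !addKn /X /Y.
  by rewrite ![n * _]mulnC !divnMDl // !divn_small ?ltn_mod // !addn0.
have mE : Q' * m = 1 + Q * m'.
  apply/eqP; rewrite -(eqn_pmul2l n_gt0); apply/eqP.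
  transitivity (Q' * (m * n)); first by lia.
  rewrite -w; transitivity (n + Q * (m' * n)); last by lia.
  rewrite -w'; transitivity (P * Q' + a * Q * Q'); first by lia.
  by rewrite det; lia.
have xyE : x + a * y = X * m + Y * m'.
  apply/eqP; rewrite -(eqn_pmul2l n_gt0); apply/eqP.
  transitivity (x * n + a * (y * n)); first by lia.
  rewrite -xE -yE; transitivity (X * (m * n) + Y * (m' * n)); last by lia.
  by rewrite -w -w'; lia.
have : x + a * y + n * (k1 * m + k2 * m') = t + n * (A * m + B.+1 * m' + t * Q * m').
  transitivity ((X + k1 * n) * m + (Y + k2 * n) * m'); first by rewrite xyE; lia.
  rewrite XE YE; transitivity (n * (A * m + B.+1 * m') + t * (Q' * m) + t * Q * m' * n.-1).
    by lia.
  by rewrite mE; move: n.-1 nE => n1 ->; lia.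
move=> /(congr1 (modn^~ n)); rewrite /= ![_ + n * _]addnC ![n * _]mulnC.
by rewrite !modnMDl.
Qed.

Local Notation in_power := (in_power n a).
Local Notation outside := (outside n a).

(** The linear form that takes the value n at v_i and v_(i+1). *)
Definition slope i x y := x * (q i.+1 - q i) + y * (p i - p i.+1).

Lemma slope_coord i x y : i < e -> y * p i.+1 <= x * q i.+1 -> x * q i <= y * p i ->
  slope i x y = coordX x y i + coordY x y i.
Proof.
move=> ie le1 le2; rewrite /slope /coordX /coordY !mulnBr.
have := leq_mul2l x (q i) (q i.+1); rewrite (ltnW (bd_q_lt bd ie)) orbT => h1.
have := leq_mul2l y (p i.+1) (p i); rewrite (ltnW (bd_p_lt bd ie)) orbT => h2.
lia.
Qed.

Lemma slopeD i x y x' y' : slope i (x + x') (y + y') = slope i x y + slope i x' y'.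
Proof. by rewrite /slope !mulnDl addnACA. Qed.

Lemma slopeZ i m x y : slope i (m * x) (m * y) = m * slope i x y.
Proof. by rewrite /slope -!mulnA -mulnDr. Qed.

Lemma slope_i i : i < e -> slope i (p i) (q i) = n.
Proof.
move=> ie; have := bd_det bd ie; have := bd_p_lt bd ie; have := bd_q_lt bd ie.
rewrite /slope !mulnBr => h1 h2 det.
have : q i * p i.+1 <= q i * p i by rewrite leq_mul2l ltnW ?orbT.
have : p i * q i <= p i * q i.+1 by rewrite leq_mul2l ltnW ?orbT.
lia.
Qed.

Lemma slope_iS i : i < e -> slope i (p i.+1) (q i.+1) = n.
Proof.
move=> ie; have := bd_det bd ie; have := bd_p_lt bd ie; have := bd_q_lt bd ie.
rewrite /slope !mulnBr => h1 h2 det.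
have : q i.+1 * p i.+1 <= q i.+1 * p i by rewrite leq_mul2l ltnW ?orbT.
have : p i.+1 * q i <= p i.+1 * q i.+1 by rewrite leq_mul2l ltnW ?orbT.
lia.
Qed.

Lemma slope_convex i j : j.+1 < e -> 2 * slope i (p j.+1) (q j.+1) <=
  slope i (p j) (q j) + slope i (p j.+2) (q j.+2).
Proof.
move=> je; have [c [c1 pc qc]] := bd_convex bd je.
by rewrite -slopeD pc qc slopeZ leq_mul2r c1 orbT.
Qed.

(** By convexity the line through two consecutive boundary points supports
    the whole boundary. *)
Lemma slope_boundary i j : i < e -> j <= e -> n <= slope i (p j) (q j).
Proof.
move=> ie je.
have up d : i.+1 + d <= e -> n <= slope i (p (i.+1 + d)) (q (i.+1 + d)) /\
    slope i (p (i + d)) (q (i + d)) <= slope i (p (i.+1 + d)) (q (i.+1 + d)).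
  elim: d => [|d IHd] de; first by rewrite !addn0 slope_i ?slope_iS.
  have [|h1 h2] := IHd; first lia.
  have := @slope_convex i (i + d); rewrite !addnS !addSn in h1 h2 de * => /(_ de).
  lia.
have down d : d <= i -> n <= slope i (p (i - d)) (q (i - d)) /\
    slope i (p (i - d).+1) (q (i - d).+1) <= slope i (p (i - d)) (q (i - d)).
  elim: d => [|d IHd] di; first by rewrite !subn0 slope_i ?slope_iS.
  have [|h1 h2] := IHd; first lia.
  have := @slope_convex i (i - d.+1).
  have -> : (i - d.+1).+1 = i - d by lia.
  by move=> /(_ ltac:(lia)); lia.
have [ji|ij] := leqP j i.
  by have [] := down (i - j) (leq_subr _ _); rewrite subKn.
by have [] := up (j - i.+1) ltac:(lia); rewrite subnKC.
Qed.

(** The boundary points generate the invariant monomials, since the coordinates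
    of a point of weight 0 have no fractional part. *)
Lemma invariant_cone u v : n %| u + a * v -> exists i A B, [/\ i < e,
  u = A * p i + B * p i.+1 & v = A * q i + B * q i.+1].
Proof.
move=> uvn; have [ie le1 le2] := coneP u v; set i := cone u v in ie le1 le2.
have wt : u + a * v = 0 %[mod n] by rewrite mod0n; apply/eqP.
have /dvdnP[A AE] : n %| coordX u v i.
  by rewrite /dvdn (coordX_mod ie le1 wt) mul0n mod0n.
have /dvdnP[B BE] : n %| coordY u v i.
  have := coordY_mod ie le2 wt.
  by rewrite mul0n addn0 mod0n => /eqP.
exists i, A, B; split=> //.
  apply/eqP; rewrite -(eqn_pmul2l n_gt0) (coord_x ie le1 le2) AE BE; apply/eqP; lia.
apply/eqP; rewrite -(eqn_pmul2l n_gt0) (coord_y ie le1 le2) AE BE; apply/eqP; lia.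
Qed.

Lemma invariant_ge u v : n %| u + a * v -> 0 < u + v ->
  exists i, [/\ i <= e, p i <= u & q i <= v].
Proof.
move=> uvn uv0; have [i [A [B [ie uE vE]]]] := invariant_cone uvn.
case: A uE vE => [|A] uE vE; last by exists i; split; nia.
case: B uE vE => [|B] uE vE; last by exists i.+1; split; nia.
by move: uv0; rewrite uE vE.
Qed.

Lemma slope_invariant i u v : i < e -> n %| u + a * v -> 0 < u + v -> n <= slope i u v.
Proof.
move=> ie /invariant_cone[j [A [B [je -> ->]]]] uv0.
rewrite slopeD !slopeZ.
have := slope_boundary ie (ltnW je); have := slope_boundary ie je.
case: A uv0 => [|A] uv0; last by nia.
case: B uv0 => [|B] uv0; last by nia.
by rewrite !mul0n in uv0.
Qed.

Lemma in_power_slope t k x y i : i < e -> in_power t k x y -> k * n <= slope i x y.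
Proof.
move=> ie; elim: k x y => [|k IHk] x y; first by rewrite mul0n.
move=> /in_powerS[u [v [ux vy uv0 uvn /IHk]]].
rewrite -[in slope i x y](subnK ux) -[in slope i _ y](subnK vy) slopeD.
by have := slope_invariant ie uvn uv0; lia.
Qed.

(** The integral parts of the coordinates of a monomial tell how many times it
    can be divided by x^(p i) y^(q i) and by x^(p (i+1)) y^(q (i+1)). *)
Lemma cell_in_power t x y : x + a * y = t %[mod n] ->
  in_power t ((cell x y).1.2 + (cell x y).2) x y.
Proof.
move=> wt; have [ie le1 le2] := coneP x y; rewrite /cell /=.
set i := cone x y in ie le1 le2 *.
set A := _ %/ n; set B := _ %/ n.
have [hA hB] : A * n <= coordX x y i /\ B * n <= coordY x y i by split; exact: leq_divM.
have xE := coord_x ie le1 le2; have yE := coord_y ie le1 le2.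
have lex : A * p i + B * p i.+1 <= x.
  rewrite -(leq_pmul2l n_gt0) xE.
  apply: (@leq_trans (A * n * p i + B * n * p i.+1)); first lia.
  by apply: leq_add; rewrite leq_mul2r ?hA ?hB orbT.
have ley : A * q i + B * q i.+1 <= y.
  rewrite -(leq_pmul2l n_gt0) yE.
  apply: (@leq_trans (A * n * q i + B * n * q i.+1)); first lia.
  by apply: leq_add; rewrite leq_mul2r ?hA ?hB orbT.
pose x0 := x - (A * p i + B * p i.+1); pose y0 := y - (A * q i + B * q i.+1).
have wi := bd_weight bd (ltnW ie); have wi' := bd_weight bd ie.
have wt0 : x0 + a * y0 = t %[mod n].
  have E : x + a * y = x0 + a * y0 + (A * (p i + a * q i) + B * (p i.+1 + a * q i.+1)).
    by rewrite /x0 /y0 -[in LHS](subnK lex) -[in LHS](subnK ley); lia.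
  rewrite -wt E; have /dvdnP[m ->] : n %| A * (p i + a * q i) + B * (p i.+1 + a * q i.+1).
    by apply: dvdn_add; exact: dvdn_mull.
  by rewrite [in RHS]addnC modnMDl.
have pi0 : 0 < p i + q i.
  by rewrite addn_gt0 (leq_ltn_trans (leq0n _) (bd_p_lt bd ie)).
have pi1 : 0 < p i.+1 + q i.+1.
  by rewrite addn_gt0 (leq_ltn_trans (leq0n _) (bd_q_lt bd ie)) orbT.
have E0 : in_power t 0 x0 y0 by apply/eqP.
have := in_power_mul A wi pi0 (in_power_mul B wi' pi1 E0).
rewrite addn0.
have -> : x0 + B * p i.+1 + A * p i = x by rewrite /x0 -addnA [B * _ + _]addnC subnK.
by have -> : y0 + B * q i.+1 + A * q i = y
  by rewrite /y0 -addnA [B * _ + _]addnC subnK.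
Qed.

(** The map to cells embeds the monomials outside m^k W_t in e triangles. *)
Lemma size_outside_le t k : 2 * size (outside t k) <= e * (k * k.+1).
Proof.
rewrite -(size_triangle k) mulnCA leq_pmul2l // -(size_map (fun xy => cell xy.1 xy.2)).
rewrite -[e in X in _ <= X](size_iota 0 e).
rewrite -(size_allpairs (fun i AB => (i, AB.1, AB.2))).
apply: uniq_leq_size.
  rewrite map_inj_in_uniq ?outside_uniq // => -[x y] [x' y'].
  rewrite !mem_outside // => /andP[/eqP wt _] /andP[/eqP wt' _] /(cell_inj wt wt').
  by case=> -> ->.
move=> c /mapP[[x y]]; rewrite mem_outside // => /andP[/eqP wt nE] -> /=.
have [ie _ _] := coneP x y; have EAB := cell_in_power wt.
apply/allpairsP; exists (cone x y, (coordX x y (cone x y) %/ n, coordY x y (cone x y) %/ n)).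
rewrite mem_iota mem_triangle /=; split=> //.
by rewrite ltnNge; apply: contra nE => /in_power_le; apply.
Qed.

(** A monomial in m^k W_t has slope at least k n in every cone, but a monomial
    in the cell (A, B + 1) has slope less than (A + B + 3) n. *)
Lemma size_outside_ge t k : e * ((k - 2) * (k - 1)) <= 2 * size (outside t k).
Proof.
case: k => [|[|k]]; rewrite ?muln0 //.
have -> : (k.+2 - 2) * (k.+2 - 1) = k * k.+1 by rewrite !subSS !subn0.
rewrite -(size_triangle k) mulnCA leq_pmul2l // -(size_map (fun xy => cell xy.1 xy.2) (outside _ _)).
rewrite -[e in X in X <= _](size_iota 0 e).
rewrite -(size_allpairs (fun i AB => (i, AB.1, AB.2.+1))).
apply: uniq_leq_size.
  apply: allpairs_uniq; rewrite ?iota_uniq ?triangle_uniq //.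
  by move=> [? [? ?]] [? [? ?]] _ _ /= [-> -> ->].
move=> c /allpairsP[[i [A B]] /= []]; rewrite mem_iota mem_triangle add0n => /andP[_ ie] AB ->.
have [x [y [wt cE]]] := cell_surj t A B ie.
apply/mapP; exists (x, y) => //; rewrite mem_outside // wt eqxx andTb.
apply/negP => /(in_power_slope ie).
have [_ le1 le2] := coneP x y; case: cE => cE AE BE; rewrite cE in le1 le2 AE BE.
rewrite (slope_coord ie le1 le2).
have := divn_eq (coordX x y i) n; have := divn_eq (coordY x y i) n.
rewrite AE BE; have := ltn_pmod (coordX x y i) n_gt0; have := ltn_pmod (coordY x y i) n_gt0.
nia.
Qed.

Lemma size_outside1_le t : size (outside t 1) <= e.
Proof. by have := size_outside_le t 1; lia. Qed.

(** For t = 0 the only generator is the constant 1. *)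
Lemma size_outside10 t : n %| t -> size (outside t 1) <= 1.
Proof.
move=> nt; rewrite -[X in _ <= X]/(size [:: (0, 0)]).
apply: uniq_leq_size; first exact: outside_uniq.
move=> [x y]; rewrite mem_outside // inE => /andP[/eqP wt nE].
apply: contraR nE => xy0; apply/in_powerS; exists x, y; split=> //.
- by case: x y xy0 {wt} => [|x] [|y].
- by rewrite /dvdn wt; exact: nt.
- by rewrite !subnn /= muln0 mod0n eq_sym; exact: nt.
Qed.

End Cones.

(** ** Weights dividing every invariant monomial *)

(** The two cases are t = (t mod a) + a (t div a), if y is large enough, and
    t = (t - a y) + a y. *)
Lemma exists_divisor a n x y t : a.-1 <= x -> n <= x + a * y -> 0 < a -> t < n ->
  exists x' y', [/\ x' <= x, y' <= y & x' + a * y' = t].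
Proof.
move=> ax nxy a0 tn; have := divn_eq t a; have := ltn_pmod t a0.
case: (leqP (t %/ a) y) => [ty|yt] ta tE.
  by exists (t %% a), (t %/ a); split=> //; lia.
exists (t - a * y), y; split=> //; first by lia.
by rewrite subnK // mulnC; apply: leq_trans (leq_divM t a); rewrite leq_mul2r ltnW ?orbT.
Qed.

(** If n + 1 = a b then b is inverse to a modulo n, and the weights y + b x and
    x + a y determine each other.  So the previous lemma applies to (x, y) if
    x >= a - 1 and to (y, x) if y >= b - 1; otherwise x + a y < n. *)
Lemma divisors_cover a n t x y : 0 < a < n -> a %| n + 1 ->
    0 < x + y -> n %| x + a * y ->
  exists x' y', [/\ x' <= x, y' <= y & x' + a * y' = t %[mod n]].
Proof.
move=> /andP[a0 an] /dvdnP[b ab] xy0 nxy.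
have n0 : 0 < n by lia.
have xy_ge : n <= x + a * y.
  by apply: dvdn_leq => //; case: x y xy0 {nxy} => [|x] [|y]; nia.
case: (leqP a.-1 x) => [ax|xa].
  have [x' [y' [xx yy E]]] := exists_divisor ax xy_ge a0 (ltn_pmod t n0).
  by exists x', y'; rewrite E modn_mod.
case: (leqP b.-1 y) => [by1|yb]; last first.
  have : x + a * y < n by nia.
  by rewrite ltnNge xy_ge.
have b0 : 0 < b by case: b ab {by1} => //; lia.
have nyx : n %| y + b * x.
  have : n %| b * (x + a * y) by exact: dvdn_mull.
  have -> : b * (x + a * y) = (y + b * x) + n * y by nia.
  by rewrite dvdn_addl // dvdn_mulr.
have yx_ge : n <= y + b * x.
  by apply: dvdn_leq => //; case: x y xy0 {nxy xy_ge nyx xa by1} => [|x] [|y]; nia.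
have [y' [x' [yy xx E]]] := exists_divisor by1 yx_ge b0 (ltn_pmod (b * t) n0).
exists x', y'; split=> //.
have abE m : a * (b * m) = m %[mod n].
  by rewrite mulnA [a * b]mulnC -ab mulnDl mul1n mulnC modnMDl.
have <- : a * (y' + b * x') = t %[mod n] by rewrite E modnMmr abE.
by rewrite mulnDr -[RHS]modnDmr abE modnDmr addnC.
Qed.

Section Special.
Variables (n a e : nat) (p q : nat -> nat).
Hypothesis bd : boundary n a e p q.
Hypotheses (a_gt1 : 1 < a) (a_ltn : a < n) (co_an : coprime a n).

(** From v_0 = (n, 0) and v_1 = (n - a, 1) on, the boundary follows a line as
    long as it stays in the quadrant. *)
Lemma boundary_start i : 0 < i -> i <= n %/ a ->
  [/\ i < e, p i = n - i * a & q i = i] /\ p i.-1 = n - i.-1 * a /\ q i.-1 = i.-1.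
Proof.
have e1 := bd_e bd; have divn := leq_divM n a.
have rem : 0 < n %% a.
  rewrite lt0n; apply/negP => /eqP na; have : a %| n by apply/eqP.
  by move/gcdn_idPl; move: co_an; rewrite /coprime => /eqP ->; lia.
have nE := divn_eq n a.
elim: i => // -[_ _ ia|i IHi _ ia].
  rewrite (bd_p1 bd) (bd_q1 bd) (bd_p0 bd) (bd_q0 bd) /= mul1n mul0n subn0.
  by split=> //; split=> //; lia.
have [||[ie pE qE] [pE' qE']] := IHi; try lia; rewrite /= in pE' qE'.
have [c [c1 pc qc]] := bd_convex bd ie.
have plt := bd_p_lt bd ie.
have aE : i.+2 * a <= n by apply: leq_trans divn; rewrite leq_mul2r ia orbT.
have c2 : c = 2.
  by apply/eqP; rewrite eqn_leq c1 andbT -ltnS ltnNge; apply/negP => c3; nia.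
subst c; have pE2 : p i.+2 = n - i.+2 * a by lia.
split; last by split.
split; [|exact: pE2|lia].
have p2 : 0 < p i.+2 by rewrite pE2; nia.
have : i.+2 <= e by [].
rewrite leq_eqVlt => /predU1P[ie2|//].
by move: p2; rewrite ie2 (bd_pe bd).
Qed.

(** Let n = s a + r be the division of n by a, and t = - (r + 1).  Since r < a,
    the boundary point v_s = (r, s) is a vertex.  The module W_t is the ideal of
    the invariants divisible by x^(r + 1), divided by x^(r + 1); as such it
    needs e generators: the v_j for j < s, and the v_s + v_j for s <= j < e.  A
    divisor x^i y^j of the monomial at v_s of weight t would satisfy
    i + 1 = a (s - j) with i <= r < a, whence r = a - 1 and a divides n + 1. *)
Lemma special_weight : ~~ (a %| n + 1) -> exists t x y,
  [/\ e <= size (outside n a t 1), 0 < x + y, n %| x + a * y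
    & forall x' y', x' <= x -> y' <= y -> x' + a * y' <> t %[mod n]].
Proof.
move=> a_ndvd; have n0 : 0 < n by lia.
have nE := divn_eq n a; have r_lta : n %% a < a by rewrite ltn_mod; lia.
have s_gt0 : 0 < n %/ a by rewrite divn_gt0; lia.
have r_gt0 : 0 < n %% a.
  rewrite lt0n; apply/negP => /eqP na; have : a %| n by apply/eqP.
  by move/gcdn_idPl; move: co_an; rewrite /coprime => /eqP ->; lia.
have [[se ps qs] [ps' qs']] := boundary_start s_gt0 (leqnn _).
set s := n %/ a in nE s_gt0 se ps qs ps' qs'; set r := n %% a in nE r_lta r_gt0.
have psE : p s = r by lia.
have ps1 : p s.-1 = r + a.
  have : s.-1 * a + a = s * a by rewrite -mulSnr prednK.
  by rewrite ps'; lia.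
have qstep j : s <= j -> j < e -> q j + s < q j.+1.
  move=> /subnK <-; elim: (j - s) => [|d IHd]; rewrite ?add0n => je.
    have := @bd_convex _ _ _ _ _ bd s.-1; rewrite prednK // => /(_ je)[c [c1 pc qc]].
    have c3 : 2 < c.
      rewrite ltnNge; apply/negP => c2; have cE : c = 2 by lia.
      by move: pc; rewrite cE psE ps1; lia.
    rewrite qs; rewrite qs qs' in qc; nia.
  rewrite addSn in je *; have [c [c1 pc qc]] := bd_convex bd je.
  by have := IHd ltac:(lia); nia.
have r1n : r.+1 < n by lia.
exists (n - r.+1), r, s; split.
- pose pt j := if j < s then (p j - r.+1, q j) else (p j - 1, s + q j).
  have p_gt0 j : j < e -> 0 < p j by move=> je; have := bd_p_lt bd je; lia.
  have p_gtr j : j < s -> r < p j.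
    by move=> js; rewrite -psE; apply: (p_mono_lt bd) => //; exact: ltnW.
  have ptw j : j < e -> (pt j).1 + a * (pt j).2 = n - r.+1 %[mod n].
    move=> je; apply/eqP; rewrite -(eqn_modDr r.+1) subnK; last exact: ltnW.
    have /dvdnP[m w] := bd_weight bd (ltnW je).
    rewrite /pt modnn; case: ifP => js /=.
      rewrite addnAC subnK; last exact: p_gtr.
      by rewrite w modnMl.
    have -> : p j - 1 + a * (s + q j) + r.+1 = m * n + n.
      by rewrite -w; have := p_gt0 j je; lia.
    by rewrite modnMDl modnn.
  have ptE j : j < e -> ~~ in_power n a (n - r.+1) 1 (pt j).1 (pt j).2.
    move=> je; apply/negP => /in_powerS[u [v [ux vy uv0 uvn _]]].
    have [i [ie pu qv]] := invariant_ge bd n0 uvn uv0.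
    have pj0 := p_gt0 j je.
    have ij : j < i.
      rewrite ltnNge; apply/negP => ij; have := p_mono bd ij (ltnW je).
      by move: ux; rewrite /pt; case: ifP => js /=; lia.
    have := q_mono bd ij ie; have := bd_q_lt bd je.
    move: vy; rewrite /pt; case: ifP => js /=; first by lia.
    have := qstep j _ je; rewrite leqNgt js => /(_ isT); lia.
  rewrite -[e](size_iota 0) -(size_map pt); apply: uniq_leq_size.
    rewrite map_inj_in_uniq ?iota_uniq // => j j'.
    rewrite !mem_iota !add0n => /andP[_ je] /andP[_ je'].
    have qlt i i' : i < i' -> i' < e -> (pt i).2 < (pt i').2.
      move=> ii' ie'; have := q_mono_lt bd n0 ii' (ltnW ie').
      by rewrite /pt; case: ifP => is_; case: ifP => is' /=; lia.
    by case: (ltngtP j j') => // jj' pp; [have := qlt _ _ jj' je'|have := qlt _ _ jj' je];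
      rewrite pp ltnn.
  move=> xy /mapP[j]; rewrite mem_iota add0n => /andP[_ je] ->.
  by rewrite [pt j]surjective_pairing mem_outside // (ptw j je) eqxx ptE.
- by lia.
- by rewrite addnC mulnC -nE dvdnn.
move=> x y xr ys /eqP; rewrite -(eqn_modDr r.+1) subnK; last exact: ltnW.
rewrite modnn => /dvdnP[m mE].
have m1 : m = 1.
  have : a * y <= s * a by rewrite mulnC leq_mul2r ys orbT.
  by case: m mE => [|[|m]] mE; nia.
rewrite m1 mul1n in mE; case/negP: a_ndvd.
have : a * (s - y) = x.+1 by rewrite mulnBr; lia.
case sy: (s - y) => [|[|d]] xE; [lia| |nia].
by apply/dvdnP; exists s.+1; lia.
Qed.

End Special.

Import numFieldNormedType.Exports.

Local Open Scope classical_set_scope.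
Local Open Scope ring_scope.

Local Notation span := Defs.span.

(** * Submodules, noetherian modules and associated primes *)

Section Submodules.
Context {A : comNzRingType}.

Lemma submoduleP (M : lmodType A) (N : set M) :
  submodule N <-> N 0 /\ forall r u v, N u -> N v -> N (r *: u + v).
Proof.
rewrite /submodule /GRing.submod_closed /GRing.linear_closed inE.
split=> -[N0 NL]; split=> //.
- by move=> r u v Nu Nv; have := NL r u v; rewrite !inE; apply.
- by move=> r u v; rewrite !inE; apply: NL.
Qed.

Lemma submodule0 (M : lmodType A) (N : set M) : submodule N -> N 0.
Proof. by case/submoduleP. Qed.

Lemma submoduleD (M : lmodType A) (N : set M) u v :
  submodule N -> N u -> N v -> N (u + v).
Proof. by case/submoduleP => _ NL Nu Nv; rewrite -[u]scale1r; apply: NL. Qed.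

Lemma submoduleZ (M : lmodType A) (N : set M) r u :
  submodule N -> N u -> N (r *: u).
Proof.
by case/submoduleP => N0 NL Nu; rewrite -[_ *: _]addr0; apply: NL.
Qed.

Lemma submoduleB (M : lmodType A) (N : set M) u v :
  submodule N -> N u -> N v -> N (u - v).
Proof.
move=> subN Nu Nv; rewrite -scaleN1r.
by apply: submoduleD => //; apply: submoduleZ.
Qed.

Lemma submodule_sum (M : lmodType A) (N : set M) I (s : seq I) (P : pred I) F :
  submodule N -> (forall i, P i -> N (F i)) -> N (\sum_(i <- s | P i) F i).
Proof.
move=> subN NF; apply: (big_ind N) => //; first exact: submodule0.
by move=> u v; apply: submoduleD.
Qed.

Lemma submodule_span (M : lmodType A) (X : set M) : submodule (span X).
Proof.
apply/submoduleP; split=> [N [subN _]|r u v Xu Xv N [subN XN]].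
  exact: submodule0.
by apply: submoduleD => //; [apply: submoduleZ => //; apply: Xu|apply: Xv].
Qed.

Lemma span_sub (M : lmodType A) (X N : set M) :
  submodule N -> X `<=` N -> span X `<=` N.
Proof. by move=> subN XN; apply: smallest_sub. Qed.

Lemma sub_span (M : lmodType A) (X : set M) : X `<=` span X.
Proof. exact: sub_gen_smallest. Qed.

Lemma spanS (M : lmodType A) (X Y : set M) : X `<=` Y -> span X `<=` span Y.
Proof.
by move=> XY; apply: span_sub; [exact: submodule_span|move=> u /XY/sub_span].
Qed.

Lemma span_nil (M : lmodType A) : span [set` [::] : seq M] = [set 0].
Proof.
apply/seteqP; split; last first.
  by move=> _ ->; exact: (submodule0 (submodule_span _)).
apply: span_sub => [|u].
  apply/submoduleP; split=> [|r u v /= -> ->] //.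
  by rewrite scaler0 addr0.
by rewrite /= in_nil.
Qed.

Lemma span_cons (M : lmodType A) (g : M) s w :
  span [set` g :: s] w <-> exists r v, span [set` s] v /\ w = r *: g + v.
Proof.
have sub_gs := submodule_span [set` g :: s].
split=> [|[r [v [sv ->]]]]; last first.
  apply: (submoduleD sub_gs).
    by apply: (submoduleZ _ sub_gs); apply: sub_span; rewrite /= mem_head.
  by apply: spanS sv => x /= xs; rewrite inE xs orbT.
move: w; apply: span_sub.
  have sub_s := submodule_span [set` s].
  apply/submoduleP; split=> [|r u1 u2 [r1 [v1 [sv1 ->]]] [r2 [v2 [sv2 ->]]]].
    by exists 0, 0; split; [exact: submodule0 sub_s|rewrite scale0r addr0].
  exists (r * r1 + r2), (r *: v1 + v2); split.
    by apply: (submoduleD sub_s) => //; apply: (submoduleZ _ sub_s).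
  by rewrite scalerDr scalerDl scalerA addrACA.
move=> u /=; rewrite inE => /predU1P[->|us].
  exists 1, 0; split; last by rewrite scale1r addr0.
  by apply: (submodule0 (submodule_span _)).
by exists 0, u; split; [exact: sub_span|rewrite scale0r add0r].
Qed.

Lemma span_codom (M : lmodType A) (I : finType) (g : I -> M) w :
  (exists c : I -> A, w = \sum_i c i *: g i) -> span [set` codom g] w.
Proof.
have sub_g := submodule_span [set` codom g].
case=> c ->; apply: (submodule_sum _ sub_g) => i _; apply: (submoduleZ _ sub_g).
by apply: sub_span; exact: codom_f.
Qed.

Lemma span_seqP (M : lmodType A) (s : seq M) w :
  span [set` s] w -> exists c : 'I_(size s) -> A, w = \sum_i c i *: s`_i.
Proof.
elim: s w => [|g s IHs] w.
  by rewrite span_nil => ->; exists (fun=> 0); rewrite big_ord0.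
move=> /span_cons[r [v [/IHs[c ->] ->]]].
exists (fun i => if unlift ord0 i is Some j then c j else r).
rewrite big_ord_recl unlift_none; congr (_ + _).
by apply: eq_bigr => i _; rewrite liftK.
Qed.

Definition fg (M : lmodType A) (N : set M) : Prop :=
  exists s : seq M, span [set` s] = N.

Definition noetherian : Prop := forall I : set A^o, submodule I -> fg I.

(** Induction on the generators of M: the coefficients of the first generator
    in the elements of N form an ideal, and lifts of generators of this ideal
    reduce N to its intersection with the span of the other generators. *)
Lemma noetherian_fg (M : lmodType A) (N : set M) :
  noetherian -> finitely_generated M -> submodule N -> fg N.
Proof.
move=> noethA [s sT] subN.
have {sT} : N `<=` span [set` s] by rewrite sT.
elim: s N subN => [|g s IHs] N subN Ns.
  exists [::]; apply/seteqP; split=> [|u Nu]; last exact: Ns.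
  by rewrite span_nil => _ ->; apply: submodule0.
pose I : set A^o := [set r | exists v, span [set` s] v /\ N ((r : A) *: g + v)].
have sub_s := submodule_span [set` s].
have subI : submodule I.
  apply/submoduleP; split.
    exists 0; split; first exact: submodule0 sub_s.
    by rewrite scale0r addr0; exact: submodule0.
  move=> r r1 r2 [v1 [sv1 N1]] [v2 [sv2 N2]]; exists (r *: v1 + v2); split.
    by apply: (submoduleD sub_s) => //; apply: (submoduleZ _ sub_s).
  have -> : (r *: r1 + r2 : A) *: g + (r *: v1 + v2) =
      r *: ((r1 : A) *: g + v1) + ((r2 : A) *: g + v2).
    by rewrite scalerDr scalerDl scalerA addrACA.
  by apply: submoduleD => //; apply: submoduleZ.
have [||s1 s1E] := IHs (N `&` span [set` s]).
- apply/submoduleP; split; first by split; [exact: submodule0|exact: submodule0 sub_s].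
  move=> r u v [Nu su] [Nv sv]; split.
    by apply: submoduleD => //; apply: submoduleZ.
  by apply: (submoduleD sub_s) => //; apply: (submoduleZ _ sub_s).
- by move=> u [].
have [si siE] := noethA _ subI.
have [f fP] : exists f : A -> M, forall r, I r ->
    span [set` s] (f r) /\ N (r *: g + f r).
  have /choice[f fP] : forall r : A, exists v, I r ->
      span [set` s] v /\ N (r *: g + v).
    move=> r; case: (pselect (I r)) => [[v vP]|nI]; first by exists v.
    by exists 0.
  by exists f.
exists ([seq r *: g + f r | r <- si] ++ s1).
apply/seteqP; split.
  apply: span_sub => // u /=; rewrite mem_cat => /orP[/mapP[r rsi ->]|us1].
    have Ir : I r by rewrite -siE; exact: sub_span.
    by case: (fP r Ir).
  have : span [set` s1] u by exact: sub_span.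
  by rewrite s1E => -[].
move=> w Nw; set L := _ ++ _.
have subL := submodule_span [set` L].
have [r [v [sv wE]]] := (span_cons g s w).1 (Ns w Nw).
have Ir : I r by exists v; split=> //; rewrite -wE.
have [u [Lu [v' [sv' uE]]]] : exists u, span [set` L] u /\
    exists v', span [set` s] v' /\ u = r *: g + v'.
  move: Ir; rewrite -siE => /span_seqP[c ->].
  exists (\sum_i c i *: ((si`_i : A) *: g + f (si`_i))); split.
    apply: (submodule_sum _ subL) => i _; apply: (submoduleZ _ subL).
    apply: sub_span => /=; rewrite mem_cat; apply/orP; left; apply/mapP.
    by exists si`_i; rewrite ?mem_nth.
  exists (\sum_i c i *: f si`_i); split.
    apply: (submodule_sum _ sub_s) => i _; apply: (submoduleZ _ sub_s).
    have Ii : I si`_i by rewrite -siE; apply: sub_span; exact: mem_nth.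
    by case: (fP _ Ii).
  rewrite scaler_suml -big_split; apply: eq_bigr => i _ /=.
  by rewrite scalerDr scalerA.
have Nu : N u.
  suff : span [set` L] `<=` N by apply.
  apply: span_sub => // x /=; rewrite mem_cat => /orP[/mapP[r' r'si ->]|xs1].
    have Ir' : I r' by rewrite -siE; exact: sub_span.
    by case: (fP r' Ir').
  have : span [set` s1] x by exact: sub_span.
  by rewrite s1E => -[].
rewrite -(subrK u w) addrC; apply: (submoduleD subL) => //.
apply: (spanS (X := [set` s1])); first by move=> x /= xs; rewrite mem_cat xs orbT.
rewrite s1E; split; first exact: submoduleB.
rewrite wE uE opprD addrACA subrr add0r.
exact: (submoduleB sub_s).
Qed.

(** The form in which locality enters the lemma of Nakayama. *)
Definition local_ring : Prop := forall f r : A,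
  maximal_ideal A f -> exists s, s * (1 - r * f) = 1.

(** If N is contained in f N + N' then it is contained in N': a generator g of
    N with g - f (r g + v) in N' is redundant modulo N', as 1 - r f is a
    unit. *)
Lemma nakayama (M : lmodType A) (N N' : set M) (f : A) :
    local_ring -> maximal_ideal A f -> submodule N' -> fg N ->
    (forall w, N w -> exists w', N w' /\ N' (w - f *: w')) ->
  N `<=` N'.
Proof.
move=> locA mf subN' [s <-] {N}; elim: s => [|g s IHs] sfN'.
  by rewrite span_nil => _ ->; exact: submodule0.
have sub_s := submodule_span [set` s].
have [|w0 [/span_cons[r [v [sv ->]]] gN']] := sfN' g.
  by apply: sub_span; rewrite /= mem_head.
have [c cE] := locA f r mf.
have gE : N' (g - (c * f) *: v).
  have -> : g - (c * f) *: v = c *: (g - f *: (r *: g + v)).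
    rewrite -[g in LHS]scale1r -cE -!scalerA -scalerBr; congr (_ *: _).
    by rewrite scalerBl scale1r scalerDr opprD addrA scalerA [r * f]mulrC.
  exact: submoduleZ.
have sN' : span [set` s] `<=` N'.
  apply: IHs => w sw.
  have [|w' [/span_cons[r' [v' [sv' ->]]] wN']] := sfN' w.
    by apply/span_cons; exists 0, w; rewrite scale0r add0r.
  exists ((r' * (c * f)) *: v + v'); split.
    by apply: (submoduleD sub_s) => //; apply: (submoduleZ _ sub_s).
  have -> : w - f *: ((r' * (c * f)) *: v + v') =
      (w - f *: (r' *: g + v')) + (f * r') *: (g - (c * f) *: v).
    rewrite scalerBr !scalerDr !scalerA -!mulrA [_ + f *: v' in RHS]addrC.
    by rewrite !opprD !addrA subrK addrAC.
  by apply: submoduleD => //; apply: submoduleZ.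
move=> w /span_cons[r' [v' [sv' ->]]].
apply: submoduleD => //; last exact: sN'.
apply: submoduleZ => //; rewrite -(subrK ((c * f) *: v) g).
by apply: submoduleD => //; apply: sN'; apply: (submoduleZ _ sub_s).
Qed.

Lemma prime_idealP (P : set A) :
  prime_ideal P <->
  [/\ submodule (P : set A^o), ~ P 1 & forall a b, P (a * b) -> P a \/ P b].
Proof.
rewrite /prime_ideal /idealr_closed /prime_idealr_closed.
split=> [[[P0 P1 PL] PM]|[/submoduleP[P0 PL] P1 PM]]; split.
- apply/submoduleP; rewrite !inE in P0; split=> // r u v Pu Pv.
  by have := PL r u v; rewrite !inE; apply.
- by move/negP: P1; apply: contra_not => P1; apply/mem_set.
- by move=> a b /mem_set/PM/orP[] /set_mem; auto.
- split; first by rewrite inE.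
  + by apply/negP => /set_mem.
  + by move=> r u v; rewrite !inE; apply: PL.
- by move=> a b /set_mem/PM[] /mem_set ->; rewrite ?orbT.
Qed.

(** The annihilator of the class of w in M / K; quotient modules are handled
    through the submodules of M that define them. *)
Definition colon (M : lmodType A) (K : set M) (w : M) : set A :=
  [set r | K (r *: w)].

Lemma submodule_colon (M : lmodType A) (K : set M) w :
  submodule K -> submodule (colon K w : set A^o).
Proof.
move=> subK; apply/submoduleP; rewrite /colon /=; split.
  by rewrite scale0r; exact: submodule0.
move=> r u v Ku Kv; rewrite scalerDl -scalerA.
by apply: submoduleD => //; apply: submoduleZ.
Qed.

(** Zorn's lemma is replaced by the choice of an increasing sequence in F, whose
    union is finitely generated. *)
Lemma noetherian_max (F : set (set A^o)) (I0 : set A^o) :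
    noetherian -> (forall I, F I -> submodule I) -> F I0 ->
  exists I, [/\ F I, I0 `<=` I & forall J, F J -> I `<=` J -> J `<=` I].
Proof.
move=> noethA Fsub F0; apply: contrapT => nomax.
have [g gP] : exists g : set A^o -> set A^o, forall I, F I -> I0 `<=` I ->
    [/\ F (g I), I `<=` g I & ~ (g I `<=` I)].
  have /choice[g gP] : forall I : set A^o, exists J, F I -> I0 `<=` I ->
      [/\ F J, I `<=` J & ~ (J `<=` I)].
    move=> I; apply: contrapT => noJ; apply: nomax.
    have [FI I0I] : F I /\ I0 `<=` I.
      by split; apply: contrapT => nI; apply: noJ; exists I.
    exists I; split=> // J FJ IJ; apply: contrapT => nJ.
    by apply: noJ; exists J.
  by exists g.
pose c k := iter k g I0.
have cP k : F (c k) /\ I0 `<=` c k.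
  elim: k => [|k [Fk Ik]]; first by split.
  by have [Fg kg _] := gP _ Fk Ik; split=> //= r /Ik/kg.
have cS k : c k `<=` c k.+1 by have [Fk Ik] := cP k; have [] := gP _ Fk Ik.
have cmono k l : (k <= l)%N -> c k `<=` c l.
  move=> /subnK <-; elim: (l - k)%N => // m IHm r /IHm; exact: cS.
pose U : set A^o := \bigcup_k c k.
have subU : submodule U.
  apply/submoduleP; split.
    by exists 0%N => //; exact: submodule0 (Fsub _ (cP 0%N).1).
  move=> r u v [k _ ku] [l _ lv]; exists (maxn k l) => //.
  have subc := Fsub _ (cP (maxn k l)).1.
  apply: submoduleD => //; first apply: submoduleZ => //.
    by apply: cmono ku; exact: leq_maxl.
  by apply: cmono lv; exact: leq_maxr.
have [s sU] := noethA _ subU.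
have [k sk] : exists k, [set` s] `<=` c k.
  have {sU} : [set` s] `<=` U by rewrite -sU; exact: sub_span.
  elim: s => [|r s IHs] sU; first by exists 0%N.
  have [|k sk] := IHs; first by move=> u us; apply: sU; rewrite /= inE us orbT.
  have [l _ rl] : U r by apply: sU; rewrite /= mem_head.
  exists (maxn k l) => u /=; rewrite inE => /predU1P[->|/sk].
    by apply: cmono rl; exact: leq_maxr.
  by apply: cmono; exact: leq_maxl.
have [Fk Ik] := cP k.
have [_ _] := gP _ Fk Ik; apply.
apply: subset_trans (span_sub (Fsub _ Fk) sk).
by rewrite sU => r kr; exists k.+1.
Qed.

(** A maximal member of the set of annihilators of nonzero classes is prime. *)
Lemma associated_prime (M : lmodType A) (K : set M) (w0 : M) :
    noetherian -> submodule K -> ~ K w0 ->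
  exists w, [/\ ~ K w, prime_ideal (colon K w) & colon K w0 `<=` colon K w].
Proof.
move=> noethA subK Kw0.
pose F : set (set A^o) := [set I | exists w, ~ K w /\ I = colon K w].
have [||I [[w [Kw ->]] w0w wmax]] := @noetherian_max F (colon K w0) noethA.
- by move=> _ [w [_ ->]]; exact: submodule_colon.
- by exists w0.
exists w; split=> //; apply/prime_idealP; split.
- exact: submodule_colon.
- by rewrite /colon /= scale1r.
move=> a b abw; have [|bw] := pselect (colon K w b); [by right|left].
apply: (wmax (colon K (b *: w))); first by exists (b *: w).
  by move=> r rw; rewrite /colon /= scalerA mulrC -scalerA; exact: submoduleZ.
by rewrite /colon /= scalerA.
Qed.

(** Passing to the quotient by a regular element strictly enlarges an
    associated prime: the part of M/K killed by p is not contained in f(M/K),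
    for otherwise it would be divisible by f, hence zero by Nakayama. *)
Lemma associated_prime_regular (M : lmodType A) (K : set M) (f : A) (w : M) :
    noetherian -> local_ring -> finitely_generated M -> submodule K ->
    maximal_ideal A f -> (forall u, K (f *: u) -> K u) ->
    ~ K w -> prime_ideal (colon K w) ->
  let K1 : set M := [set u | exists v, K (u - f *: v)] in
  exists w1, [/\ ~ K1 w1, prime_ideal (colon K1 w1),
    colon K w `<=` colon K1 w1, colon K1 w1 f & ~ colon K w f].
Proof.
move=> noethA locA fgM subK mf regf Kw /prime_idealP[_ _ prw] K1.
have subK1 : submodule K1.
  apply/submoduleP; split.
    by exists 0; rewrite scaler0 subrr; exact: submodule0.
  move=> r u1 u2 [v1 Kv1] [v2 Kv2]; exists (r *: v1 + v2).
  have -> : r *: u1 + u2 - f *: (r *: v1 + v2) =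
      r *: (u1 - f *: v1) + (u2 - f *: v2).
    by rewrite scalerDr scalerBr !scalerA [r * f]mulrC opprD addrACA.
  by apply: submoduleD => //; apply: submoduleZ.
have KK1 : K `<=` K1 by move=> u Ku; exists 0; rewrite scaler0 subr0.
pose N : set M := [set u | forall r, colon K w r -> K (r *: u)].
have subN : submodule N.
  apply/submoduleP; split=> [r _|r u v Nu Nv r' r'w].
    by rewrite scaler0; exact: submodule0.
  rewrite scalerDr scalerA mulrC -scalerA.
  by apply: submoduleD => //; [apply: submoduleZ => //; exact: Nu|exact: Nv].
have [u [Nu K1u]] : exists u, N u /\ ~ K1 u.
  apply: contrapT => noU; apply: Kw.
  apply: (nakayama (N := N) locA mf) => //; first exact: noetherian_fg.
  move=> u Nu; have [v Kv] : K1 u.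
    by apply: contrapT => nK1; apply: noU; exists u.
  exists v; split=> // r rw; apply: regf; rewrite scalerA mulrC -scalerA.
  have -> : r *: (f *: v) = r *: u - r *: (u - f *: v).
    by rewrite -scalerBr opprB addrC subrK.
  by apply: submoduleB => //; [exact: Nu|exact: submoduleZ].
have [w1 [K1w1 prw1 uw1]] := associated_prime noethA subK1 K1u.
exists w1; split=> //.
- by move=> r rw; apply: uw1; apply: KK1; apply: Nu.
- by apply: uw1; exists u; rewrite subrr; exact: submodule0.
- by move=> /regf.
Qed.

End Submodules.

(** * Power series in two variables *)

Section Series.
Variable K : fieldType.
Implicit Types f g h : series2 K.

Lemma coef2_congr f g i j : f = g -> coef2 f i j = coef2 g i j.
Proof. by move->. Qed.

Lemma coef2D f g i j : coef2 (f + g) i j = coef2 f i j + coef2 g i j.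
Proof. by []. Qed.

Lemma coef2N f i j : coef2 (- f) i j = - coef2 f i j.
Proof. by []. Qed.

Lemma coef2B f g i j : coef2 (f - g) i j = coef2 f i j - coef2 g i j.
Proof. by []. Qed.

Lemma coef20 i j : coef2 (0 : series2 K) i j = 0.
Proof. by []. Qed.

Lemma coef21 i j : coef2 (1 : series2 K) i j = ((i == 0%N) && (j == 0%N))%:R.
Proof. by []. Qed.

Lemma coef2M f g i j : coef2 (f * g) i j =
  \sum_(k < i.+1) \sum_(l < j.+1) coef2 f k l * coef2 g (i - k) (j - l).
Proof. by []. Qed.

(* Keeps simplification from unfolding products; coef2M does it on demand. *)
#[local] Opaque mul2.

Lemma coef2_sum I (s : seq I) (P : pred I) (F : I -> series2 K) i j :
  coef2 (\sum_(k <- s | P k) F k) i j = \sum_(k <- s | P k) coef2 (F k) i j.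
Proof. by elim/big_rec2: _ => //= k x y _ <-. Qed.

Lemma coef2M_neq0 f g i j : coef2 (f * g) i j != 0 ->
  exists k l, [/\ (k <= i)%N, (l <= j)%N, coef2 f k l != 0
    & coef2 g (i - k) (j - l) != 0].
Proof.
apply: contra_neqP => nokl; rewrite coef2M big1 // => k _; rewrite big1 // => l _.
apply: contra_not_eq nokl; rewrite mulf_eq0 negb_or => /andP[fkl gkl].
by exists k, l; rewrite !leq_ord.
Qed.

Lemma coef2M00 f g : coef2 (f * g) 0 0 = coef2 f 0 0 * coef2 g 0 0.
Proof. by rewrite coef2M !big_ord1. Qed.

Definition term (c : K) (p q : nat) : series2 K :=
  Series2 (fun i j => if (i == p) && (j == q) then c else 0).

Lemma coef2_term c p q i j :
  coef2 (term c p q) i j = if (i == p) && (j == q) then c else 0.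
Proof. by []. Qed.

Lemma coef2_termM c p q f i j : coef2 (term c p q * f) i j =
  if (p <= i)%N && (q <= j)%N then c * coef2 f (i - p) (j - q) else 0.
Proof.
rewrite coef2M; case: ifPn => [/andP[lepi leqj]|npq].
  have ltpi : (p < i.+1)%N by [].
  have ltqj : (q < j.+1)%N by [].
  rewrite (bigD1 (Ordinal ltpi)) //= (bigD1 (Ordinal ltqj)) //= !eqxx /=.
  rewrite big1 ?addr0 => [|l]; last first.
    by rewrite -val_eqE /= => /negPf ->; rewrite mul0r.
  rewrite big1 ?addr0 // => k; rewrite -val_eqE /= => /negPf kp.
  by rewrite big1 // => l _; rewrite kp mul0r.
rewrite big1 // => k _; rewrite big1 // => l _.
rewrite coef2_term; case: ifP => [/andP[/eqP kp /eqP lq]|_]; last first.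
  by rewrite mul0r.
by move: npq; rewrite -kp -lq !leq_ord.
Qed.

Lemma term_mul c d p q p' q' :
  term c p q * term d p' q' = term (c * d) (p + p') (q + q').
Proof.
apply: series2P => i j; rewrite coef2_termM !coef2_term.
case: ifPn => [/andP[lepi leqj]|npq].
  rewrite -(eqn_add2r p) -(eqn_add2r q (j - q)) !subnK // [(p' + p)%N]addnC.
  by rewrite [(q' + q)%N]addnC; case: ifP; rewrite ?mulr0.
case: ifP => // /andP[/eqP iE /eqP jE]; move: npq.
by rewrite iE jE !leq_addr.
Qed.

Lemma term_exp p q k : term 1 p q ^+ k = term 1 (p * k) (q * k).
Proof.
elim: k => [|k IHk]; last by rewrite exprS IHk term_mul mulr1 !mulnS.
rewrite expr0 !muln0; apply: series2P => i j.
by rewrite coef21 coef2_term; case: ifP.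
Qed.

Lemma term1_00 : term 1 0 0 = 1.
Proof. by rewrite -(muln0 0%N) -term_exp expr0. Qed.

Lemma termI c p q : c != 0 -> injective ( *%R (term c p q)).
Proof.
move=> c0 f g fg; apply: series2P => i j.
have := coef2_congr (p + i) (q + j) fg.
by rewrite !coef2_termM !leq_addr !addKn => /(mulfI c0).
Qed.

Lemma mulf2_eq0 f g : f * g = 0 -> f = 0 \/ g = 0.
Proof.
(* the product of the lexicographically first terms survives *)
have first h : h <> 0 -> exists i j, [/\ coef2 h i j != 0,
    forall i' j', (i' < i)%N -> coef2 h i' j' = 0
    & forall j', (j' < j)%N -> coef2 h i j' = 0].
  move=> h0; have [i0 [j0 h0ij]] : exists i j, coef2 h i j != 0.
    apply: contrapT => nh; apply: h0; apply: series2P => i j.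
    by apply: contrapT => /eqP hij; apply: nh; exists i, j.
  pose P i := `[< exists j, coef2 h i j != 0 >].
  have exP : exists i, P i by exists i0; apply/asboolP; exists j0.
  case: (ex_minnP exP) => i /asboolP exQ imin.
  case: (ex_minnP exQ) => j hij jmin; exists i, j; split=> //.
    move=> i' j' i'i; apply: contrapT => /eqP hij'.
    by move: i'i; rewrite ltnNge imin //; apply/asboolP; exists j'.
  by move=> j' j'j; apply: contrapT => /eqP /jmin; rewrite leqNgt j'j.
move=> fg0; have [->|/first[i [j [fij f1 f2]]]] := pselect (f = 0); first by left.
have [->|/first[k [l [gkl g1 g2]]]] := pselect (g = 0); first by right.
have ltik : (i < (i + k).+1)%N by rewrite ltnS leq_addr.
have ltjl : (j < (j + l).+1)%N by rewrite ltnS leq_addr.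
have := coef2_congr (i + k) (j + l) fg0; rewrite coef2M.
rewrite (bigD1 (Ordinal ltik)) //= (bigD1 (Ordinal ltjl)) //= !addKn.
rewrite big1 => [|j']; last first.
  rewrite -val_eqE /= => j'j; have [/f2 ->|lej] := ltnP j' j; first by rewrite mul0r.
  by rewrite (g2 (j + l - j')%N) ?mulr0 //; have := leq_ord j'; lia.
rewrite addr0 big1 ?addr0 => [|i'].
  by move/eqP; rewrite mulf_eq0 (negPf fij) (negPf gkl).
rewrite -val_eqE /= => i'i; rewrite big1 // => j' _.
have [/f1 ->|lei] := ltnP i' i; first by rewrite mul0r.
by rewrite (g1 (i + k - i')%N) ?mulr0 //; have := leq_ord i'; lia.
Qed.

(** ** Order and limits *)

Definition ordge k f := forall i j, (i + j < k)%N -> coef2 f i j = 0.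

Lemma ordge0 f : ordge 0 f. Proof. by []. Qed.

Lemma ordge_zero k : ordge k 0. Proof. by []. Qed.

Lemma ordgeW k l f : (l <= k)%N -> ordge k f -> ordge l f.
Proof. by move=> lk fk i j ij; apply: fk; apply: leq_trans lk. Qed.

Lemma ordgeD k f g : ordge k f -> ordge k g -> ordge k (f + g).
Proof. by move=> fk gk i j ij; rewrite coef2D fk ?gk ?addr0. Qed.

Lemma ordgeN k f : ordge k f -> ordge k (- f).
Proof. by move=> fk i j ij; rewrite coef2N fk ?oppr0. Qed.

Lemma ordgeB k f g : ordge k f -> ordge k g -> ordge k (f - g).
Proof. by move=> fk gk; apply: ordgeD => //; apply: ordgeN. Qed.

Lemma ordge_sum k I (s : seq I) (P : pred I) (F : I -> series2 K) :
  (forall i, P i -> ordge k (F i)) -> ordge k (\sum_(i <- s | P i) F i).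
Proof. by move=> Fk; apply: big_ind => //; apply: ordgeD. Qed.

Lemma ordgeM k l f g : ordge k f -> ordge l g -> ordge (k + l) (f * g).
Proof.
move=> fk gl i j ij; apply: contrapT => /eqP/coef2M_neq0[i' [j' [i'i j'j]]].
have [lt_k|le_k] := ltnP (i' + j') k; first by rewrite fk ?eqxx.
by rewrite gl ?eqxx //; lia.
Qed.

Lemma ordge_term k c p q : (k <= p + q)%N -> ordge k (term c p q).
Proof.
move=> kpq i j; rewrite coef2_term; case: ifP => // /andP[/eqP -> /eqP ->].
by rewrite ltnNge kpq.
Qed.

Lemma ordge_eq0 f : (forall k, ordge k f) -> f = 0.
Proof. by move=> fk; apply: series2P => i j; apply: (fk (i + j).+1). Qed.

Lemma series2_lim (s : nat -> series2 K) :
  (forall k, ordge k (s k.+1 - s k)) -> exists f, forall k, ordge k (f - s k).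
Proof.
move=> sk; exists (Series2 (fun i j => coef2 (s (i + j).+1) i j)) => k i j ij.
rewrite coef2B /=; suff sd d : coef2 (s ((i + j).+1 + d)%N) i j =
    coef2 (s (i + j).+1) i j.
  by rewrite -(sd (k - (i + j).+1)%N) subnKC // subrr.
elim: d => [|d <-]; first by rewrite addn0.
apply/eqP; rewrite -subr_eq0 addnS -coef2B; apply/eqP; apply: sk.
by rewrite addSn ltnS leq_addr.
Qed.

Lemma ordgeX f k : ordge 1 f -> ordge k (f ^+ k).
Proof.
move=> f1; elim: k => // k IHk; rewrite exprS -add1n; exact: ordgeM.
Qed.

(** The inverse of 1 - h is the limit of the partial sums of its geometric
    series. *)
Lemma unit2P f : coef2 f 0 0 != 0 -> exists g, f * g = 1.
Proof.
move=> f00; pose h := 1 - term (coef2 f 0 0)^-1 0 0 * f.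
have h1 : ordge 1 h.
  move=> [|//] [|//] _; rewrite coef2B coef2_termM coef21 /= subnn mulVf //.
  by rewrite subrr.
have [|g gP] := @series2_lim (fun k => \sum_(i < k) h ^+ i).
  by move=> k; rewrite big_ord_recr /= addrAC subrr add0r; exact: ordgeX.
exists (term (coef2 f 0 0)^-1 0 0 * g); rewrite mulrA [f * _]mulrC.
apply/eqP; rewrite -subr_eq0; apply/eqP/ordge_eq0 => k.
have -> : term (coef2 f 0 0)^-1 0 0 * f = 1 - h by rewrite opprB addrC subrK.
have -> : (1 - h) * g - 1 = (1 - h) * (g - \sum_(i < k) h ^+ i) - h ^+ k.
  have hk : (1 - h) * \sum_(i < k) h ^+ i = 1 - h ^+ k.
    by rewrite -opprB mulNr -subrX1 opprB.
  rewrite [in RHS]mulrBr hk; move: (_ * g) (h ^+ k) => x y.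
  by rewrite opprB addrA addrAC addrK.
apply: ordgeB; last exact: ordgeX.
by rewrite -[k in ordge k]add0n; apply: ordgeM.
Qed.

(** ** Splitting a series along finitely many monomials *)

(** Every monomial of f is assigned to one of the monomials x^(p t) y^(q t)
    dividing it; the predicate Q passes what is known about the cofactors, such
    as their weights, to the series g t. *)
Lemma term_decomp (I : finType) (p q : I -> nat) (Q : I -> nat -> nat -> Prop) f :
    (forall i j, coef2 f i j != 0 -> exists t,
      [/\ (p t <= i)%N, (q t <= j)%N & Q t (i - p t)%N (j - q t)%N]) ->
  exists2 g : I -> series2 K, f = \sum_t term 1 (p t) (q t) * g t
    & forall t i j, coef2 (g t) i j != 0 -> Q t i j.
Proof.
move=> fQ; have /choice[c cP] : forall ij : nat * nat, exists o : option I,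
    coef2 f ij.1 ij.2 != 0 -> exists t, [/\ o = Some t, (p t <= ij.1)%N,
      (q t <= ij.2)%N & Q t (ij.1 - p t)%N (ij.2 - q t)%N].
  move=> [i j] /=.
  have [fij|fij] := pselect (coef2 f i j != 0); last by exists None.
  by have [t tP] := fQ _ _ fij; exists (Some t) => _; exists t; case: tP.
exists (fun t => Series2 (fun i j =>
  if c (i + p t, j + q t)%N == Some t then coef2 f (i + p t) (j + q t) else 0)).
  apply: series2P => i j; rewrite coef2_sum.
  have [fij|fij] := eqVneq (coef2 f i j) 0.
    rewrite fij big1 // => t _; rewrite coef2_termM; case: ifP => // /andP[pi qj].
    by rewrite /= !subnK //; case: ifP; rewrite ?fij ?mulr0.
  have /= [t [ct pi qj _]] := cP (i, j) fij.
  rewrite (bigD1 t) //= [X in _ + X]big1 ?addr0 => [|t' t't].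
    by rewrite coef2_termM pi qj /= !subnK // ct eqxx mul1r.
  rewrite coef2_termM; case: ifP => // /andP[pi' qj'].
  rewrite /= !subnK // ct; case: eqP => [[tt']|]; last by rewrite mulr0.
  by rewrite tt' eqxx in t't.
move=> t i j /=; case: ifP => [/eqP ct fij|_]; last by rewrite eqxx.
have [t' /=] := cP (i + p t, j + q t)%N fij; rewrite ct => -[[<-]] _ _.
by rewrite !addnK.
Qed.

End Series.

#[local] Opaque mul2.

(** ** The ring of series is noetherian *)

(** Dickson's lemma: with one point (p, q) of X given, the points of X that are
    not above it lie in finitely many rows and columns. *)
Lemma dickson (X : set (nat * nat)) : exists s : seq (nat * nat),
  (forall x, x \in s -> X x) /\
  (forall x, X x -> exists y, [/\ y \in s, (y.1 <= x.1)%N & (y.2 <= x.2)%N]).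
Proof.
have [[[p q] Xpq]|nX] := pselect (exists x, X x); last first.
  by exists [::]; split=> // x Xx; case: nX; exists x.
(* least elements of the rows below p and of the columns left of q *)
have /choice[r rP] : forall i, exists o : option nat,
    (forall j, X (i, j) -> exists2 m, o = Some m & (m <= j)%N) /\
    (forall m, o = Some m -> X (i, m)).
  move=> i; have [exj|nj] := pselect (exists j, `[< X (i, j) >]).
    case: (ex_minnP exj) => m /asboolP Xm mmin; exists (Some m); split.
      by move=> j Xj; exists m => //; apply: mmin; apply/asboolP.
    by move=> _ [<-].
  by exists None; split=> // j Xj; case: nj; exists j; apply/asboolP.
have /choice[c cP] : forall j, exists o : option nat,
    (forall i, X (i, j) -> exists2 m, o = Some m & (m <= i)%N) /\
    (forall m, o = Some m -> X (m, j)).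
  move=> j; have [exi|ni] := pselect (exists i, `[< X (i, j) >]).
    case: (ex_minnP exi) => m /asboolP Xm mmin; exists (Some m); split.
      by move=> i Xi; exists m => //; apply: mmin; apply/asboolP.
    by move=> _ [<-].
  by exists None; split=> // i Xi; case: ni; exists i; apply/asboolP.
pose sr := pmap (fun i => omap (fun m => (i, m)) (r i)) (iota 0 p).
pose sc := pmap (fun j => omap (fun m => (m, j)) (c j)) (iota 0 q).
exists ((p, q) :: sr ++ sc); split.
  move=> x; rewrite inE mem_cat => /predU1P[->//|/orP[]];
    rewrite mem_pmap => /mapP[k _].
    by case rk: (r k) => [m|//] [->]; apply: (rP k).2.
  by case ck: (c k) => [m|//] [->]; apply: (cP k).2.
move=> [i j] Xij; have [le_pi|lt_ip] := leqP p i; last first.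
  have [m rm mj] := (rP i).1 j Xij; exists (i, m); split=> //.
  rewrite inE mem_cat mem_pmap; apply/orP; right; apply/orP; left.
  by apply/mapP; exists i; rewrite ?mem_iota // rm.
have [le_qj|lt_jq] := leqP q j; last first.
  have [m cm mi] := (cP j).1 i Xij; exists (m, j); split=> //.
  rewrite inE !mem_cat !mem_pmap; apply/orP; right; apply/orP; right.
  by apply/mapP; exists j; rewrite ?mem_iota // cm.
by exists (p, q); rewrite mem_head.
Qed.

Section Noetherian.
Variable K : fieldType.
Implicit Types f g h : series2 K.

(** Position of the leading term: least degree first, then least power of x. *)
Definition leads f (x : nat * nat) : Prop :=
  coef2 f x.1 x.2 != 0 /\
  forall i j, (i + j < x.1 + x.2)%N \/ (i + j = x.1 + x.2 /\ i < x.1)%N ->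
    coef2 f i j = 0.

(** By Dickson's lemma finitely many F l in the ideal have leading positions that
    divide all others.  Combinations of the F l remove the homogeneous parts of
    an element one degree after the other, monomial by monomial, and the
    coefficients used have increasing order, so that they can be summed. *)
Lemma series2_noetherian : noetherian (A := series2 K).
Proof.
move=> I subI.
pose X : set (nat * nat) := [set x | exists f, I f /\ leads f x].
have [s [sX Xs]] := dickson X.
pose m := size s; pose t (k : 'I_m) := nth (0, 0)%N s k.
have tX k : X (t k) by apply: sX; exact: mem_nth.
have [F /all_and2[IF FP]] := choice tX.
pose D := (\max_(k < m) ((t k).1 + (t k).2))%N.
have IL (c : 'I_m -> series2 K) : I (\sum_k c k * F k).
  by apply: (submodule_sum _ subI) => k _; exact: (submoduleZ (c k) subI (IF k)).
have step k i f : I f -> ordge k f -> (i <= k.+1)%N ->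
    (forall i', (i' < i)%N -> coef2 f i' (k - i') = 0) ->
    exists g : 'I_m -> series2 K,
      (forall l, ordge (k - D) (g l)) /\ ordge k.+1 (f - \sum_l g l * F l).
  move di : (k.+1 - i)%N => d; elim: d i di f => [|d IHd] i di f If fk ik fi.
    exists (fun=> 0); split; first by move=> l; exact: ordge_zero.
    rewrite big1 ?subr0 => [|l _]; last by rewrite mul0r.
    move=> i' j' ij'; have [lt_k|le_k] := ltnP (i' + j') k; first exact: fk.
    have -> : j' = (k - i')%N by lia.
    by apply: fi; lia.
  have [fik|fik] := eqVneq (coef2 f i (k - i)) 0.
    apply: (IHd i.+1) => //; try lia.
    by move=> i'; rewrite ltnS leq_eqVlt => /predU1P[->//|/fi].
  have Xik : X (i, k - i)%N.
    exists f; split=> //; split=> //= i' j' [ij'|[ij' i'i]].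
      by apply: fk; lia.
    have -> : j' = (k - i')%N by lia.
    exact: fi.
  have [y [ys /= y1 y2]] := Xs _ Xik.
  have [l yl] : exists l, y = t l.
    have lts : (index y s < m)%N by rewrite index_mem.
    by exists (Ordinal lts); rewrite /t /= nth_index.
  have [ly1 ly2] : ((t l).1 <= i)%N /\ ((t l).2 <= k - i)%N by rewrite -yl.
  have [Fl Fl0] := FP l.
  pose g0 := term (coef2 f i (k - i) / coef2 (F l) (t l).1 (t l).2)
    (i - (t l).1) (k - i - (t l).2).
  have le_D : ((t l).1 + (t l).2 <= D)%N.
    exact: (leq_bigmax (F := fun l => (t l).1 + (t l).2)%N).
  have g0E i' j' : (i' + j' < k)%N \/ (i' + j' = k /\ i' < i)%N ->
      coef2 (g0 * F l) i' j' = 0.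
    move=> ij'; rewrite coef2_termM; case: ifP => // /andP[i'i j'j].
    by rewrite [coef2 (F l) (i' - _) _]Fl0 ?mulr0 //; lia.
  have If1 : I (f - g0 * F l).
    exact: (submoduleB subI If (submoduleZ g0 subI (IF l))).
  have [||||g [gk fg]] := IHd i.+1 _ (f - g0 * F l) If1; try lia.
  - by move=> i' j' ij'; rewrite coef2B fk // g0E ?subr0 //; left.
  - move=> i'; rewrite ltnS leq_eqVlt => /predU1P[->|i'i].
      rewrite coef2B coef2_termM !leq_subr /= !subKn //.
      by rewrite divfK // subrr.
    rewrite coef2B fi // g0E ?subr0 //; right; lia.
  exists (fun l' => (if l' == l then g0 else 0) + g l'); split.
    move=> l'; apply: ordgeD; last exact: gk.
    case: ifP => _; last exact: ordge_zero.
    by apply: ordge_term; lia.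
  suff -> : \sum_l' ((if l' == l then g0 else 0) + g l') * F l' =
      g0 * F l + \sum_l g l * F l by rewrite opprD addrA.
  under eq_bigr do rewrite mulrDl.
  rewrite big_split /= (bigD1 l) //= eqxx big1 ?addr0 // => l' /negPf ->.
  by rewrite mul0r.
have /choice[G GP] : forall kf : nat * series2 K, exists g : 'I_m -> series2 K,
    I kf.2 -> ordge kf.1 kf.2 -> (forall l, ordge (kf.1 - D) (g l)) /\
      ordge kf.1.+1 (kf.2 - \sum_l g l * F l).
  move=> [k f] /=; have [If|nI] := pselect (I f); last by exists (fun=> 0).
  have [fk|nk] := pselect (ordge k f); last by exists (fun=> 0).
  by have [g gP] := step k 0%N f If fk isT (fun i (i0 : (i < 0)%N) => False_ind _ (notF i0)); exists g.
exists (codom F); apply/seteqP; split.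
  by apply: span_sub => // _ /codomP[k ->].
move=> /= f If; apply: span_codom.
move: f If => /= f If.
pose r := fix r k := if k is k'.+1 then
  r k' - \sum_l G (k', r k') l * F l else f.
have rP k : I (r k) /\ ordge k (r k).
  elim: k => [|k [Ik rk]] /=; first by split.
  have [_ rk1] := GP (k, r k) Ik rk; split=> //.
  exact: (submoduleB subI Ik (IL _)).
pose c k l := \sum_(k' < k) G (nat_of_ord k', r k') l.
have rE k : r k = f - \sum_l c k l * F l.
  elim: k => [|k IHk] /=.
    by rewrite big1 ?subr0 // => l _; rewrite /c big_ord0 mul0r.
  rewrite {1}IHk -addrA -opprD -big_split; congr (_ - _).
  by apply: eq_bigr => l _; rewrite /c big_ord_recr /= mulrDl.
have /choice[L LP] : forall l, exists g, forall k, ordge k (g - c (k + D)%N l).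
  move=> l; apply: series2_lim => k.
  rewrite addSn /c big_ord_recr /= addrAC subrr add0r.
  have [Ik rk] := rP (k + D)%N; have [Gk _] := GP (_, _) Ik rk.
  by have := Gk l; rewrite addnK.
suff fE : f = \sum_l L l * F l by exists L.
apply/eqP; rewrite -subr_eq0; apply/eqP; apply: ordge_eq0 => k.
have -> : f - \sum_l L l * F l = r (k + D)%N - \sum_l (L l - c (k + D)%N l) * F l.
  rewrite rE -addrA -opprD -big_split; congr (_ - _).
  by apply: eq_bigr => l _ /=; rewrite -mulrDl addrC subrK.
apply: ordgeB; first by apply: ordgeW (rP _).2; rewrite leq_addr.
apply: ordge_sum => l _.
exact: ordgeW (leq_addr 0 k) (ordgeM (LP l k) (ordge0 _)).
Qed.

End Noetherian.

(** * The eigenspaces as modules *)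

Section Eigenmodules.
Variables (K : fieldType) (z : K) (a t : nat).
Local Notation S := (series2 K).
Local Notation A := (cyclic_quotient z a).

(** The equation f(z x, z^a y) = z^t f(x, y), read on coefficients. *)
Definition eigenseries : {pred S} := [in [set f : S |
  forall i j, z ^+ (i + a * j) * coef2 f i j = z ^+ t * coef2 f i j]].

Lemma eigenseriesP (f : S) :
  reflect (forall i j, z ^+ (i + a * j) * coef2 f i j = z ^+ t * coef2 f i j)
          (f \in eigenseries).
Proof. by apply: (iffP idP); rewrite unfold_in inE. Qed.

Lemma eigenseries_zmod : zmod_closed eigenseries.
Proof.
split=> [|f g /eigenseriesP ft /eigenseriesP gt]; apply/eigenseriesP => i j.
  by rewrite coef20 !mulr0.
by rewrite coef2B !mulrBr ft gt.
Qed.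

HB.instance Definition _ :=
  GRing.isZmodClosed.Build S eigenseries eigenseries_zmod.

Record eigenmodule := Eigenmodule {
  em_val : S;
  em_valP : em_val \in eigenseries
}.

HB.instance Definition _ := [isSub for em_val].
HB.instance Definition _ := [Choice of eigenmodule by <:].
HB.instance Definition _ := [SubChoice_isSubZmodule of eigenmodule by <:].

Lemma em_scale_subproof (c : A) (u : eigenmodule) :
  val c * em_val u \in eigenseries.
Proof.
apply/eigenseriesP => i j; rewrite coef2M !mulr_sumr.
apply: eq_bigr => k _; rewrite !mulr_sumr; apply: eq_bigr => l _.
have /invariants_cyclicP/(_ k l) := cq_valP c.
have /eigenseriesP/(_ (i - k)%N (j - l)%N) := em_valP u => uE cE.
rewrite [RHS]mulrCA -uE -[in RHS]cE mulrACA -exprD.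
by congr (z ^+ _ * _); rewrite addnACA -mulnDr !subnKC // -ltnS ltn_ord.
Qed.

Definition em_scale (c : A) (u : eigenmodule) : eigenmodule :=
  Eigenmodule (em_scale_subproof c u).

Lemma em_valZ c u : val (em_scale c u) = val c * val u. Proof. by []. Qed.

Lemma em_val0 : val (0 : eigenmodule) = 0. Proof. by []. Qed.
Lemma em_valD (u v : eigenmodule) : val (u + v) = val u + val v.
Proof. by []. Qed.
Lemma em_valB (u v : eigenmodule) : val (u - v) = val u - val v.
Proof. by []. Qed.
Lemma em_val_sum I (s : seq I) (P : pred I) (F : I -> eigenmodule) :
  val (\sum_(i <- s | P i) F i) = \sum_(i <- s | P i) val (F i).
Proof. by elim/big_rec2: _ => //= i x y _ <-. Qed.

Lemma em_scaleA c d u : em_scale c (em_scale d u) = em_scale (c * d) u.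
Proof. by apply: val_inj; rewrite !em_valZ mulrA. Qed.

Lemma em_scale1 : left_id 1 em_scale.
Proof. by move=> u; apply: val_inj; rewrite em_valZ mul1r. Qed.

Lemma em_scaleDr : right_distributive em_scale +%R.
Proof. by move=> c u v; apply: val_inj; rewrite em_valD !em_valZ em_valD mulrDr. Qed.

Lemma em_scaleDl u : {morph em_scale^~ u : c d / c + d}.
Proof. by move=> c d; apply: val_inj; rewrite em_valD !em_valZ -mulrDl. Qed.

HB.instance Definition _ := GRing.Zmodule_isLmodule.Build A eigenmodule
  em_scaleA em_scale1 em_scaleDr em_scaleDl.

Lemma em_val_scale (c : A) (u : eigenmodule) : val (c *: u) = val c * val u.
Proof. by []. Qed.

End Eigenmodules.

(** * The ring of invariants *)

Section Invariants.
Variables (K : fieldType) (n a : nat) (z : K).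
Hypotheses (n_gt1 : (1 < n)%N) (co_an : coprime a n).
Hypothesis prim_z : n.-primitive_root z.
Implicit Types f g h : series2 K.

Local Notation S := (series2 K).
Local Notation A := (cyclic_quotient z a).

Let n_gt0 : (0 < n)%N := ltnW n_gt1.

(** Since z is a primitive root, these are the eigenspaces of the generator of
    the group. *)
Definition W (t : nat) : set S :=
  [set f | `[< forall i j, coef2 f i j != 0 -> i + a * j = t %[mod n] >]].

Lemma WP t f :
  W t f <-> forall i j, coef2 f i j != 0 -> i + a * j = t %[mod n].
Proof. by split=> [/asboolP|?]; last exact/asboolP. Qed.

Lemma W_weight t f i j : W t f -> coef2 f i j != 0 -> i + a * j = t %[mod n].
Proof. by move/WP; apply. Qed.

Lemma W_mod s t f : s = t %[mod n] -> W s f -> W t f.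
Proof. by move=> st Wf; apply/WP => i j fij; rewrite -st; exact: W_weight fij. Qed.

Lemma W_zero t : W t 0.
Proof. by apply/WP => i j; rewrite eqxx. Qed.

Lemma WD t f g : W t f -> W t g -> W t (f + g).
Proof.
move=> Wf Wg; apply/WP => i j; rewrite coef2D.
have [->|/(W_weight Wf) //] := eqVneq (coef2 f i j) 0.
by rewrite add0r => /(W_weight Wg).
Qed.

Lemma WN t f : W t f -> W t (- f).
Proof. by move=> Wf; apply/WP => i j; rewrite coef2N oppr_eq0 => /(W_weight Wf). Qed.

Lemma WB t f g : W t f -> W t g -> W t (f - g).
Proof. by move=> Wf Wg; apply/WD/WN. Qed.

Lemma W_sum t I (s : seq I) (P : pred I) (F : I -> S) :
  (forall i, P i -> W t (F i)) -> W t (\sum_(i <- s | P i) F i).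
Proof. by move=> WF; apply: big_ind => //; [exact: W_zero|exact: WD]. Qed.

Lemma WM s t f g : W s f -> W t g -> W (s + t) (f * g).
Proof.
move=> Wf Wg; apply/WP => i j /coef2M_neq0[k [l [ki lj]]].
move=> /(W_weight Wf) kl /(W_weight Wg) ijkl.
have -> : (i + a * j = (k + a * l) + (i - k + a * (j - l)))%N.
  by rewrite addnACA -mulnDr !subnKC.
by rewrite -modnDm kl ijkl modnDm.
Qed.

Lemma W_one : W 0 1.
Proof.
apply/WP => [[|i]] [|j]; rewrite coef21 /= ?eqxx // => _.
by rewrite !muln0.
Qed.

Lemma W_exp t f k : W t f -> W (t * k) (f ^+ k).
Proof.
move=> Wf; elim: k => [|k IHk]; last by rewrite exprS mulnS; exact: WM.
by rewrite expr0 muln0; exact: W_one.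
Qed.

Lemma W_term c p q : W (p + a * q) (term c p q).
Proof.
apply/WP => i j; rewrite coef2_term; case: ifP => [/andP[/eqP -> /eqP ->] //|].
by rewrite eqxx.
Qed.

(** The coefficientwise projection on the part of weight t; for t = 0 it is
    the Reynolds operator. *)
Definition pi (t : nat) f : S :=
  Series2 (fun i j => if i + a * j == t %[mod n] then coef2 f i j else 0).

Lemma coef2_pi t f i j :
  coef2 (pi t f) i j = if i + a * j == t %[mod n] then coef2 f i j else 0.
Proof. by []. Qed.

Lemma pi_W t f : W t (pi t f).
Proof.
by apply/WP => i j; rewrite coef2_pi; case: ifP => [/eqP //|_]; rewrite eqxx.
Qed.

Lemma pi_id t f : W t f -> pi t f = f.
Proof.
move=> Wf; apply: series2P => i j; rewrite coef2_pi; case: ifP => // /eqP ij.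
by apply/esym; apply: contrapT => /eqP/(W_weight Wf).
Qed.

Lemma pi_eq0 s t f : W s f -> (s != t %[mod n]) -> pi t f = 0.
Proof.
move=> Wf st; apply: series2P => i j; rewrite coef2_pi; case: ifP => // /eqP ij.
by apply: contrapT => /eqP/(W_weight Wf) ijs; rewrite -ijs ij eqxx in st.
Qed.

Lemma piD t f g : pi t (f + g) = pi t f + pi t g.
Proof.
apply: series2P => i j; rewrite coef2D !coef2_pi coef2D.
by case: ifP; rewrite ?addr0.
Qed.

Lemma pi_zero t : pi t 0 = 0.
Proof. by apply: series2P => i j; rewrite coef2_pi coef20 if_same. Qed.

Lemma pi_sum t I (s : seq I) (P : pred I) (F : I -> S) :
  pi t (\sum_(i <- s | P i) F i) = \sum_(i <- s | P i) pi t (F i).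
Proof.
by elim/big_rec2: _ => [|i x y _ <-]; [exact: pi_zero|rewrite piD].
Qed.

Lemma piM s t f g : W s f -> pi (s + t) (f * g) = f * pi t g.
Proof.
move=> Wf; apply: series2P => i j; rewrite coef2_pi !coef2M.
have -> : (if i + a * j == s + t %[mod n] then
    \sum_(k < i.+1) \sum_(l < j.+1) coef2 f k l * coef2 g (i - k) (j - l)
    else 0) = \sum_(k < i.+1) \sum_(l < j.+1)
      (if i + a * j == s + t %[mod n] then
         coef2 f k l * coef2 g (i - k) (j - l) else 0).
  by case: ifP => // _; rewrite big1 // => k _; rewrite big1.
apply: eq_bigr => k _; apply: eq_bigr => l _; rewrite coef2_pi.
have [->|fkl] := eqVneq (coef2 f k l) 0; first by rewrite !mul0r if_same.
have -> : (i + a * j = (k + a * l) + (i - k + a * (j - l)))%N.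
  by rewrite addnACA -mulnDr !subnKC // -ltnS ltn_ord.
by rewrite -modnDml (W_weight Wf fkl) modnDml eqn_modDl; case: ifP; rewrite ?mulr0.
Qed.

Lemma sum_pi f : f = \sum_(t < n) pi t f.
Proof.
apply: series2P => i j; rewrite coef2_sum.
have lt_n : ((i + a * j) %% n < n)%N by rewrite ltn_mod.
rewrite (bigD1 (Ordinal lt_n)) //= modn_mod eqxx.
rewrite big1 ?addr0 // => t; rewrite -val_eqE /= => ne_t.
by rewrite ifN // (modn_small (ltn_ord t)) eq_sym.
Qed.

(** ** Elements of the ring *)

Lemma valA_W (r : A) : W 0 (val r).
Proof.
apply/WP => i j rij; have /invariants_cyclicP/(_ i j) := cq_valP r.
rewrite -[val r]/(cq_val r) in rij; rewrite -[in RHS](mul1r (coef2 _ _ _)).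
move=> /(mulIf rij)/eqP; rewrite -(prim_order_dvd prim_z) mod0n.
by move/eqP.
Qed.

Definition toA f : A := insubd (0 : A) f.

Lemma toAK f : W 0 f -> val (toA f) = f.
Proof.
move=> Wf; rewrite /toA val_insubd ifT //; apply/invariants_cyclicP => i j.
have [->|fij] := eqVneq (coef2 f i j) 0; first by rewrite mulr0.
suff /eqP -> : z ^+ (i + a * j) == 1 by rewrite mul1r.
by rewrite -(prim_order_dvd prim_z) /dvdn (W_weight Wf fij) mod0n.
Qed.

Lemma valA_inj (r s : A) : val r = val s -> r = s.
Proof. exact: val_inj. Qed.

Lemma valAM (r s : A) : val (r * s) = val r * val s. Proof. by []. Qed.
Lemma valAD (r s : A) : val (r + s) = val r + val s. Proof. by []. Qed.
Lemma valAB (r s : A) : val (r - s) = val r - val s. Proof. by []. Qed.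
Lemma valA1 : val (1 : A) = 1. Proof. by []. Qed.
Lemma valA0 : val (0 : A) = 0. Proof. by []. Qed.

Lemma valAX (r : A) k : val (r ^+ k) = val r ^+ k.
Proof. by elim: k => // k IHk; rewrite !exprS valAM IHk. Qed.

Lemma valA_sum I (s : seq I) (P : pred I) (F : I -> A) :
  val (\sum_(k <- s | P k) F k) = \sum_(k <- s | P k) val (F k).
Proof. by elim/big_rec2: _ => //= k x y _ <-. Qed.

Definition cst c : A := toA (term c 0 0).

Lemma val_cst c : val (cst c) = term c 0 0.
Proof. by apply: toAK; have := @W_term c 0 0; rewrite muln0. Qed.

Lemma cst_mul c d : cst (c * d) = cst c * cst d.
Proof. by apply: valA_inj; rewrite valAM !val_cst term_mul. Qed.

Lemma cst1 : cst 1 = 1.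
Proof. by apply: valA_inj; rewrite val_cst term1_00. Qed.

Lemma cst0 : cst 0 = 0.
Proof.
by apply: valA_inj; rewrite val_cst; apply: series2P => i j /=; rewrite if_same.
Qed.

Definition xn : A := toA (term 1 n 0).
Definition yn : A := toA (term 1 0 n).

Lemma val_xn : val xn = term 1 n 0.
Proof.
apply: toAK; apply: W_mod (W_term 1 n 0).
by rewrite muln0 addn0 modnn mod0n.
Qed.

Lemma val_yn : val yn = term 1 0 n.
Proof.
apply: toAK; apply: W_mod (W_term 1 0 n).
by rewrite add0n modnMl mod0n.
Qed.

Lemma mulA_eq0 (r s : A) : r * s = 0 -> r = 0 \/ s = 0.
Proof.
move=> rs0; have : val r * val s = 0 by rewrite -valAM rs0.
by case/mulf2_eq0 => [r0|s0]; [left|right]; apply: valA_inj.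
Qed.

Lemma unitA_P (r : A) : coef2 (val r) 0 0 != 0 -> exists s, r * s = 1.
Proof.
move=> /unit2P[g rg]; exists (toA (pi 0 g)); apply: valA_inj.
rewrite valAM toAK; last exact: pi_W.
rewrite -(piM 0 g (valA_W r)) rg pi_id //; exact: W_one.
Qed.

Lemma maximal_idealE (r : A) :
  maximal_ideal A r <-> coef2 (val r) 0 0 = 0.
Proof.
rewrite /maximal_ideal /=; split=> [nr|r0 [s rs]].
  by apply: contrapT => /eqP/unitA_P.
have : coef2 (val (r * s)) 0 0 = coef2 (1 : S) 0 0 by rewrite rs.
by rewrite valAM coef2M00 r0 mul0r coef21 => /esym/eqP; rewrite oner_eq0.
Qed.

Lemma local_A : local_ring (A := A).
Proof.
move=> f r /maximal_idealE f0.
have [|s sE] := @unitA_P (1 - r * f).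
  rewrite valAB valAM coef2B coef2M00 f0 mulr0 subr0 coef21.
  exact: oner_neq0.
by exists s; rewrite mulrC.
Qed.

(** The Reynolds operator recovers an ideal of invariants from the ideal of S
    that it generates, and the latter is noetherian. *)
Lemma noetherian_A : noetherian (A := A).
Proof.
move=> I subI.
pose J (s : seq A) : set S^o := span [set` ([seq val r | r <- s] : seq S^o)].
pose F : set (set S^o) := [set N | exists2 s, [set` s] `<=` I & N = J s].
have [||N [[s sI ->] _ smax]] := @noetherian_max S F (J [::]) (@series2_noetherian K).
- by move=> _ [s _ ->]; exact: submodule_span.
- by exists [::].
exists s; apply/seteqP; split; first exact: span_sub.
move=> f If; have : J s (val f).
  apply: (smax (J (f :: s))); first exists (f :: s) => //.
  - by move=> r /=; rewrite inE => /predU1P[->//|/sI].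
  - by apply: spanS => g /=; rewrite inE => ->; rewrite orbT.
  - by apply: sub_span; rewrite /= mem_head.
move=> /span_seqP[c fE].
have {fE} : f = \sum_i toA (pi 0 (c i)) * s`_i.
  apply: valA_inj; rewrite valA_sum -[LHS](pi_id (valA_W f)) fE.
  rewrite pi_sum; apply: eq_bigr => i _.
  have lti : (i < size s)%N by rewrite -(size_map val s).
  rewrite valAM toAK; last exact: pi_W.
  rewrite (nth_map 0) // -[_ *: _]/(c i * val s`_i) !(mulrC _ (val _)).
  exact: (piM 0 (c i) (valA_W s`_i)).
move=> ->; have sub_s := submodule_span [set` s : seq A^o].
apply: (submodule_sum _ sub_s) => i _.
apply: (submoduleZ _ sub_s); apply: sub_span; apply: mem_nth.
by rewrite -(size_map val s).
Qed.

(** ** Krull dimension *)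

Lemma prime_exp (Q : set A) r k : prime_ideal Q -> Q (r ^+ k) -> Q r.
Proof.
case/prime_idealP => _ Q1 QM; elim: k => [|k IHk]; first by rewrite expr0.
by rewrite exprS => /QM[|/IHk].
Qed.

Lemma prime_dvd (Q : set A) r s : prime_ideal Q -> Q r -> Q (r * s).
Proof.
case/prime_idealP => subQ _ _ Qr; rewrite mulrC.
exact: (submoduleZ s subQ Qr).
Qed.

Lemma prime_add (Q : set A) r s : prime_ideal Q -> Q r -> Q s -> Q (r + s).
Proof. by case/prime_idealP => subQ _ _ Qr Qs; exact: (submoduleD subQ Qr Qs). Qed.

Lemma max_xn : maximal_ideal A xn.
Proof.
apply/maximal_idealE; rewrite val_xn coef2_term.
by rewrite eq_sym (gtn_eqF n_gt0).
Qed.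

Lemma max_yn : maximal_ideal A yn.
Proof.
apply/maximal_idealE; rewrite val_yn coef2_term.
by rewrite [(0 == n)%N]eq_sym (gtn_eqF n_gt0) andbF.
Qed.

(** The cofactor g has its n-th power invariant, as it is an eigenvector. *)
Lemma exp_xmul g (r : A) : val r = term 1 1 0 * g -> exists s, r ^+ n = xn * s.
Proof.
move=> rE; have Wg : W (n - 1) g.
  apply/WP => i j gij; apply/eqP; rewrite -(eqn_modDr 1) subnK //.
  rewrite modnn addnAC addn1; apply/eqP; rewrite -[RHS](mod0n n).
  apply: (W_weight (valA_W r)); rewrite rE coef2_termM /= subn1 subn0 mul1r; exact: gij.
exists (toA (g ^+ n)); apply: valA_inj; rewrite valAX valAM rE.
rewrite toAK ?val_xn; first by rewrite exprMn term_exp mul1n mul0n.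
by apply: W_mod (W_exp n Wg); rewrite modnMl mod0n.
Qed.

Lemma exp_ymul g (r : A) : val r = term 1 0 1 * g -> exists s, r ^+ n = yn * s.
Proof.
move=> rE; have Wg : W (a * n - a) g.
  apply/WP => i j gij; apply/eqP; rewrite -(eqn_modDr a) subnK ?leq_pmulr //.
  rewrite modnMl -addnA -mulnSr; apply/eqP.
  rewrite -[RHS](mod0n n); apply: (W_weight (valA_W r)).
  by rewrite rE coef2_termM /= subn1 subn0 mul1r; exact: gij.
exists (toA (g ^+ n)); apply: valA_inj; rewrite valAX valAM rE.
rewrite toAK ?val_yn; first by rewrite exprMn term_exp mul1n mul0n.
by apply: W_mod (W_exp n Wg); rewrite modnMl mod0n.
Qed.

Definition divx f : S := Series2 (fun i j => coef2 f i.+1 j).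
Definition axis f : S := Series2 (fun i j => if i == 0%N then coef2 f i j else 0).

Lemma axis_divx f : f = axis f + term 1 1 0 * divx f.
Proof.
apply: series2P => i j; rewrite coef2D coef2_termM /=.
case: i => [|i]; first by rewrite addr0.
by rewrite add0r subSS !subn0 mul1r.
Qed.

Lemma axis_W t f : W t f -> W t (axis f).
Proof.
by move=> Wf; apply/WP => i j /=; case: ifP; [move=> _ /(W_weight Wf)|rewrite eqxx].
Qed.

(** An invariant without constant term is the sum of a multiple of y and a
    multiple of x in S, whose n-th powers are multiples of y^n and x^n in A. *)
Lemma prime_max (Q : set A) : prime_ideal Q -> Q xn -> Q yn ->
  maximal_ideal A `<=` Q.
Proof.
move=> prQ Qx Qy r /maximal_idealE r0.
have Wr := valA_W r; have Wr0 := axis_W Wr.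
have -> : r = toA (axis (val r)) + (r - toA (axis (val r))).
  by rewrite addrC subrK.
apply: (prime_add prQ).
  have [|s sE] := @exp_ymul (Series2 (fun i j => coef2 (axis (val r)) i j.+1))
      (toA (axis (val r))).
    rewrite toAK //; apply: series2P => i j; rewrite coef2_termM /=.
    case: j => [|j] /=; last by rewrite subSS !subn0 mul1r.
    by case: ifP => // /eqP ->.
  by apply: (prime_exp (k := n)) => //; rewrite sE; exact: prime_dvd.
have [|s sE] := @exp_xmul (divx (val r)) (r - toA (axis (val r))).
  by rewrite valAB toAK // {1}[val r]axis_divx addrC addKr.
by apply: (prime_exp (k := n)) => //; rewrite sE; exact: prime_dvd.
Qed.

(** Choose an element in each step of the chain but not in the previous one.  If
    the steps outnumber the functionals, a nontrivial combination of these
    elements over K is killed by all functionals, so it lies in N and its last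
    term lies one step lower, a contradiction. *)
Lemma chain_bound (M : lmodType A) (N : set M) (I : finType) (L : M -> I -> K)
    (P : nat -> set M) m :
    (forall u v i, L (u + v) i = L u i + L v i) ->
    (forall c u i, L (cst c *: u) i = c * L u i) ->
    (forall u, (forall i, L u i = 0) -> N u) ->
    (forall k, (k <= m)%N -> submodule (P k) /\ N `<=` P k) ->
    (forall k, (k < m)%N -> P k `<=` P k.+1 /\ ~ (P k.+1 `<=` P k)) ->
  (m <= #|I|)%N.
Proof.
move=> LD LZ LN PN Pm; rewrite leqNgt; apply/negP => ltIm.
have /choice[u uP] : forall k : 'I_m, exists u, P k.+1 u /\ ~ P k u.
  move=> k; have [_ nP] := Pm k (ltn_ord k); apply: contrapT => nu; apply: nP.
  by move=> u Pu; apply: contrapT => nPu; apply: nu; exists u.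
have L0 i : L 0 i = 0.
  by have := LZ 0 0 i; rewrite scaler0 mul0r.
have Lsum (F : 'I_m -> M) i : L (\sum_k F k) i = \sum_k L (F k) i.
  by elim/big_rec2: _ => // k x y _ <-; rewrite LD.
pose B : 'M[K]_(m, #|I|) := \matrix_(k, i) L (u k) (enum_val i).
have : kermx B != 0.
  rewrite kermx_eq0 -row_leq_rank -ltnNge.
  exact: leq_ltn_trans (rank_leq_col _) ltIm.
case/rowV0Pn => v /sub_kermxP vB v0.
have [k0 vk0] : exists k, v 0 k != 0.
  apply: contrapT => nk; case/eqP: v0; apply/rowP => k; rewrite mxE.
  by apply: contrapT => /eqP vk; apply: nk; exists k.
pose k1 := [arg max_(k > k0 | v 0%R k != 0%R) (k : nat)]%N.
have [vk1 k1max] : v 0 k1 != 0 /\ forall k, v 0 k != 0 -> (k <= k1)%N.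
  by rewrite /k1; case: arg_maxnP.
pose w := \sum_k cst (v 0 k) *: u k.
have Nw : N w.
  apply: LN => i; rewrite Lsum.
  have := congr1 (fun C : 'rV_#|I| => C 0 (enum_rank i)) vB; rewrite !mxE => vBi.
  rewrite -[RHS]vBi; apply: eq_bigr => k _.
  by rewrite LZ mxE enum_rankK.
have [_ nPk1] := uP k1; apply: nPk1.
have [subP NP] := PN k1 (ltnW (ltn_ord k1)).
have Pmono k l : (k <= l)%N -> (l <= m)%N -> P k `<=` P l.
  move=> /subnK <-; elim: (l - k)%N => [|d IHd] lm x; first by rewrite add0n.
  move=> /(IHd (ltnW lm)).
  by have [+ _] := Pm _ lm; apply.
have -> : u k1 = cst (v 0 k1)^-1 *:
    (w - \sum_(k | k != k1) cst (v 0 k) *: u k).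
  rewrite /w (bigD1 k1) //= addrK scalerA -cst_mul mulVf // cst1 scale1r //.
apply: submoduleZ => //; apply: submoduleB => //; first exact: NP.
apply: submodule_sum => // k kk1.
have [->|vk] := eqVneq (v 0 k) 0.
  by rewrite cst0 scale0r; exact: submodule0.
apply: submoduleZ => //; have [Pu _] := uP k.
apply: Pmono Pu; last exact: ltnW.
by rewrite ltn_neqAle -val_eqE /= in kk1 *; rewrite kk1 k1max.
Qed.

Lemma exists_axis f : f <> 0 ->
  exists k g, f = term 1 k 0 * g /\ exists j, coef2 g 0 j != 0.
Proof.
move=> f0; pose P i := `[< exists j, coef2 f i j != 0 >].
have exP : exists i, P i.
  apply: contrapT => nP; apply: f0; apply: series2P => i j.
  by apply: contrapT => /eqP fij; apply: nP; exists i; apply/asboolP; exists j.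
case: (ex_minnP exP) => k /asboolP[j fkj] kmin.
exists k, (Series2 (fun i j => coef2 f (i + k) j)); split; last by exists j.
apply: series2P => i l; rewrite coef2_termM /= subn0 andbT mul1r.
case: ifPn => [ki|]; first by rewrite subnK.
rewrite -ltnNge => ik; apply: contrapT => /eqP fil.
by move: ik; rewrite ltnNge kmin //; apply/asboolP; exists l.
Qed.

Lemma axisM_neq0 f g : (exists j, coef2 f 0 j != 0) ->
  (exists j, coef2 g 0 j != 0) -> exists j, coef2 (f * g) 0 j != 0.
Proof.
move=> [j fj] [l gl]; apply: contrapT => nfg.
have : axis f * axis g = 0.
  apply: series2P => i m; apply: contrapT => /eqP/[dup] /coef2M_neq0[i' [m' [_ _]]].
  rewrite /=; case: (i' =P 0%N) => [->|_]; last by rewrite eqxx.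
  rewrite subn0; case: (i =P 0%N) => [->|_]; last by rewrite eqxx.
  move=> _ _; rewrite coef2M big_ord1 => fg; apply: nfg; exists m.
  by rewrite coef2M big_ord1.
case/mulf2_eq0 => [/(coef2_congr 0 j)|/(coef2_congr 0 l)] /= /eqP.
  by rewrite (negPf fj).
by rewrite (negPf gl).
Qed.

Lemma shift_W t k g : W t (term 1 k 0 * g) -> W (t + k * (n - 1)) g.
Proof.
move=> Wf; apply/WP => i j gij; apply/eqP; rewrite -(eqn_modDr k).
have -> : (t + k * (n - 1) + k = t + k * n)%N.
  by rewrite -addnA -mulnSr -subSn // subn1.
rewrite [(t + k * n)%N]addnC modnMDl addnAC.
apply/eqP; apply: (W_weight Wf).
by rewrite coef2_termM leq_addl /= subn0 mul1r addnK.
Qed.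

(** Modulo a prime containing a nonzero element f, one of x^n and y^n is a
    parameter.  Write f = x^k g with x not dividing g: then f^n = (x^n)^k g^n
    with both factors invariant.  If the prime contains g^n, which is a unit
    times a power of y^n up to an element divisible by x, then a power of y^n
    is a multiple of x^n. *)
Lemma prime_parameter (P : set A) (f0 : A) : prime_ideal P -> P f0 -> f0 <> 0 ->
  exists z1, (z1 = xn \/ z1 = yn) /\
  exists e c c', P (xn ^+ e - z1 * c) /\ P (yn ^+ e - z1 * c').
Proof.
move=> prP Pf0 f00.
have {f00} /exists_axis[k [g [fE g0]]] : val f0 <> 0.
  by move=> v0; apply: f00; apply: valA_inj.
have Wg : W (0 + k * (n - 1)) g by apply: shift_W; rewrite -fE; exact: valA_W.
have Wgn : W 0 (g ^+ n).
  by apply: W_mod (W_exp n Wg); rewrite modnMl mod0n.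
have [subP _ PM] := (prime_idealP P).1 prP.
have [Px|Ph] : P xn \/ P (toA (g ^+ n)).
  have [|/(prime_exp prP)|] := PM (xn ^+ k) (toA (g ^+ n)); [|by left|by right].
    have -> : xn ^+ k * toA (g ^+ n) = f0 * f0 ^+ n.-1.
      rewrite -exprS prednK //; apply: valA_inj.
      rewrite valAM !valAX toAK // val_xn fE exprMn !term_exp.
      by rewrite !mul0n mulnC.
    exact: prime_dvd.
- exists yn; split; [by right|exists 1%N, 0, 1].
  by rewrite mulr0 subr0 mulr1 subrr expr1; split=> //; exact: (submodule0 subP).
exists xn; split; first by left.
have [q [hq0 hq]] : exists q, coef2 (g ^+ n) 0 q != 0 /\
    forall j, (j < q)%N -> coef2 (g ^+ n) 0 j = 0.
  have exq : exists q, coef2 (g ^+ n) 0 q != 0.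
    elim: (n) => [|m IHm]; last by rewrite exprS; exact: axisM_neq0.
    by exists 0%N; rewrite expr0 coef21 oner_neq0.
  case: (ex_minnP exq) => q hq0 qmin; exists q; split=> // j jq.
  by apply: contrapT => /eqP/qmin; rewrite leqNgt jq.
set h := toA _ in Ph; have hE : val h = g ^+ n by exact: toAK.
have [e qE] : exists e, q = (n * e)%N.
  have := W_weight Wgn hq0; rewrite add0n mod0n => /eqP.
  by rewrite -/(_ %| _)%N Gauss_dvdr 1?coprime_sym // => /dvdnP[e ->]; exists e; rewrite mulnC.
pose eps : S := Series2 (fun i j => if i == 0%N then coef2 (g ^+ n) 0 (j + q) else 0).
have axE : axis (g ^+ n) = term 1 0 q * eps.
  apply: series2P => i j; rewrite coef2_termM /= subn0.
  case: (i =P 0%N) => [->|_]; last by rewrite mulr0 if_same.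
  by rewrite mul1r; case: ifPn => [qj|]; [rewrite subnK|rewrite -ltnNge => /hq].
have Weps : W 0 eps.
  apply/WP => i j; rewrite /=; case: (i =P 0%N) => [->|_]; last by rewrite eqxx.
  move/(W_weight Wgn); rewrite qE mulnDr addnA -modnDmr mulnCA modnMr addn0.
  by [].
have [r rE] : exists r, toA eps * r = 1.
  by apply: unitA_P; rewrite toAK //= add0n.
pose w := h - yn ^+ e * toA eps.
have [s sE] : exists s, w ^+ n = xn * s.
  apply: (@exp_xmul (divx (g ^+ n))).
  rewrite valAB valAM valAX toAK // val_yn term_exp hE mul0n -qE -axE.
  by rewrite [X in X - _]axis_divx addrC addKr.
have hw : yn ^+ (e * n) = (h - w) ^+ n * r ^+ n.
  have -> : h - w = yn ^+ e * toA eps by rewrite opprB addrC subrK.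
  by rewrite exprMn -mulrA -exprMn rE expr1n mulr1 exprM.
have PX : P (yn ^+ (e * n) - xn * ((-1) ^+ n * s * r ^+ n)).
  rewrite hw; have -> : xn * ((-1) ^+ n * s * r ^+ n) = (- w) ^+ n * r ^+ n.
    by rewrite (exprNn w) sE; ring.
  rewrite -mulrBl subrXX opprK subrK -mulrA.
  exact: prime_dvd.
move: e PX {qE axE w sE hw} => [|e] PX.
  exists 0%N, ((-1) ^+ n * s * r ^+ n), ((-1) ^+ n * s * r ^+ n).
  by move: PX; rewrite mul0n !expr0.
exists (e.+1 * n)%N, (xn ^+ (e.+1 * n).-1), ((-1) ^+ n * s * r ^+ n).
split=> //; rewrite -exprS prednK ?muln_gt0 // subrr.
exact: (submodule0 subP).
Qed.

(** Krull's argument for principal ideals, with a parameter z1 modulo P.  If z1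
    is in Q then so are x^n and y^n, and Q is maximal.  Otherwise let N k be the
    contraction of the ideal b^k in the localization at Q of A / P.  The ring
    A / (P, z1) has finite length, so N k + (z1) = N (k+1) + (z1) for some k;
    as z1 is regular modulo N k, this gives N k = N (k+1) + z1 N k and
    N k = N (k+1) by Nakayama, which makes b, an element of Q, a unit at Q. *)
Lemma prime_height (P Q : set A) (f0 b : A) : prime_ideal P -> prime_ideal Q ->
  P `<=` Q -> P f0 -> f0 <> 0 -> Q b -> ~ P b -> maximal_ideal A `<=` Q.
Proof.
move=> prP prQ PQ Pf0 f00 Qb Pb.
have [z1 [z1E [e [c [c' [Px Py]]]]]] := prime_parameter prP Pf0 f00.
have [subP P1 PM] := (prime_idealP P).1 prP.
have [subQ Q1 QM] := (prime_idealP Q).1 prQ.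
have mz1 : maximal_ideal A z1.
  by case: z1E => ->; [exact: max_xn|exact: max_yn].
have [Qz1|Qz1] := pselect (Q z1).
  apply: prime_max => //; apply: (prime_exp (k := e)) => //.
    by rewrite -(subrK (z1 * c) (xn ^+ e)); apply: prime_add => //;
      [exact: PQ|exact: prime_dvd].
  by rewrite -(subrK (z1 * c') (yn ^+ e)); apply: prime_add => //;
    [exact: PQ|exact: prime_dvd].
exfalso.
pose N k : set A^o := [set r | exists s, ~ Q s /\ exists d, P (s * r - b ^+ k * d)].
have subN k : submodule (N k).
  apply/submoduleP; split.
    exists 1; split=> //; exists 0; rewrite !mulr0 subr0.
    exact: (submodule0 subP).
  move=> r r1 r2 [s1 [Qs1 [d1 P1']]] [s2 [Qs2 [d2 P2']]].
  exists (s1 * s2); split; first by move=> /QM[].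
  exists (r * s2 * d1 + s1 * d2); rewrite -[_ *: _]/(r * r1).
  have -> : s1 * s2 * (r * r1 + r2) - b ^+ k * (r * s2 * d1 + s1 * d2) =
      (s1 * r1 - b ^+ k * d1) * (r * s2) + (s2 * r2 - b ^+ k * d2) * s1 by ring.
  by apply: prime_add => //; apply: prime_dvd.
have NS k : N k.+1 `<=` N k.
  move=> r [s [Qs [d Pd]]]; exists s; split=> //; exists (b * d).
  by rewrite mulrA -exprSr.
have PN k : P `<=` N k.
  by move=> r Pr; exists 1; split=> //; exists 0; rewrite mul1r mulr0 subr0.
pose T k : set A^o := [set r | exists r' d, N k r' /\ r = r' + z1 * d].
pose J : set A^o := [set r | exists r' d, P r' /\ r = r' + z1 * d].
have subT k : submodule (T k).
  apply/submoduleP; split.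
    exists 0, 0; split; first exact: (submodule0 (subN k)).
    by rewrite mulr0 addr0.
  move=> r _ _ [r1 [d1 [N1 ->]]] [r2 [d2 [N2 ->]]].
  exists (r * r1 + r2), (r * d1 + d2); split.
    exact: (submoduleD (subN k) (submoduleZ r (subN k) N1) N2).
  by rewrite -[_ *: _]/(r * _); ring.
have [k Tk] : exists k, T k `<=` T k.+1.
  apply: contrapT => nT.
  pose I : finType := ('I_(n * e) * 'I_(n * e))%type.
  suff : (#|I| < #|I|)%N by rewrite ltnn.
  apply: (@chain_bound A^o J I (fun r ij => coef2 (val r) ij.1 ij.2)
    (fun k => T (#|I|.+1 - k)%N)) => //.
  - by move=> d r i; rewrite -[_ *: _]/(_ * _) valAM val_cst coef2_termM /= !subn0.
  - move=> r r0; have [|g rE gW] := @term_decomp K bool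
        (fun t => if t then (n * e)%N else 0%N)
        (fun t => if t then 0%N else (n * e)%N)
        (fun _ i j => i + a * j = 0 %[mod n]) (val r).
      move=> i j rij; have wij := W_weight (valA_W r) rij.
      have [le_i|lt_i] := leqP (n * e) i.
        exists true; split=> //; rewrite subn0 -[RHS]wij; apply/eqP.
        by rewrite -(eqn_modDr (n * e)) addnAC subnK // eq_sym -modnDmr modnMr addn0.
      have [le_j|lt_j] := leqP (n * e) j.
        exists false; split=> //; rewrite subn0 -[RHS]wij; apply/eqP.
        rewrite -(eqn_modDr (a * (n * e))) -addnA -mulnDr subnK // eq_sym.
        by rewrite -modnDmr mulnCA modnMr addn0.
      by have := r0 (Ordinal lt_i, Ordinal lt_j); rewrite /= => r0'; rewrite r0' eqxx in rij.
    have {rE} -> : r = xn ^+ e * toA (g true) + yn ^+ e * toA (g false).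
      have Wg t : W 0 (g t) by apply/WP; exact: gW.
      apply: valA_inj; apply: etrans rE _.
      rewrite valAD !valAM !valAX val_xn val_yn !toAK // !term_exp !mul0n.
      by rewrite big_bool.
    exists ((xn ^+ e - z1 * c) * toA (g true) + (yn ^+ e - z1 * c') * toA (g false)).
    exists (c * toA (g true) + c' * toA (g false)); split; last by ring.
    by apply: prime_add => //; apply: prime_dvd.
  - move=> k _; split=> // r [r1 [d [Pr ->]]]; exists r1, d; split=> //.
    exact: PN.
  - move=> k; rewrite ltnS => kI; rewrite subSn // subSS; split.
      by move=> r [r1 [d [Nr ->]]]; exists r1, d; split=> //; exact: NS.
    by move=> TT; apply: nT; exists (#|I| - k)%N.
have : N k `<=` N k.+1.
  apply: (nakayama (M := A^o) local_A mz1) => //; first exact: noetherian_A.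
  move=> r Nr; have [|r1 [d [Nr1 rE]]] := Tk r.
    by exists r, 0; rewrite mulr0 addr0.
  exists d; split; last by rewrite rE -[_ *: _]/(z1 * d) addrK.
  have [s [Qs [d' Pd']]] : N k (z1 * d).
    have -> : z1 * d = r - r1 by rewrite rE addrC addKr.
    apply: (submoduleB (subN k)) => //; exact: NS.
  exists (s * z1); split; first by move=> /QM[].
  by exists d'; rewrite -mulrA.
move=> /(_ (b ^+ k)) [|s [Qs [d Pd]]].
  exists 1; split=> //; exists 1.
  by rewrite mulr1 mul1r subrr; exact: (submodule0 subP).
have [||Psb] := PM (b ^+ k) (s - b * d).
- by have -> : b ^+ k * (s - b * d) = s * b ^+ k - b ^+ k.+1 * d by rewrite exprSr; ring.
- by move/(prime_exp prP).
apply: Qs; rewrite -(subrK (b * d) s); apply: prime_add => //; first exact: PQ.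
exact: prime_dvd.
Qed.

Lemma nat_supremum (X : set nat) m : X m -> (forall k, X k -> (k <= m)%N) ->
  supremum 0%N X = m.
Proof.
move=> Xm Xle; have Xsup : has_sup X by split; [exists m|exists m].
have X0 : X != set0 by apply/set0P; exists m.
rewrite /supremum ifN //; case: xgetP => [y _ [yu yl]|/(_ m)].
  by apply/eqP; rewrite eqn_leq -!leEnat yl ?yu.
by case; split=> // k; apply.
Qed.

Lemma nat_supremum_ge (X : set nat) m : (0 < m)%N -> (m <= supremum 0%N X)%N ->
  exists2 k, X k & (m <= k)%N.
Proof.
move=> m0 msup; apply: contrapT => noX.
have Xm k : X k -> (k < m)%N by move=> Xk; rewrite ltnNge; apply/negP => mk; apply: noX; exists k.
move: msup; rewrite /supremum; case: ifP => [_|_]; first by rewrite leqNgt m0.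
case: xgetP => [y _ [yu yl]|_]; last by rewrite leqNgt m0.
suff /(leq_trans _) ym : (y <= m.-1)%N by move=> /ym; rewrite -ltnS prednK // ltnn.
rewrite -leEnat; apply: yl => k /Xm km.
by rewrite leEnat -ltnS prednK.
Qed.

Lemma prime0 : prime_ideal [set (0 : A)].
Proof.
apply/prime_idealP; split.
- apply/submoduleP; split=> // r u v -> ->; by rewrite scaler0 addr0.
- by move/eqP; rewrite oner_eq0.
- by move=> r s /mulA_eq0.
Qed.

Definition xprime : set A := [set r | forall j, coef2 (val r) 0 j = 0].

Lemma prime_xprime : prime_ideal xprime.
Proof.
apply/prime_idealP; split.
- apply/submoduleP; split=> // r u v Pu Pv j.
  rewrite -[_ *: _]/(r * u) valAD coef2D Pv addr0 valAM coef2M big_ord1.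
  by rewrite big1 // => k _; rewrite Pu mulr0.
- by move=> /(_ 0%N) /eqP; rewrite valA1 coef21 oner_eq0.
move=> r s Prs; have [Pr|nr] := pselect (xprime r); first by left.
right=> j; apply: contrapT => /eqP sj.
have [|j'] := @axisM_neq0 (val r) (val s) _ (ex_intro _ j sj).
  by apply: contrapT => nr'; apply: nr => j'; apply: contrapT => /eqP rj'; apply: nr'; exists j'.
by rewrite -valAM Prs eqxx.
Qed.

Lemma prime_maximal : prime_ideal (maximal_ideal A).
Proof.
apply/prime_idealP; split.
- apply/submoduleP; split; first by apply/maximal_idealE.
  move=> r u v /maximal_idealE u0 /maximal_idealE v0; apply/maximal_idealE.
  by rewrite -[_ *: _]/(r * u) valAD coef2D valAM coef2M00 u0 v0 mulr0 addr0.
- by move=> /maximal_idealE/eqP; rewrite valA1 coef21 oner_eq0.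
- move=> r s /maximal_idealE; rewrite valAM coef2M00 => /eqP.
  by rewrite mulf_eq0 => /orP[/eqP|/eqP]; [left|right]; apply/maximal_idealE.
Qed.

Lemma prime_sub_max (Q : set A) : prime_ideal Q -> Q `<=` maximal_ideal A.
Proof.
case/prime_idealP => subQ Q1 _ r Qr [s rs]; apply: Q1; rewrite -rs mulrC.
exact: (submoduleZ s subQ Qr).
Qed.

(** P1 is not zero, so P2 is the maximal ideal by prime_height. *)
Lemma prime_chain (P0 P1 P2 P3 : set A) :
    prime_ideal P0 -> prime_ideal P1 -> prime_ideal P2 -> prime_ideal P3 ->
  P0 `<` P1 -> P1 `<` P2 -> P2 `<` P3 -> False.
Proof.
move=> pr0 pr1 pr2 pr3 [_ n10] [s12 n21] [s23 n32]; apply: n32.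
have [f0 [Pf0 nPf0]] : exists f0 : A, P1 f0 /\ ~ P0 f0.
  by apply: contrapT => nf; apply: n10 => f0 Pf0; apply: contrapT => nP; apply: nf; exists f0.
have [b [Pb nPb]] : exists b, P2 b /\ ~ P1 b.
  by apply: contrapT => nf; apply: n21 => b Pb; apply: contrapT => nP; apply: nf; exists b.
apply: subset_trans (prime_sub_max pr3) _.
apply: (prime_height pr1 pr2 s12 Pf0 _ Pb nPb) => f00; apply: nPf0.
by rewrite f00; case/prime_idealP: pr0 => /submodule0.
Qed.

Lemma krull_dim_A : krull_dim A = 2%N.
Proof.
apply: nat_supremum => [|k [P [prP ltP]]]; last first.
  rewrite leqNgt; apply/negP => k2.
  by apply: (@prime_chain (P 0%N) (P 1%N) (P 2%N) (P 3%N));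
    try (apply: prP; lia); apply: ltP; lia.
exists (fun i => if i is i'.+1 then if i' is 0%N then xprime else maximal_ideal A
         else [set 0]); split.
  case=> [|[|i]] _; [exact: prime0|exact: prime_xprime|exact: prime_maximal].
case=> [|[|//]] _.
  split=> [r -> //|/(_ xn)]; rewrite /xprime /= val_xn => xn0.
  have : xn = 0.
    by apply: xn0 => j; rewrite coef2_term eq_sym (gtn_eqF n_gt0).
  move=> /(congr1 val); rewrite val_xn valA0 => /(coef2_congr n 0)/eqP.
  by rewrite coef2_term !eqxx oner_eq0.
split; first exact: prime_sub_max prime_xprime.
move=> /(_ yn max_yn n) /eqP; rewrite val_yn coef2_term !eqxx /=.
by rewrite oner_eq0.
Qed.

(** ** Maximal Cohen-Macaulay modules *)

Lemma smul_nil (M : lmodType A) : smul [set` [::] : seq A] [set: M] = [set 0].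
Proof.
apply/seteqP; split.
  apply: span_sub => [|u []//].
  by apply/submoduleP; split=> // r u v -> ->; rewrite scaler0 addr0.
by move=> _ ->; exact: (submodule0 (submodule_span _)).
Qed.

Lemma submodule_smul (M : lmodType A) (I : set A) (N : set M) :
  submodule (smul I N).
Proof. exact: submodule_span. Qed.

Lemma smul_rcons (M : lmodType A) (s : seq A) (f : A) u :
  smul [set` rcons s f] [set: M] u <->
  exists v, smul [set` s] [set: M] (u - f *: v).
Proof.
have subs := submodule_smul [set` s] [set: M].
have subr := submodule_smul [set` rcons s f] [set: M].
split=> [|[v sv]].
  move: u; apply: span_sub.
    apply/submoduleP; split; first by exists 0; rewrite scaler0 subr0; exact: (submodule0 subs).
    move=> r u1 u2 [v1 s1] [v2 s2]; exists (r *: v1 + v2).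
    have -> : r *: u1 + u2 - f *: (r *: v1 + v2) =
        r *: (u1 - f *: v1) + (u2 - f *: v2).
      by rewrite scalerDr scalerBr !scalerA [r * f]mulrC opprD addrACA.
    by apply: (submoduleD subs) => //; apply: (submoduleZ _ subs).
  move=> _ [r rs [v _ <-]]; move: rs; rewrite /= mem_rcons inE => /predU1P[->|rs].
    by exists v; rewrite subrr; exact: (submodule0 subs).
  by exists 0; rewrite scaler0 subr0; apply: sub_span; exists r => //; exists v.
rewrite -(subrK (f *: v) u); apply: (submoduleD subr).
  apply: spanS sv => _ [r rs [w _ <-]]; exists r; last by exists w.
  by rewrite /= mem_rcons inE rs orbT.
by apply: sub_span; exists f; [rewrite /= mem_rcons mem_head|exists v].
Qed.

(** Each member of a regular sequence enlarges an associated prime, so the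
    dimension bounds the length of regular sequences. *)
Lemma regular_sequence_size (M : lmodType A) (s : seq A) :
  finitely_generated M -> regular_sequence M s -> (size s <= 2)%N.
Proof.
move=> fgM [sm sreg sT]; rewrite leqNgt; apply/negP => s3.
have chain k : (k <= size s)%N -> exists (P : nat -> set A),
    (forall i, (i <= k)%N -> prime_ideal (P i)) /\
    (forall i, (i < k)%N -> P i `<` P i.+1) /\
    exists w, ~ smul [set` take k s] [set: M] w /\
      P k = colon (smul [set` take k s] [set: M]) w.
  elim: k => [_|k IHk ks].
    have [u0 nu0] : exists u, ~ smul [set` take 0 s] [set: M] u.
      apply: contrapT => nu; case/eqP: sT; apply/seteqP; split=> // u _.
      have : smul [set` take 0 s] [set: M] u.
        by apply: contrapT => nu'; apply: nu; exists u.
      apply: spanS => _ [r rs [w _ <-]]; exists r; last by exists w.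
      by move: rs; rewrite take0.
    have [w [nw prw _]] := associated_prime noetherian_A (submodule_smul _ _) nu0.
    by exists (fun=> colon (smul [set` take 0 s] [set: M]) w); split=> //; split=> //; exists w.
  have [P [prP [ltP [w [nw PE]]]]] := IHk (ltnW ks).
  have msk : maximal_ideal A s`_k by apply: sm; exact: mem_nth.
  have prw : prime_ideal (colon (smul [set` take k s] [set: M]) w) by rewrite -PE; exact: prP.
  have [w1 [nw1 prw1 sub1 f1 f0]] := associated_prime_regular noetherian_A local_A fgM
    (submodule_smul _ _) msk (sreg k ks) nw prw.
  have KE : [set u | exists v, smul [set` take k s] [set: M] (u - s`_k *: v)] =
      smul [set` take k.+1 s] [set: M].
    by rewrite (take_nth 0) //; apply/seteqP; split=> u /smul_rcons.
  rewrite KE in nw1 prw1 sub1 f1.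
  exists (fun i => if (i <= k)%N then P i else colon (smul [set` take k.+1 s] [set: M]) w1).
  split=> [i|].
    by rewrite leq_eqVlt => /predU1P[->|]; [rewrite /= ltnn|rewrite ltnS => ik; rewrite /= ik; exact: prP].
  split=> [i|]; last by exists w1; rewrite /= ltnn.
  rewrite ltnS leq_eqVlt => /predU1P[->|ik]; last first.
    by rewrite /= ik orbT; exact: ltP.
  by rewrite /= eqxx ltnn PE; split=> // /(_ _ f1).
have [P [prP [ltP _]]] := chain 3%N s3.
by apply: (@prime_chain (P 0%N) (P 1%N) (P 2%N) (P 3%N)); (apply: prP || apply: ltP).
Qed.

Lemma MCM_regular_pair (M : lmodType A) : MCM M -> nonzero_module M ->
  exists f g : A, [/\ maximal_ideal A f, maximal_ideal A g,
    forall u : M, f *: u = 0 -> u = 0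
    & forall u v : M, g *: u = f *: v -> exists w, u = f *: w].
Proof.
case=> _ /[apply]; rewrite krull_dim_A /depth => /nat_supremum_ge[//|_ [s [sm sreg _] <-]].
case: s sm sreg => [|f [|g s]] // sm sreg _; exists f, g; split.
- by apply: sm; rewrite /= mem_head.
- by apply: sm; rewrite /= !inE eqxx orbT.
- by move=> u fu; have := sreg 0%N isT u; rewrite /= smul_nil; apply.
move=> u v guv; have := sreg 1%N isT u.
have -> : take 1 [:: f, g & s] = rcons [::] f by [].
move=> regg; have {regg} : smul [set` rcons [::] f] [set: M] u.
  by apply: regg; apply/smul_rcons; exists v; rewrite /= guv subrr smul_nil.
by case/smul_rcons => w; rewrite smul_nil => /eqP; rewrite subr_eq0 => /eqP ->; exists w.
Qed.

(** Let f, g be a regular sequence on M.  A prime associated with M contains no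
    x^n: otherwise it is not zero, it is strictly contained in a prime associated
    with M / f M, which is then the maximal ideal, against the regularity of g.
    A prime associated with M / x^n M and containing y^n is the maximal ideal, so
    it contains f and g; since f w and g w are multiples x^n a1 and x^n a2, the
    regularity of f, g makes a1 a multiple of f, and w a multiple of x^n. *)
Lemma MCM_xy_regular (M : lmodType A) : MCM M -> nonzero_module M ->
  (forall u : M, xn *: u = 0 -> u = 0) /\
  (forall u v : M, yn *: u = xn *: v -> exists w, u = xn *: w).
Proof.
move=> mcmM nzM; have [f [g [mf mg freg greg]]] := MCM_regular_pair mcmM nzM.
have fgM : finitely_generated M by case: mcmM.
have subM0 : submodule [set (0 : M)].
  by apply/submoduleP; split=> // r u v -> ->; rewrite scaler0 addr0.
have xreg (u : M) : xn *: u = 0 -> u = 0.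
  move=> xu; apply: contrapT => u0.
  have [w [w0 prw uw]] := associated_prime noetherian_A subM0 u0.
  have [|w1 [nw1 prw1 sub1 f1 f0]] := associated_prime_regular noetherian_A local_A fgM
    subM0 mf _ w0 prw; first by move=> v /= /freg.
  have xw : colon [set 0] w xn by exact: uw.
  have xn0 : xn <> 0.
    move=> /(congr1 val); rewrite val_xn valA0 => /(coef2_congr n 0)/eqP.
    by rewrite coef2_term !eqxx oner_eq0.
  have [v] := prime_height prw prw1 sub1 xw xn0 f1 f0 mg.
  move=> /eqP; rewrite subr_eq0 => /eqP/greg[w' w1E].
  by apply: nw1; exists w'; rewrite w1E subrr.
split=> // u v yuv; apply: contrapT => nu.
pose K1 : set M := [set u | exists w, u = xn *: w].
have subK1 : submodule K1.
  apply/submoduleP; split; first by exists 0; rewrite scaler0.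
  move=> r _ _ [w1 ->] [w2 ->]; exists (r *: w1 + w2).
  by rewrite scalerDr !scalerA mulrC.
have [w [nw prw uw]] := associated_prime noetherian_A subK1 nu.
have mw : maximal_ideal A `<=` colon K1 w.
  apply: prime_max => //; first by exists w.
  by apply: uw; exists v.
have [a1 fE] := mw _ mf; have [a2 gE] := mw _ mg.
have [a3 a1E] : exists a3, a1 = f *: a3.
  apply: (greg _ a2); apply/eqP; rewrite -subr_eq0; apply/eqP/xreg.
  rewrite scalerBr !scalerA ![xn * _]mulrC -!scalerA -fE -gE.
  by rewrite !scalerA mulrC subrr.
apply: nw; exists a3; apply/eqP; rewrite -subr_eq0; apply/eqP/freg.
by rewrite scalerBr fE a1E !scalerA mulrC subrr.
Qed.

(** Evaluation reduces finite generation to that of the kernel. *)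
Lemma fg_kernel (V M : lmodType A) (ev : V -> M) (N : set V) :
    finitely_generated M ->
    (forall r u v, ev (r *: u + v) = r *: ev u + ev v) ->
    submodule N -> fg (N `&` [set u | ev u = 0]) -> fg N.
Proof.
move=> fgM evL subN [s1 s1E].
have ev0 : ev 0 = 0.
  by have := evL (-1) 0 0; rewrite scaler0 add0r scaleN1r addNr.
have evZ r u : ev (r *: u) = r *: ev u by rewrite -[r *: u]addr0 evL ev0 addr0.
have evD u v : ev (u + v) = ev u + ev v by rewrite -[u]scale1r evL !scale1r.
have evB u v : ev (u - v) = ev u - ev v by rewrite -scaleN1r evD evZ scaleN1r.
have evS (I : finType) (F : I -> V) : ev (\sum_i F i) = \sum_i ev (F i).
  by elim/big_rec2: _ => // i x y _ <-.
have [|s sE] := @noetherian_fg _ M (ev @` N) noetherian_A fgM.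
  apply/submoduleP; split; first by exists 0 => //; exact: submodule0.
  move=> r _ _ [u Nu <-] [v Nv <-]; exists (r *: u + v); last exact: evL.
  by apply: submoduleD => //; apply: submoduleZ.
have /choice[g gP] : forall w, exists u, (ev @` N) w -> N u /\ ev u = w.
  move=> w; have [[u Nu uw]|nw] := pselect ((ev @` N) w); last by exists 0.
  by exists u.
have gs w : w \in s -> N (g w) /\ ev (g w) = w.
  by move=> ws; apply: gP; rewrite -sE; exact: sub_span.
exists (map g s ++ s1); set L := map g s ++ s1.
have subL := submodule_span [set` L].
apply/seteqP; split.
  apply: span_sub => // u; rewrite /= mem_cat => /orP[/mapP[w /gs[Nw _] -> //]|us1].
  have : span [set` s1] u by exact: sub_span.
  by rewrite s1E => -[].
move=> u Nu; have : (ev @` N) (ev u) by exists u.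
rewrite -sE => /span_seqP[c uE].
have gi (i : 'I_(size s)) : N (g s`_i) /\ ev (g s`_i) = s`_i.
  by apply: gs; exact: mem_nth.
pose v := \sum_(i < size s) c i *: g s`_i.
rewrite -(subrK v u); apply: (submoduleD subL).
  apply: (spanS (X := [set` s1])); first by move=> x /= xs; rewrite mem_cat xs orbT.
  rewrite s1E; split.
    apply: submoduleB => //; apply: submodule_sum => // i _.
    by apply: submoduleZ => //; case: (gi i).
  rewrite /= evB evS uE; apply/eqP; rewrite subr_eq0; apply/eqP.
  by apply: eq_bigr => i _; rewrite evZ (gi i).2.
apply: (submodule_sum _ subL) => i _; apply: (submoduleZ _ subL).
by apply: sub_span; rewrite /= mem_cat map_f // mem_nth.
Qed.

(** Hom_A(S, M), with S acting by multiplication on the argument; evaluation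
    at 1 identifies M with its part of weight 0. *)
Definition coind (M : lmodType A) : set (S -> M) :=
  [set phi | (forall f g, phi (f + g) = phi f + phi g) /\
             (forall (r : A) f, phi (val r * f) = r *: phi f)].

Section Coinduced.
Variable M : lmodType A.
Hypothesis fgM : finitely_generated M.
Hypothesis xreg : forall u : M, xn *: u = 0 -> u = 0.
Hypothesis yreg : forall u v : M, yn *: u = xn *: v -> exists w, u = xn *: w.
Implicit Types phi psi chi : S -> M.

Local Notation X := (term (1 : K) 1 0).
Local Notation Y := (term (1 : K) 0 1).

Lemma coind0 phi : coind phi -> phi 0 = 0.
Proof. by case=> _ phiZ; have := phiZ 0 0; rewrite mulr0 scale0r. Qed.

Lemma coindB phi f g : coind phi -> phi (f - g) = phi f - phi g.
Proof.
move=> cphi; have [phiD _] := cphi.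
by apply/eqP; rewrite eq_sym subr_eq -phiD subrK.
Qed.

Lemma coind_sum phi I (s : seq I) (P : pred I) (F : I -> S) : coind phi ->
  phi (\sum_(i <- s | P i) F i) = \sum_(i <- s | P i) phi (F i).
Proof.
move=> cphi; have [phiD _] := cphi.
by elim/big_rec2: _ => [|i x y _ <-]; [exact: coind0|rewrite phiD].
Qed.

Lemma submodule_coind : submodule (@coind M).
Proof.
apply/submoduleP; split.
  by split=> *; rewrite /GRing.zero /= ?addr0 ?scaler0.
move=> r phi psi [pD pZ] [qD qZ]; split=> [f g|c f].
  by rewrite !fctE pD qD scalerDr addrACA.
by rewrite !fctE pZ qZ scalerDr !scalerA mulrC.
Qed.

Lemma coind_comb (I : finType) (phi : I -> S -> M) (c : I -> S) :
  (forall i, coind (phi i)) -> coind (fun f => \sum_i phi i (c i * f)).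
Proof.
move=> cphi; split=> [f g|r f].
  by rewrite -big_split; apply: eq_bigr => i _; rewrite mulrDr (cphi i).1.
by rewrite scaler_sumr; apply: eq_bigr => i _; rewrite mulrCA (cphi i).2.
Qed.

Lemma Xn_val f : X * (term 1 n.-1 0 * f) = val xn * f.
Proof. by rewrite val_xn mulrA term_mul mul1r add1n prednK. Qed.

(** Together with the next lemma: x, y form a regular sequence on Hom_A(S, M),
    because their n-th powers, which are in A, do so on M. *)
Lemma coind_x_regular phi : coind phi -> (forall f, phi (X * f) = 0) ->
  forall f, phi f = 0.
Proof. by move=> cphi pX f; apply: xreg; rewrite -cphi.2 -Xn_val. Qed.

Lemma coind_y_regular phi psi : coind phi -> coind psi ->
    (forall f, phi (Y * f) = psi (X * f)) ->
  exists2 chi, coind chi & forall f, phi f = chi (X * f).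
Proof.
move=> cphi cpsi pq.
have /choice[chi chiE] : forall f, exists w, phi (term 1 n.-1 0 * f) = xn *: w.
  move=> f; apply: (@yreg _ (psi (term 1 0 n.-1 * f))).
  rewrite -cphi.2 -cpsi.2 -Xn_val -pq; congr (phi _).
  rewrite val_yn !mulrA !term_mul !mulr1; congr (term _ _ _ * _); lia.
have inj (u v : M) : xn *: u = xn *: v -> u = v.
  move=> uv; apply/eqP; rewrite -subr_eq0; apply/eqP/xreg.
  by rewrite scalerBr uv subrr.
exists chi => [|f].
  split=> [f g|r f]; apply: inj.
    by rewrite scalerDr -!chiE mulrDr cphi.1.
  by rewrite scalerA [xn * r]mulrC -scalerA -!chiE mulrCA cphi.2.
by apply: inj; rewrite -chiE -cphi.2 mulrCA Xn_val.
Qed.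

(** A map is determined by its values at the n^2 monomials with exponents less
    than n, and these values can be made zero one after the other. *)
Lemma fg_coind : fg (@coind M).
Proof.
pose e k : S := term 1 (k %/ n) (k %% n).
pose H k : set (S -> M) := [set phi | coind phi /\ forall i, (i < k)%N -> phi (e i) = 0].
have subH k : submodule (H k).
  apply/submoduleP; split; first by split=> [|i _] //; exact: (submodule0 submodule_coind).
  move=> r phi psi [cphi pe] [cpsi qe]; split.
    apply: (submoduleD submodule_coind) => //.
    exact: (submoduleZ _ submodule_coind).
  by move=> i ik; rewrite !fctE pe // qe // scaler0 addr0.
have -> : @coind M = H 0%N by apply/seteqP; split=> phi; [split|case].
have [N] : exists N, N = (n * n)%N by exists (n * n)%N.
rewrite -[N in LHS]addn0; move: (0)%N => k; elim: N k => [|N IHN] k kN.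
  exists [::]; rewrite span_nil; apply/seteqP; split=> [_ ->|phi [cphi pe]].
    exact: (submodule0 (subH k)).
  apply/funext => f.
  have [|g fE gW] := @term_decomp K 'I_(n * n)%N (fun i => i %/ n)%N (fun i => i %% n)%N
      (fun _ i j => (i %% n == 0) && (j %% n == 0))%N f.
    move=> i j _.
    have lt_ij : ((i %% n) * n + j %% n < n * n)%N.
      apply: (@leq_trans ((i %% n).+1 * n)); first by rewrite mulSnr ltn_add2l ltn_mod.
      by rewrite leq_mul2r ltn_mod n_gt0 orbT.
    exists (Ordinal lt_ij); rewrite /= divnMDl // divn_small ?ltn_mod // addn0.
    rewrite modnMDl modn_mod; split; try exact: leq_mod.
    have modB m : ((m - m %% n) %% n = 0)%N.
      by rewrite {1}(divn_eq m n) addnK modnMl.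
    by rewrite !modB.
  rewrite fE (coind_sum _ _ _ cphi) big1 // => i _.
  have Wg : W 0 (g i).
    apply/WP => p q /gW/andP[/eqP p0 /eqP q0].
    by rewrite -modnDm p0 -modnMmr q0 muln0 mod0n addn0 mod0n.
  by rewrite mulrC -(toAK Wg) cphi.2 pe ?scaler0 // -[k]add0n kN.
apply: (@fg_kernel _ M (fun phi => phi (e k))) => //.
have -> : H k `&` [set phi | phi (e k) = 0] = H k.+1.
  apply/seteqP; split=> phi; first move=> [[cphi pe] pek].
    by split=> // i; rewrite ltnS leq_eqVlt => /predU1P[->//|/pe].
  by case=> cphi pe; split; [split=> // i ik; apply: pe; exact: ltnW|exact: pe].
by apply: IHN; rewrite addnS -addSn.
Qed.

Definition homogeneous_generators (I : finType) (phi : I -> S -> M) (t : I -> nat) :=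
  (forall i, coind (phi i) /\ forall f, phi i f = phi i (pi (t i) f)) /\
  (forall psi, coind psi -> exists c : I -> S, forall f, psi f = \sum_i phi i (c i * f)).

(** The components in all weights of generators over A generate over S. *)
Lemma exists_homogeneous_generators :
  exists m (phi : 'I_m -> S -> M) t, homogeneous_generators phi t.
Proof.
have [L LE] := fg_coind.
have cL (i : 'I_(size L)) : coind L`_i.
  by rewrite -LE; apply: sub_span; exact: mem_nth.
pose I : finType := ('I_(size L) * 'I_n)%type.
pose ev (k : 'I_#|I|) : I := enum_val k.
exists #|I|, (fun k f => L`_(ev k).1 (pi (ev k).2 f)),
  (fun k => (ev k).2 : nat); split=> [k|psi cpsi].
  split; last by move=> f; rewrite (pi_id (pi_W _ _)).
  have [pD pZ] := cL (ev k).1; split=> [f g|r f]; first by rewrite piD pD.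
  by rewrite -[X in pi X]add0n (piM _ _ (valA_W r)) pZ.
have : span [set` L] psi by rewrite LE.
move=> /span_seqP[c psiE]; exists (fun k => val (c (ev k).1)) => f.
rewrite psiE fct_sumE.
under eq_bigr => i _ do rewrite fctE -(cL i).2 [val (c i) * f]sum_pi (coind_sum _ _ _ (cL i)).
rewrite pair_big /= [LHS](reindex _ (onW_bij _ (enum_val_bij I))) /=.
by apply: eq_bigr => k _.
Qed.

(** A minimal system of homogeneous generators satisfies no relation.  Its
    relations have nonunit coefficients; splitting the coefficients of a
    relation as multiples of x and of y gives, since x and y form a regular
    sequence, relations among the cofactors, whence by induction the
    coefficients of a relation have arbitrarily large order. *)
Lemma exists_homogeneous_basis :
  exists m (phi : 'I_m -> S -> M) t, homogeneous_generators phi t /\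
    forall c : 'I_m -> S, (forall f, \sum_i phi i (c i * f) = 0) -> forall i, c i = 0.
Proof.
have exm : exists m, `[< exists (phi : 'I_m -> S -> M) t, homogeneous_generators phi t >].
  have [m [phi [t gen]]] := exists_homogeneous_generators.
  by exists m; apply/asboolP; exists phi, t.
case: (ex_minnP exm) => m /asboolP[phi [t [hphi gen]]] mmin.
exists m, phi, t; split; first by split.
have cphi i : coind (phi i) by case: (hphi i).
(* a unit coefficient would make a generator redundant *)
have rel1 c : (forall f, \sum_i phi i (c i * f) = 0) -> forall i, coef2 (c i) 0 0 = 0.
  move=> Rc i0; apply: contrapT => /eqP/unit2P[d dE].
  case: m phi t hphi gen mmin cphi c Rc i0 d dE => [|m] phi t hphi gen mmin cphi
    c Rc i0 d dE; first by have := ltn_ord i0.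
  suff : (m.+1 <= m)%N by rewrite ltnn.
  apply: mmin; apply/asboolP.
  exists (fun k => phi (lift i0 k)), (fun k => t (lift i0 k)); split=> // psi cpsi.
  have [e psiE] := gen psi cpsi.
  exists (fun k => e (lift i0 k) - c (lift i0 k) * d * e i0) => f.
  have i0E g : phi i0 g = - \sum_k phi (lift i0 k) (c (lift i0 k) * d * g).
    have := Rc (d * g); rewrite (bigD1_ord i0) //= !mulrA dE mul1r => /eqP.
    rewrite addr_eq0 => /eqP ->; congr (- _).
    by apply: eq_bigr => k _; rewrite mulrA.
  rewrite psiE (bigD1_ord i0) //= i0E addrC -sumrB; apply: eq_bigr => k _.
  by rewrite mulrBl (coindB _ _ (cphi _)) !mulrA.
pose Rel (c : 'I_m -> S) := forall f, \sum_i phi i (c i * f) = 0.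
suff ordR k c : Rel c -> forall i, ordge k (c i).
  by move=> c Rc i; apply: ordge_eq0 => k; exact: ordR.
elim: k c => [c _ i|k IHk c Rc]; first exact: ordge0.
have {}IHk c' : Rel c' -> forall i, ordge k (c' i) by exact: IHk.
pose u i := divx (c i); pose v i : S := Series2 (fun p q => coef2 (axis (c i)) p q.+1).
have cE i : c i = X * u i + Y * v i.
  rewrite {1}[c i]axis_divx addrC; congr (_ + _).
  apply: series2P => p q; rewrite coef2_termM /=.
  case: q => [|q] /=; last by rewrite subSS !subn0 mul1r.
  by case: ifP => // /eqP ->; exact: rel1.
have cu : coind (fun f => \sum_i phi i (u i * f)) by exact: coind_comb.
have cv : coind (fun f => \sum_i phi i (v i * f)) by exact: coind_comb.
have ncu : coind (fun f => - \sum_i phi i (u i * f)).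
  split=> [f g|r f]; first by rewrite cu.1 opprD.
  by rewrite cu.2 scalerN.
have [|chi cchi vchi] := coind_y_regular cv ncu.
  move=> f; apply/eqP; rewrite -addr_eq0 addrC -big_split /= -[X in _ == X](Rc f).
  apply/eqP; apply: eq_bigr => i _.
  by rewrite -(cphi i).1 cE mulrDl !mulrA ![u i * _]mulrC ![v i * _]mulrC.
have uchi f : \sum_i phi i (u i * f) + chi (Y * f) = 0.
  move: f; apply: coind_x_regular.
    split=> [f g|r f].
      by rewrite cu.1 mulrDr cchi.1 addrACA.
    by rewrite cu.2 mulrCA cchi.2 scalerDr.
  move=> f; rewrite mulrCA -vchi -[RHS](Rc f) -big_split; apply: eq_bigr => i _.
  by rewrite /= -(cphi i).1 cE mulrDl !mulrA ![u i * _]mulrC ![v i * _]mulrC.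
have [d dE] := gen chi cchi.
have R1 : Rel (fun i => v i - X * d i).
  move=> f; under eq_bigr do rewrite mulrBl (coindB _ _ (cphi _)).
  rewrite sumrB vchi dE; apply/eqP; rewrite subr_eq0; apply/eqP.
  by apply: eq_bigr => i _; rewrite mulrA [d i * X]mulrC.
have R2 : Rel (fun i => u i + Y * d i).
  move=> f; rewrite -[RHS](uchi f) dE -big_split; apply: eq_bigr => i _.
  by rewrite /= -(cphi i).1 mulrDl mulrA [d i * Y]mulrC.
move=> i; have -> : c i = X * (u i + Y * d i) + Y * (v i - X * d i).
  by rewrite cE; ring.
rewrite -add1n; apply: ordgeD; apply: ordgeM; try exact: ordge_term.
  exact: (IHk _ R2 i).
exact: (IHk _ R1 i).
Qed.

End Coinduced.

(** iota identifies M with the direct sum of the modules W (t i). *)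
Definition decomposition (M : lmodType A) r (t : 'I_r -> nat) (iota : M -> 'I_r -> S) :=
  [/\ forall u i, W (t i) (iota u i),
      forall u v i, iota (u + v) i = iota u i + iota v i,
      forall c u i, iota (c *: u) i = val c * iota u i,
      forall u, (forall i, iota u i = 0) -> u = 0
    & forall F, (forall i, W (t i) (F i)) -> exists u, forall i, iota u i = F i].

(** Maximal Cohen-Macaulay modules are direct sums of modules W t: evaluation
    at 1 identifies M with the part of weight 0 of the free graded module of
    the maps from the series ring to M. *)
Lemma MCM_decomposition (M : lmodType A) : MCM M -> nonzero_module M ->
  exists r (t : 'I_r -> nat) (iota : M -> 'I_r -> S), (0 < r)%N /\ decomposition t iota.
Proof.
move=> mcmM nzM; have [xreg yreg] := MCM_xy_regular mcmM nzM.
have fgM : finitely_generated M by case: mcmM.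
have [r [phi [t [[hphi gen] free]]]] := exists_homogeneous_basis fgM xreg yreg.
have cphi i : coind (phi i) by case: (hphi i).
pose Phi (F : 'I_r -> S) := \sum_i phi i (F i).
have Phi_inj F : (forall i, W (t i) (F i)) -> Phi F = 0 -> forall i, F i = 0.
  move=> WF F0; apply: free => f; rewrite [f]sum_pi.
  under eq_bigr => i _ do rewrite mulr_sumr (coind_sum _ _ _ (cphi i)).
  rewrite exchange_big big1 //= => s _.
  have [s0|s0] := eqVneq (s : nat) 0%N.
    have Wf : W 0 (pi s f) by rewrite s0; exact: pi_W.
    under eq_bigr => i _ do rewrite mulrC -(toAK Wf) (cphi i).2.
    by rewrite -scaler_sumr -/(Phi F) F0 scaler0.
  rewrite big1 // => i _; rewrite (hphi i).2.
  rewrite (pi_eq0 (WM (WF i) (pi_W s f))) ?(coind0 (cphi i)) //.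
  rewrite -[X in _ != X %[mod n]]addn0 eqn_modDl mod0n modn_small //.
have surj u : exists F, (forall i, W (t i) (F i)) /\ Phi F = u.
  have cu : coind (fun f => toA (pi 0 f) *: u).
    split=> [f g|c f].
      rewrite -scalerDl; congr (_ *: _); apply: valA_inj.
      by rewrite valAD !toAK ?piD //; try exact: pi_W; apply: WD; exact: pi_W.
    rewrite scalerA; congr (_ *: _); apply: valA_inj.
    by rewrite valAM !toAK; [exact: (piM 0 f (valA_W c))|exact: pi_W|exact: pi_W].
  have [c cE] := gen _ cu; exists (fun i => pi (t i) (c i)); split=> [i|].
    exact: pi_W.
  have := cE 1; rewrite (pi_id W_one).
  have -> : toA 1 = 1 by apply: valA_inj; rewrite toAK //; exact: W_one.
  rewrite scale1r => ->; apply: eq_bigr => i _.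
  by rewrite mulr1 (hphi i).2 // (pi_id (pi_W _ _)) -(hphi i).2.
have /choice[iota iotaP] := surj.
have iotaW u i : W (t i) (iota u i) by case: (iotaP u).
have iotaE u F : (forall i, W (t i) (F i)) -> Phi F = u -> forall i, iota u i = F i.
  move=> WF Fu i; apply/eqP; rewrite -subr_eq0; apply/eqP.
  apply: (Phi_inj (fun i => iota u i - F i)) => [j|].
    by apply: WB.
  rewrite /Phi; under eq_bigr => j _ do rewrite (coindB _ _ (cphi j)).
  by rewrite sumrB -/(Phi F) Fu -/(Phi (iota u)) (iotaP u).2 subrr.
have [u0 nz0] := nzM.
exists r, t, iota; split.
  rewrite lt0n; apply/eqP => r0; case/eqP: nz0; rewrite -(iotaP u0).2 /Phi.
  by apply: big1 => i; have := ltn_ord i; rewrite [X in (_ < X)%N]r0.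
split=> //.
- move=> u v; apply: iotaE => [i|]; first exact: WD.
  rewrite /Phi; under eq_bigr => i _ do rewrite (cphi i).1.
  by rewrite big_split -!/(Phi _) !(iotaP _).2.
- move=> c u; apply: iotaE => [i|].
    exact: (WM (valA_W c) (iotaW u i)).
  rewrite /Phi; under eq_bigr => i _ do rewrite (cphi i).2.
  by rewrite -scaler_sumr -/(Phi _) (iotaP _).2.
- move=> u u0'; rewrite -(iotaP u).2 /Phi big1 // => i _.
  by rewrite u0' (coind0 (cphi i)).
by move=> F WF; exists (Phi F); exact: iotaE.
Qed.

(** ** The modules W t *)

Local Notation E t := (eigenmodule z a t).

Lemma eigenseries_W t f : (f \in eigenseries z a t) <-> W t f.
Proof.
split=> [/eigenseriesP ft|Wf].
  apply/WP => i j fij; apply/eqP; rewrite -(eq_prim_root_expr prim_z).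
  by apply/eqP; apply: (mulIf fij); exact: ft.
apply/eigenseriesP => i j; have [->|fij] := eqVneq (coef2 f i j) 0.
  by rewrite !mulr0.
congr (_ * _); apply/eqP; rewrite (eq_prim_root_expr prim_z).
by apply/eqP; exact: W_weight fij.
Qed.

Definition toE t f : E t := insubd (0 : E t) f.

Lemma toEK t f : W t f -> val (toE t f) = f.
Proof. by move=> Wf; rewrite /toE val_insubd ifT //; apply/eigenseries_W. Qed.

Lemma eigenmodule_W t (u : E t) : W t (val u).
Proof. by apply/eigenseries_W; exact: em_valP. Qed.

Lemma eigenmodule_decomposition t :
  decomposition (fun=> t : nat) (fun (u : E t) (_ : 'I_1) => val u).
Proof.
split=> [u _|u v _|c u _|u u0|F WF] //.
- exact: eigenmodule_W.
- by apply: val_inj; rewrite (u0 ord0).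
- exists (toE t (F ord0)) => i; rewrite (ord1 i) toEK //; exact: (WF ord0).
Qed.

Definition box (k : 'I_(n * n)) : nat * nat := (k %/ n, k %% n)%N.

(** The monomials with exponents less than n generate S over A, since all powers
    of x^n and y^n are invariant. *)
Lemma box_decomp t f : W t f -> exists2 g : 'I_(n * n) -> A,
  f = \sum_k val (g k) * term 1 (box k).1 (box k).2
  & forall k, (box k).1 + a * (box k).2 <> t %[mod n] -> g k = 0.
Proof.
move=> Wf; have [|g fE gW] := @term_decomp K _ (fun k => (box k).1) (fun k => (box k).2)
    (fun k i j => [/\ (i %% n == 0), (j %% n == 0)
       & (box k).1 + a * (box k).2 == t %[mod n]])%N f.
  move=> i j fij.
  have lt_ij : ((i %% n) * n + j %% n < n * n)%N.
    apply: (@leq_trans ((i %% n).+1 * n)); first by rewrite mulSnr ltn_add2l ltn_mod.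
    by rewrite leq_mul2r ltn_mod n_gt0 orbT.
  exists (Ordinal lt_ij); rewrite /= divnMDl // divn_small ?ltn_mod // addn0.
  have modB m : ((m - m %% n) %% n = 0)%N.
    by rewrite {1}(divn_eq m n) addnK modnMl.
  rewrite modnMDl modn_mod; split; try exact: leq_mod.
  rewrite !modB !eqxx; split=> //; apply/eqP; rewrite -(W_weight Wf fij).
  by rewrite modnDml -modnDmr modnMmr modnDmr.
have Wg k : W 0 (g k).
  apply/WP => p q /gW[/eqP p0 /eqP q0 _].
  by rewrite -modnDm p0 -modnMmr q0 muln0 mod0n addn0 mod0n.
exists (fun k => toA (g k)).
  by rewrite fE; apply: eq_bigr => k _; rewrite toAK // mulrC.
move=> k nk; apply: valA_inj; rewrite toAK // valA0; apply: series2P => i j.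
by apply: contrapT => /eqP/gW[_ _ /eqP].
Qed.

Lemma fg_eigenmodule t : finitely_generated (E t).
Proof.
exists (codom (fun k => toE t (term 1 (box k).1 (box k).2))).
apply/seteqP; split=> // u _; apply: span_codom.
have [g uE g0] := box_decomp (eigenmodule_W u).
exists g; apply: val_inj; rewrite uE.
have -> : val (\sum_k g k *: toE t (term 1 (box k).1 (box k).2)) =
    \sum_k val (g k *: toE t (term 1 (box k).1 (box k).2)) by rewrite em_val_sum.
apply: eq_bigr => k _; rewrite em_val_scale.
have [kt|nk] := pselect ((box k).1 + a * (box k).2 = t %[mod n]).
  by rewrite toEK //; apply: W_mod kt _; exact: W_term.
by rewrite g0 // valA0 !mul0r.
Qed.

Lemma eigenmodule_regular t : regular_sequence (E t) [:: xn; yn].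
Proof.
have Xn : [:: xn; yn] = rcons [:: xn] yn by [].
have X1 : [:: xn] = rcons [::] xn by [].
have val0 (u : E t) : val u = 0 -> u = 0.
  by move=> u0; apply: val_inj; rewrite u0.
split.
- by move=> r; rewrite /= !inE => /orP[/eqP ->|/eqP ->]; [exact: max_xn|exact: max_yn].
- case=> [|[|//]] _ u.
    rewrite /= smul_nil => xu; apply: val0.
    have : val (xn *: u) = 0 by rewrite xu.
    rewrite em_val_scale val_xn => xu0; apply: (@termI _ 1 n 0 (oner_neq0 _)).
    by rewrite xu0 mulr0.
  rewrite [take _ _]/= X1 => /smul_rcons[v]; rewrite smul_nil => yuv.
  have {}yuv : term 1 0 n * val u = term 1 n 0 * val v.
    rewrite -val_xn -val_yn -!em_val_scale; congr val.
    by apply/eqP; rewrite -subr_eq0; apply/eqP.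
  pose w : S := Series2 (fun i j => coef2 (val u) (i + n) j).
  have Ww : W t w.
    apply/WP => i j /(W_weight (eigenmodule_W u)) <-.
    by rewrite addnAC modnDr.
  apply/smul_rcons; exists (toE t w); rewrite smul_nil; apply: val0.
  have -> : val (u - xn *: toE t w) = val u - term 1 n 0 * w.
    by rewrite em_valB em_val_scale toEK // val_xn.
  apply/eqP; rewrite subr_eq0; apply/eqP/series2P => i j; rewrite coef2_termM.
  case: ifPn => [/andP[ni _]|]; first by rewrite /= subnK // subn0 mul1r.
  rewrite andbT -ltnNge => lt_in.
  have := coef2_congr i (j + n)%N yuv; rewrite !coef2_termM leq_addl addnK subn0 mul1r.
  by rewrite [(n <= i)%N]leqNgt lt_in.
apply/eqP => /seteqP[_ /(_ (toE t (term 1 (t %% n) 0)) I)].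
rewrite Xn X1 => /smul_rcons[v /smul_rcons[w]]; rewrite smul_nil => tE.
have {tE} : val (toE t (term 1 (t %% n) 0)) = term 1 0 n * val v + term 1 n 0 * val w.
  rewrite -val_xn -val_yn -!em_val_scale -em_valD; congr val; apply/eqP.
  by rewrite -subr_eq0 opprD addrA; apply/eqP.
rewrite toEK => [/(coef2_congr (t %% n) 0)|]; last first.
  by apply: W_mod (W_term _ _ _); rewrite muln0 addn0 modn_mod.
rewrite coef2D !coef2_termM coef2_term !eqxx /= (leqNgt n) n_gt0 (leqNgt n) ltn_mod n_gt0.
by rewrite addr0 => /eqP; rewrite oner_eq0.
Qed.

Lemma nonzero_eigenmodule t : nonzero_module (E t).
Proof.
exists (toE t (term 1 (t %% n) 0)); apply/eqP => /(congr1 val).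
rewrite toEK ?em_val0 => [/(coef2_congr (t %% n) 0)/eqP|].
  by rewrite coef2_term !eqxx oner_eq0.
by apply: W_mod (W_term _ _ _); rewrite muln0 addn0 modn_mod.
Qed.

Lemma MCM_eigenmodule t : MCM (E t).
Proof.
split=> [|_]; first exact: fg_eigenmodule.
rewrite krull_dim_A /depth (@nat_supremum _ 2) //.
  by exists [:: xn; yn] => //; exact: eigenmodule_regular.
by move=> _ [s sreg <-]; exact: regular_sequence_size (fg_eigenmodule t) sreg.
Qed.

(** ** Trace ideals *)

Lemma inverse_mod : exists b, a * b = 1 %[mod n].
Proof.
have [a0|a_gt0] := posnP a.
  by move: co_an; rewrite a0 /coprime gcd0n => /eqP n1; move: n_gt1; rewrite n1.
have /coprimeP - /(_ a_gt0)[[u v] /= uv] := co_an.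
exists u; have -> : (a * u = v * n + 1)%N by rewrite mulnC; lia.
by rewrite modnMDl.
Qed.

(** Maps on an eigenspace that commute with invariants are multiplications by
    a series: the images of a power of x and of a power of y are proportional
    to these powers. *)
Lemma W_hom t (phi : S -> S) :
    (forall (c : A) f, W t f -> phi (val c * f) = val c * phi f) ->
  exists h, forall f, W t f -> phi f = f * h.
Proof.
move=> phiZ; have [b ab] := inverse_mod.
pose X := term (1 : K) (t + n) 0; pose Y := term (1 : K) 0 (b * t).
have WX : W t X.
  by apply: W_mod (W_term _ _ _); rewrite muln0 addn0 modnDr.
have WY : W t Y.
  by apply: W_mod (W_term _ _ _); rewrite add0n mulnA -modnMml ab modnMml mul1n.
have phiX f : W t f -> X * phi f = f * phi X.
  move=> Wf; pose p := (t * (n - 1))%N; pose P := term (1 : K) p 0.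
  have tp : t + p = 0 %[mod n].
    by rewrite /p -mulnS -subSn // subn1 /= modnMl mod0n.
  have WP0 : W p P by apply: W_mod (W_term _ _ _); rewrite muln0 addn0.
  have W0 g : W t g -> W 0 (P * g).
    by move=> Wg; apply: W_mod (WM WP0 Wg); rewrite addnC.
  apply: (@termI _ 1 p 0 (oner_neq0 _)); rewrite -/P !mulrA.
  rewrite -(toAK (W0 _ WX)) -(toAK (W0 _ Wf)) -!phiZ // !toAK; try exact: W0.
  by rewrite mulrAC.
have [h hE] : exists h, phi X = X * h.
  exists (Series2 (fun i j => coef2 (phi X) (i + (t + n)) j)).
  apply: series2P => i j; rewrite coef2_termM /= subn0 mul1r andbT.
  case: ifPn => [?|]; first by rewrite subnK.
  rewrite -ltnNge => lt_i; have := coef2_congr i (j + b * t) (phiX Y WY).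
  rewrite !coef2_termM [(t + n <= i)%N]leqNgt lt_i.
  by rewrite !leq0n leq_addl addnK !subn0 !mul1r /= => <-.
exists h => f Wf; apply: (@termI _ 1 (t + n) 0 (oner_neq0 _)).
by rewrite -/X phiX // hE mulrCA.
Qed.

Section Traces.
Variables (M : lmodType A) (r : nat) (t : 'I_r -> nat) (iota : M -> 'I_r -> S).
Hypothesis dec : decomposition t iota.

Lemma decomposition_inj u v : (forall i, iota u i = iota v i) -> u = v.
Proof.
have [_ iD iZ i0 _] := dec => uv; apply/eqP; rewrite -subr_eq0; apply/eqP.
apply: i0 => i; rewrite -scaleN1r iD iZ uv.
have -> : val (-1 : A) = -1 by [].
by rewrite mulN1r subrr.
Qed.

Lemma decomposition_sum I (s : seq I) (P : pred I) (F : I -> M) i :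
  iota (\sum_(k <- s | P k) F k) i = \sum_(k <- s | P k) iota (F k) i.
Proof.
have [_ iD iZ _ _] := dec.
elim/big_rec2: _ => [|k x y _ <-]; last by rewrite iD.
by have := iZ 0 0 i; rewrite scale0r => ->; rewrite valA0 mul0r.
Qed.

Definition incl i f : M :=
  xget 0 [set u | forall j, iota u j = if j == i then f else 0].

Lemma inclE i f : W (t i) f ->
  forall j, iota (incl i f) j = if j == i then f else 0.
Proof.
move=> Wf; have [_ _ _ _ surj] := dec; rewrite /incl; case: xgetP => [u _ //|nu].
have [|u uE] := surj (fun j => if j == i then f else 0).
  by move=> j; case: eqP => [->|_] //; exact: W_zero.
by case: (nu u).
Qed.

Lemma sum_incl u : u = \sum_i incl i (iota u i).
Proof.
have [iW _ _ _ _] := dec; apply: decomposition_inj => j.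
rewrite decomposition_sum (bigD1 j) //= inclE // eqxx.
by rewrite big1 ?addr0 // => i ij; rewrite inclE // eq_sym (negPf ij).
Qed.

Lemma decomposition_hom (phi : {linear M -> A^o}) :
  exists h : 'I_r -> S, forall u, val (phi u : A) = \sum_i iota u i * h i.
Proof.
have [iW iD iZ _ _] := dec.
have /choice[h hP] : forall i, exists h, forall f, W (t i) f ->
    val (phi (incl i f) : A) = f * h.
  move=> i; apply: W_hom => c f Wf; rewrite -valAM; congr val.
  rewrite -[c * _]/(c *: phi (incl i f)) -linearZ; congr (phi _).
  have Wcf : W (t i) (val c * f) by exact: (WM (valA_W c) Wf).
  apply: decomposition_inj => j; rewrite iZ !inclE //.
  by case: ifP; rewrite ?mulr0.
exists h => u; rewrite {1}[u]sum_incl linear_sum valA_sum.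
by apply: eq_bigr => i _; rewrite hP.
Qed.

(** Maps to A multiply the components by series, so every monomial of their
    values is divisible by a monomial of one of the weights t i. *)
Lemma trace_coef p q (f : A) :
    (forall i p' q', (p' <= p)%N -> (q' <= q)%N -> p' + a * q' <> t i %[mod n]) ->
  trace_ideal M f -> coef2 (val f) p q = 0.
Proof.
have [iW iD iZ _ _] := dec => npq.
pose N : set A^o := [set c : A | forall p' q', (p' <= p)%N -> (q' <= q)%N ->
  coef2 (val c) p' q' = 0].
have subN : submodule N.
  apply/submoduleP; split=> // c f1 f2 N1 N2 p' q' pp' qq'.
  rewrite -[_ *: _]/(c * f1) valAD coef2D N2 // addr0 valAM.
  apply: contrapT => /eqP/coef2M_neq0[k [l [kp lq _ /eqP]]]; apply.
  by apply: N1; apply: leq_trans (leq_subr _ _) _.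
suff TN : trace_ideal M `<=` N by move=> /TN; apply.
apply: (span_sub subN) => _ [phi _ [u _ <-]].
have [h hE] := decomposition_hom phi => p' q' pp' qq'; rewrite hE.
rewrite coef2_sum big1 // => i _.
apply: contrapT => /eqP/coef2M_neq0[k [l [kp lq /(W_weight (iW u i)) kl _]]].
by apply: npq kl; [exact: leq_trans pp'|exact: leq_trans qq'].
Qed.

(** Split an element of the maximal ideal along monomials of weight t i; a
    cofactor has weight - t i, so the multiplication by it maps W (t i) to A. *)
Lemma trace_covers i :
    (forall p q, (0 < p + q)%N -> p + a * q = 0 %[mod n] -> exists p' q',
      [/\ (p' <= p)%N, (q' <= q)%N & p' + a * q' = t i %[mod n]]) ->
  maximal_ideal A `<=` trace_ideal M.
Proof.
have [iW iD iZ _ _] := dec => cov f /maximal_idealE f0.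
have [|g fE gW] := @term_decomp K _ (fun k => (box k).1) (fun k => (box k).2)
    (fun k p q => (box k).1 + a * (box k).2 = t i %[mod n] /\
       p + a * q = (t i * (n - 1)) %[mod n])%N (val f).
  move=> p q fpq; have [||p' [q' [pp' qq' pqt]]] := cov p q.
  - by case: p q fpq => [|p] [|q]; rewrite ?f0 ?eqxx // !addnS.
  - exact: W_weight (valA_W f) fpq.
  have lt_ij : ((p' %% n) * n + q' %% n < n * n)%N.
    apply: (@leq_trans ((p' %% n).+1 * n)); first by rewrite mulSnr ltn_add2l ltn_mod.
    by rewrite leq_mul2r ltn_mod n_gt0 orbT.
  have pp1 : (p' %% n <= p)%N by exact: leq_trans (leq_mod _ _) pp'.
  have qq1 : (q' %% n <= q)%N by exact: leq_trans (leq_mod _ _) qq'.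
  have wt : p' %% n + a * (q' %% n) = t i %[mod n].
    by rewrite -pqt modnDml -modnDmr modnMmr modnDmr.
  exists (Ordinal lt_ij); rewrite /= divnMDl // divn_small ?ltn_mod // addn0.
  rewrite modnMDl modn_mod; split=> //; split=> //.
  apply/eqP; rewrite -(eqn_modDr (t i)) -mulnSr -subSn // subn1 /= modnMl.
  rewrite -modnDmr -wt modnDmr addnACA -mulnDr !subnK //.
  by rewrite (W_weight (valA_W f) fpq) mod0n.
have subT := submodule_span (\bigcup_(phi in [set: {linear M -> A^o}]) range phi).
have -> : f = \sum_k toA (term 1 (box k).1 (box k).2 * g k).
  apply: valA_inj; rewrite fE valA_sum; apply: eq_bigr => k _; rewrite toAK //.
  apply/WP => p q /coef2M_neq0[k' [l' [kp lq]]]; rewrite coef2_term.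
  case: ifP => [/andP[/eqP k1 /eqP l1] _ /gW[w1 w2]|_]; last by rewrite eqxx.
  have -> : (p + a * q = (k' + a * l') + (p - k' + a * (q - l')))%N.
    by rewrite addnACA -mulnDr !subnKC.
  rewrite -modnDm w2 k1 l1 w1 modnDm -mulnS -subSn // subn1 /=.
  by rewrite modnMl mod0n.
apply: (submodule_sum _ subT) => k _; apply: sub_span.
have Wg : W (t i * (n - 1)) (g k) by apply/WP => p q /gW[].
have Wug u : W 0 (iota u i * g k).
  apply: W_mod (WM (iW u i) Wg).
  by rewrite -mulnS -subSn // subn1 /= modnMl mod0n.
have philin : linear ((fun u => toA (iota u i * g k)) : M -> A^o).
  move=> c u v; apply: valA_inj; rewrite toAK // iD iZ mulrDl.
  rewrite -[c *: _]/(c * toA _) -[X in _ = \val X]/(c * _ + toA _).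
  by rewrite valAD valAM !toAK // mulrA.
pose phi : {linear M -> A^o} := HB.pack ((fun u => toA (iota u i * g k)) : M -> A^o)
  (GRing.isLinear.Build _ _ _ _ _ philin).
exists phi => //; have [kt|nk] := pselect ((box k).1 + a * (box k).2 = t i %[mod n]).
  exists (incl i (term 1 (box k).1 (box k).2)) => //=.
  by rewrite inclE ?eqxx //; apply: W_mod kt (W_term _ _ _).
exists 0 => //=; have g0 : g k = 0.
  by apply: series2P => p q; apply: contrapT => /eqP/gW[].
by rewrite g0 !mulr0.
Qed.

End Traces.

(** ** Lengths and numbers of generators *)

Section Lengths.
Variables (e : nat) (bp bq : nat -> nat).
Hypothesis bd : boundary n a e bp bq.
Variables (M : lmodType A) (r : nat) (t : 'I_r -> nat) (iota : M -> 'I_r -> S).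
Hypothesis dec : decomposition t iota.

Local Notation in_power := (in_power n a).
Local Notation outside := (outside n a).
Local Notation incl := (incl iota).
Local Notation inclE := (inclE dec).

Lemma W_in_power0 s f p q : W s f -> coef2 f p q != 0 -> in_power s 0 p q.
Proof. by move=> Wf /(W_weight Wf) /eqP. Qed.

Lemma incl_sum i (I : finType) (F : I -> S) : (forall k, W (t i) (F k)) ->
  incl i (\sum_k F k) = \sum_k incl i (F k).
Proof.
move=> WF; apply: (decomposition_inj dec) => j.
rewrite inclE ?(decomposition_sum dec); last exact: W_sum.
case: (j =P i) => [->|ji]; first by apply: eq_bigr => k _; rewrite inclE // eqxx.
by rewrite big1 // => k _; rewrite inclE //; case: eqP ji.
Qed.

Lemma incl_scale i (c : A) f : W (t i) f -> incl i (val c * f) = c *: incl i f.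
Proof.
move=> Wf; have [_ _ iZ _ _] := dec; apply: (decomposition_inj dec) => j.
have Wcf : W (t i) (val c * f) by exact: (WM (valA_W c) Wf).
by rewrite iZ !inclE //; case: ifP; rewrite ?mulr0.
Qed.

(** F i tells which monomials the i-th component may have. *)
Definition monomial_sub (F : 'I_r -> nat -> nat -> Prop) : set M :=
  [set u | forall i p q, coef2 (iota u i) p q != 0 -> F i p q].

Lemma submodule_monomial F :
    (forall i p q k l, (k <= p)%N -> (l <= q)%N -> (n %| k + a * l)%N ->
       p - k + a * (q - l) = t i %[mod n] -> F i (p - k)%N (q - l)%N -> F i p q) ->
  submodule (monomial_sub F).
Proof.
move=> FD; have [iW iD iZ _ _] := dec; apply/submoduleP; split=> [i p q|c u v Fu Fv i p q].
  by have := iZ 0 0 i; rewrite scale0r valA0 mul0r => ->; rewrite eqxx.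
rewrite iD iZ coef2D; have [-> |/Fv //] := eqVneq (coef2 (iota v i) p q) 0.
rewrite addr0 => /coef2M_neq0[k [l [kp lq /(W_weight (valA_W c)) ckl upq]]].
apply: (FD i p q k l) => //; last exact: Fu.
  by rewrite /dvdn ckl mod0n.
exact: W_weight upq.
Qed.

(** The submodule m^k M, by the lemma iter_smul below. *)
Definition powers k := monomial_sub (fun i p q => in_power (t i) k p q).

Lemma submodule_powers k : submodule (powers k).
Proof.
apply: submodule_monomial => i p q k' l' kp lq nkl _ /(in_power_add nkl).
by rewrite !subnK.
Qed.

Lemma max_term p q : (0 < p + q)%N -> (n %| p + a * q)%N ->
  val (toA (term 1 p q)) = term 1 p q /\ maximal_ideal A (toA (term 1 p q)).
Proof.
move=> pq0 npq; have vE : val (toA (term 1 p q)) = term 1 p q.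
  by apply: toAK; apply: W_mod (W_term _ _ _); rewrite mod0n; apply/eqP.
split=> //; apply/maximal_idealE; rewrite vE coef2_term.
by case: p q pq0 {npq vE} => [|p] [|q].
Qed.

(** The maximal ideal is generated by the boundary monomials, which are finite
    in number, so a series with monomials in m^(k+1) W_t can be split along
    them. *)
Lemma iter_smul k : iter k (smul (maximal_ideal A)) [set: M] = powers k.
Proof.
have [iW iD iZ _ _] := dec.
elim: k => [|k IHk]; first by apply/seteqP; split=> // u _ i p q; exact: W_in_power0.
rewrite iterS IHk; apply/seteqP; split.
  apply: span_sub; first exact: submodule_powers.
  move=> _ [c mc [u Eu <-]] i p q; rewrite iZ => /coef2M_neq0[k' [l' [kp lq ckl upq]]].
  apply/in_powerS; exists k', l'; split=> //; last exact: Eu upq.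
    case: k' l' ckl {kp lq upq} => [|k'] [|l'] //.
    by move/maximal_idealE: mc => ->; rewrite eqxx.
  by rewrite /dvdn (W_weight (valA_W c) ckl) mod0n.
move=> u Eu; have subs := submodule_smul (maximal_ideal A) (powers k).
rewrite [u](sum_incl dec); apply: (submodule_sum _ subs) => i _.
have [|g uE gE] := @term_decomp K 'I_e.+1 (fun j => bp j) (fun j => bq j)
    (fun j p q => in_power (t i) k p q) (iota u i).
  move=> p q /Eu/in_powerS[k' [l' [kp lq kl0 nkl E]]].
  have [j [je jk jl]] := invariant_ge bd n_gt0 nkl kl0.
  exists (Ordinal (je : (j < e.+1)%N)); split=> /=.
  - exact: leq_trans kp.
  - exact: leq_trans lq.
  have -> : (p - bp j = (p - k') + (k' - bp j))%N by lia.
  have -> : (q - bq j = (q - l') + (l' - bq j))%N by lia.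
  apply: in_power_add E; have := nkl.
  have -> : (k' + a * l' = (k' - bp j + a * (l' - bq j)) + (bp j + a * bq j))%N.
    by rewrite addnACA -mulnDr !subnK.
  by rewrite dvdn_addl // (bd_weight bd).
have Wg j : W (t i) (g j).
  by apply/WP => p q /gE; exact: in_power_weight.
have wj (j : 'I_e.+1) : (0 < bp j + bq j)%N /\ (n %| bp j + a * bq j)%N.
  have je : (j <= e)%N by rewrite -ltnS.
  split; last exact: (bd_weight bd).
  have [->|j0] := posnP j; first by rewrite (bd_p0 bd) (bd_q0 bd) addn0.
  by rewrite addn_gt0 orbC -(bd_q0 bd) (q_mono_lt bd).
rewrite uE incl_sum => [|j]; last first.
  by case: (max_term (wj j).1 (wj j).2) => <- _; exact: (WM (valA_W _) (Wg j)).
apply: (submodule_sum _ subs) => j _; apply: sub_span.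
have [vE mE] := max_term (wj j).1 (wj j).2.
exists (toA (term 1 (bp j) (bq j))) => //; exists (incl i (g j)).
  move=> i' p q; rewrite inclE //; case: (i' =P i) => [->|_]; first exact: gE.
  by rewrite eqxx.
by rewrite -{2}vE incl_scale.
Qed.

Definition outside_list k : seq ('I_r * (nat * nat)) :=
  [seq (i, pq) | i <- enum 'I_r, pq <- outside (t i) k].

Lemma size_outside_list k :
  size (outside_list k) = (\sum_i size (outside (t i) k))%N.
Proof. by rewrite size_allpairs_dep sumnE big_map big_enum. Qed.

Lemma outside_list_uniq k : uniq (outside_list k).
Proof.
apply: allpairs_uniq_dep => [|i _|]; [exact: enum_uniq|exact: outside_uniq|].
by move=> [i pq] [i' pq'] _ _ /= [-> ->].
Qed.

Lemma mem_outside_list k i p q : ((i, (p, q)) \in outside_list k) =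
  (p + a * q == t i %[mod n]) && ~~ in_power (t i) k p q.
Proof.
rewrite -mem_outside //; apply/allpairsPdep/idP => [[i' [pq [_ o [-> ->]]]] //|o].
by exists i, (p, q); rewrite mem_enum.
Qed.

Definition coord (x : 'I_r * (nat * nat)) u := coef2 (iota u x.1) x.2.1 x.2.2.

Lemma coordD x u v : coord x (u + v) = coord x u + coord x v.
Proof. by have [_ iD _ _ _] := dec; rewrite /coord iD. Qed.

Lemma coordZ x c u : coord x (cst c *: u) = c * coord x u.
Proof.
have [_ _ iZ _ _] := dec; rewrite /coord iZ val_cst coef2_termM /=.
by rewrite !subn0.
Qed.

Lemma powers_coord k u :
  (forall x, x \in outside_list k -> coord x u = 0) -> powers k u.
Proof.
move=> u0 i p q upq; have [iW _ _ _ _] := dec; apply: contraNT (upq) => nE.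
apply/eqP; apply: (u0 (i, (p, q))); rewrite mem_outside_list nE andbT.
by apply/eqP; exact: W_weight (iW u i) upq.
Qed.

Lemma coord_incl x y : x.2.1 + a * x.2.2 = t x.1 %[mod n] ->
  coord y (incl x.1 (term 1 x.2.1 x.2.2)) = (y == x)%:R.
Proof.
case: x y => [i [p q]] [j [p' q']] /= wt; rewrite /coord /= inclE; last first.
  by apply: W_mod wt (W_term _ _ _).
rewrite -[(j, _) == _]/((j == i) && ((p' == p) && (q' == q))).
by case: eqP => //= _; case: ifP.
Qed.

Lemma outside_weight k x : x \in outside_list k ->
  x.2.1 + a * x.2.2 = t x.1 %[mod n].
Proof. by case: x => [i [p q]]; rewrite mem_outside_list => /andP[/eqP]. Qed.

(** The coefficients of the monomials outside m^k M bound the length from above.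
    Conversely, adjoining these monomials by decreasing degree gives a chain of
    submodules. *)
Lemma colength_powers k :
  colength (iter k (smul (maximal_ideal A)) [set: M]) = size (outside_list k).
Proof.
rewrite iter_smul; set L := outside_list k.
have [iW iD iZ _ _] := dec; apply: nat_supremum => [|m [P [PN Pm]]]; last first.
  rewrite -(card_ord (size L)).
  apply: (@chain_bound M (powers k) 'I_(size L)
    (fun u j => coord (tnth (in_tuple L) j) u) P).
  - by move=> u v j; exact: coordD.
  - by move=> c u j; exact: coordZ.
  - move=> u u0; apply: powers_coord => x; rewrite -/L => /seq_tnthP[j ->].
    exact: u0.
  - exact: PN.
  - by move=> l /Pm[sPP nPP]; split.
pose deg (x : 'I_r * (nat * nat)) := (x.2.1 + x.2.2)%N.
pose le x y := (deg y <= deg x)%N.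
have le_tr : transitive le by move=> y x w xy yw; exact: leq_trans yw xy.
have le_tot : total le by move=> x y; exact: leq_total.
pose L' := sort le L.
have L'L x : (x \in L') = (x \in L) by rewrite mem_sort.
have uL' : uniq L' by rewrite sort_uniq outside_list_uniq.
have sL' : size L' = size L by rewrite size_sort.
pose F j i p q := in_power (t i) k p q \/ (i, (p, q)) \in take j L'.
exists (fun j => monomial_sub (F j)); split=> j jD.
  split; last by move=> u Eu i p q /Eu; left.
  apply: submodule_monomial => i p q k' l' kp lq nkl wt [E|low].
    by left; move: (in_power_add nkl E); rewrite !subnK.
  have [|nE] := boolP (in_power (t i) k p q); [by left|right].
  have [kl0|kl0] := posnP (k' + l').
    have [-> ->] : p = (p - k')%N /\ q = (q - l')%N by lia.
    exact: low.
  have inL : (i, (p, q)) \in L'.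
    rewrite L'L mem_outside_list nE andbT.
    have -> : (p + a * q = (k' + a * l') + (p - k' + a * (q - l')))%N.
      by rewrite addnACA -mulnDr !subnKC.
    by have /dvdnP[c ->] := nkl; rewrite modnMDl wt.
  have low' : (i, (p - k', q - l')%N) \in L' by exact: mem_take low.
  rewrite in_take //; rewrite in_take // in low; apply: leq_ltn_trans low.
  rewrite leqNgt; apply/negP => lt_ind.
  have := sorted_ltn_index le_tr (sort_sorted le_tot L) _ _ low' inL lt_ind.
  by rewrite /le /deg /=; lia.
have jL : (j < size L')%N by rewrite sL'.
pose x := tnth (in_tuple L') (Ordinal jL).
have xE x0 : nth x0 L' j = x by rewrite /x (tnth_nth x0).
have xL : x \in L by rewrite -L'L; exact: mem_tnth.
have xindex : index x L' = j by rewrite -(xE x) index_uniq.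
split; last first.
  move=> /(_ (incl x.1 (term 1 x.2.1 x.2.2))) sub.
  have /sub Fx : monomial_sub (F j.+1) (incl x.1 (term 1 x.2.1 x.2.2)).
    move=> i p q upq; right; have := coord_incl (i, (p, q)) (outside_weight xL).
    rewrite /coord /= => ipq; have /eqP -> : (i, (p, q)) == x.
      by apply: contraNT upq => ne; rewrite ipq (negPf ne).
    by rewrite (take_nth x) // xE mem_rcons mem_head.
  have : coord x (incl x.1 (term 1 x.2.1 x.2.2)) != 0.
    by rewrite coord_incl ?eqxx ?oner_neq0 //; exact: outside_weight xL.
  move=> /Fx[E|].
    by move: xL E; case: (x) => [i [p q]]; rewrite mem_outside_list => /andP[_ /negP].
  rewrite -surjective_pairing -surjective_pairing in_take ?L'L //.
  by rewrite xindex ltnn.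
move=> u Fu i p q /Fu[]; [by left|move=> ij; right].
by rewrite (take_nth x) // mem_rcons inE ij orbT.
Qed.

Lemma nat_infimum (X : set nat) m : X m -> (forall k, X k -> (m <= k)%N) ->
  infimum 0%N X = m.
Proof.
move=> Xm Xge; have X0 : X != set0 by apply/set0P; exists m.
rewrite /infimum ifN //; case: xgetP => [y _ [yl yu]|/(_ m)].
  by apply/eqP; rewrite eqn_leq -!leEnat yl ?yu.
by case; split=> // k; apply.
Qed.

Lemma incl_weight i p q : p + a * q = t i %[mod n] -> W (t i) (term 1 p q).
Proof. by move=> wt; apply: W_mod wt (W_term _ _ _). Qed.

Definition minimal_monomials : seq M :=
  [seq incl x.1 (term 1 x.2.1 x.2.2) | x <- outside_list 1].

Lemma span_minimal_monomials : span [set` minimal_monomials] = setT.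
Proof.
have [iW iD iZ _ _] := dec; set s := minimal_monomials.
apply/seteqP; split=> // u _; have subs := submodule_span [set` s].
rewrite [u](sum_incl dec); apply: (submodule_sum _ subs) => i _.
set o := outside (t i) 1.
have [|g uE gE] := @term_decomp K 'I_(size o) (fun k => (nth (0, 0)%N o k).1)
    (fun k => (nth (0, 0)%N o k).2) (fun _ p q => (n %| p + a * q)%N) (iota u i).
  move=> p q /(W_weight (iW u i)) wt.
  have [p' [q' [op lp lq d]]] := outside1_divides n_gt0 wt.
  have lt_o : (index (p', q') o < size o)%N by rewrite index_mem.
  by exists (Ordinal lt_o); rewrite /= nth_index.
have Wg k : W 0 (g k) by apply/WP => p q /gE /eqP; rewrite mod0n.
have ok (k : 'I_(size o)) : (i, nth (0, 0)%N o k) \in outside_list 1.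
  apply/allpairsPdep; exists i, (nth (0, 0)%N o k); rewrite mem_enum.
  by split=> //; exact: mem_nth.
have wk (k : 'I_(size o)) := outside_weight (ok k).
rewrite uE incl_sum => [|k]; last first.
  by rewrite mulrC -(toAK (Wg k)); exact: (WM (valA_W _) (incl_weight (wk k))).
apply: (submodule_sum _ subs) => k _; rewrite mulrC -(toAK (Wg k)).
rewrite incl_scale; last exact: incl_weight (wk k).
apply: (submoduleZ _ subs); apply: sub_span; apply/mapP.
by exists (i, nth (0, 0)%N o k).
Qed.

(** The coefficients of the minimal monomials are functionals on M/mM. *)
Lemma generators_ge (s : seq M) : span [set` s] = setT ->
  (size (outside_list 1) <= size s)%N.
Proof.
move=> sT; set L := outside_list 1; have [iW iD iZ _ _] := dec.
have coordA x (c : A) u : x \in L -> coord x (c *: u) = coef2 (val c) 0 0 * coord x u.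
  case: x => i [p q]; rewrite mem_outside_list => /andP[wt nE]; rewrite /coord /=.
  set c0 := coef2 (val c) 0 0.
  have -> : iota (c *: u) i = term c0 0 0 * iota u i + (val c - term c0 0 0) * iota u i.
    by rewrite -mulrDl addrC subrK iZ.
  rewrite coef2D coef2_termM /= !subn0 [X in _ + X](_ : _ = 0) ?addr0 //.
  apply: contraNeq nE => /coef2M_neq0[k [l [kp lq]]].
  rewrite coef2B coef2_term => ckl upq; apply/in_powerS; exists k, l.
  case: (posnP (k + l)) ckl => [|kl0 ckl].
    by case: k {kp upq} => [|k] //; case: l {lq} => [|l] //; rewrite subrr eqxx.
  split=> //; last by apply/eqP; exact: W_weight upq.
  have : coef2 (val c) k l != 0.
    by move: ckl kl0; case: k {kp upq} => [|k]; case: l {lq} => [|l] //=; rewrite subr0.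
  by move=> /(W_weight (valA_W c)) kln; rewrite /dvdn kln mod0n.
pose B : 'M[K]_(size s, size L) :=
  \matrix_(j, k) coord (tnth (in_tuple L) k) s`_j.
have /choice[c cE] : forall k : 'I_(size L), exists c : 'I_(size s) -> A,
    incl (tnth (in_tuple L) k).1 (term 1 (tnth (in_tuple L) k).2.1
      (tnth (in_tuple L) k).2.2) = \sum_j c j *: s`_j.
  by move=> k; apply: span_seqP; rewrite sT.
pose C : 'M[K]_(size L, size s) := \matrix_(k, j) coef2 (val (c k j)) 0 0.
have CB : C *m B = 1%:M.
  apply/matrixP => k k'; rewrite !mxE.
  have kL := mem_tnth k (in_tuple L); have k'L := mem_tnth k' (in_tuple L).
  have uL : uniq (in_tuple L) by exact: outside_list_uniq.
  rewrite eq_sym -(inj_eq (tuple_uniqP _ uL)) -coord_incl; last exact: outside_weight kL.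
  rewrite cE.
  have -> : coord (tnth (in_tuple L) k') (\sum_j c k j *: s`_j) =
      \sum_j coord (tnth (in_tuple L) k') (c k j *: s`_j).
    by rewrite /coord (decomposition_sum dec) coef2_sum.
  by apply: eq_bigr => j _; rewrite coordA // !mxE.
rewrite -[size (outside_list 1)](mxrank1 K) -CB.
exact: leq_trans (mxrankM_maxr _ _) (rank_leq_row _).
Qed.

Lemma min_generatorsE : min_generators M = size (outside_list 1).
Proof.
apply: nat_infimum => [|_ [s sT <-]]; last exact: generators_ge.
by exists minimal_monomials; [exact: span_minimal_monomials|rewrite size_map].
Qed.

Lemma size_outside_list_le k :
  (2 * size (outside_list k) <= r * e * (k * k.+1))%N.
Proof.
rewrite size_outside_list big_distrr /= -mulnA.
have -> : (r * (e * (k * k.+1)) = \sum_(i < r) e * (k * k.+1))%N.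
  by rewrite sum_nat_const card_ord.
by apply: leq_sum => i _; exact: size_outside_le bd n_gt0 (t i) k.
Qed.

Lemma size_outside_list_ge k :
  (r * e * ((k - 2) * (k - 1)) <= 2 * size (outside_list k))%N.
Proof.
rewrite size_outside_list big_distrr /= -mulnA.
have -> : (r * (e * ((k - 2) * (k - 1))) = \sum_(i < r) e * ((k - 2) * (k - 1)))%N.
  by rewrite sum_nat_const card_ord.
by apply: leq_sum => i _; exact: size_outside_ge bd n_gt0 (t i) k.
Qed.

(** The length of M / m^k M lies between r e (k - 2) (k - 1) / 2 and
    r e k (k + 1) / 2. *)
Lemma multiplicityE (R : realType) : multiplicity R M = (r * e)%:R.
Proof.
have -> : multiplicity R M =
    lim ((fun k => (2`!)%:R * (size (outside_list k))%:R / k%:R ^+ 2 : R) @ \oo).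
  rewrite /multiplicity krull_dim_A.
  apply: (congr1 (fun u : nat -> R => lim (u @ \oo))); apply/funext => k.
  by rewrite colength_powers.
apply/cvg_lim => //; rewrite -cvg_shiftS /=.
pose c : R := (r * e)%:R.
have har : @harmonic R @ \oo --> (0 : R) by exact: cvg_harmonic.
apply: (@squeeze_cvgr _ _ _ _ (fun k => c * (1 - 3 * harmonic k)) (fun k => c * (1 + harmonic k))).
- apply: nearW => k; rewrite /harmonic /=.
  have x0 : (0 : R) < k.+1%:R by rewrite ltr0n.
  have := size_outside_list_le k.+1; have := size_outside_list_ge k.+1.
  move: (size _) => d; rewrite -!(ler_nat R) natrM -/c => lo.
  rewrite [X in _ <= X -> _]natrM -/c => hi.
  have xN : (k.+1%:R - 3) * k.+1%:R <= ((k.+1 - 2) * (k.+1 - 1))%:R :> R.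
    case: k {x0 lo hi} => [|k]; first by rewrite muln0; lra.
    by rewrite !subSS !subn0 natrM -!natr1; lra.
  have c0 : 0 <= c by exact: ler0n.
  have {xN}lo : c * ((k.+1%:R - 3) * k.+1%:R) <= 2 * d%:R.
    by apply: le_trans (ler_wpM2l c0 xN) _; move: lo; rewrite !natrM.
  have {}hi : 2 * d%:R <= c * (k.+1%:R * (k.+1%:R + 1)).
    by move: hi; rewrite !natrM -[k.+2%:R]natr1.
  rewrite ler_pdivlMr ?ler_pdivrMr ?exprn_gt0 //; move: x0 lo hi.
  rewrite [(2`!)%:R](_ : _ = 2) //; move: (k.+1%:R : R) => x x0 lo hi; apply/andP; split.
    by rewrite [X in X <= _](_ : _ = c * ((x - 3) * x)) //; field; rewrite gt_eqF.
  by rewrite [X in _ <= X](_ : _ = c * (x * (x + 1))) //; field; rewrite gt_eqF.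
- rewrite -[X in _ --> X]mulr1 -[X in _ * X]subr0 -[X in _ - X](mulr0 3).
  apply: cvgM; first exact: cvg_cst.
  by apply: cvgB; [exact: cvg_cst|apply: cvgM; [exact: cvg_cst|]].
- rewrite -[X in _ --> X]mulr1 -[X in _ * X]addr0.
  by apply: cvgM; [exact: cvg_cst|apply: cvgD; [exact: cvg_cst|]].
Qed.

End Lengths.

(** * The three conditions *)

Hypotheses (a_gt0 : (0 < a)%N) (a_ltn : (a < n)%N).

(** The upper bound comes from W 1, whose trace has no constant term. *)
Lemma test_ideal_maximal : (a %| n + 1)%N -> test_ideal_CM A = maximal_ideal A.
Proof.
move=> adiv; apply/seteqP; split=> [f ftest|f mf M mcmM nzM].
  apply/maximal_idealE.
  apply: (trace_coef (eigenmodule_decomposition 1)) (ftest _ (MCM_eigenmodule 1) (nonzero_eigenmodule 1)).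
  move=> _ p q; rewrite !leqn0 => /eqP -> /eqP ->.
  by rewrite muln0 mod0n modn_small.
have [r [t [iota [r0 dec]]]] := MCM_decomposition mcmM nzM.
apply: (trace_covers dec (i := Ordinal r0)) mf => p q pq0 pq.
apply: divisors_cover => //; first by rewrite a_gt0.
by rewrite /dvdn pq mod0n.
Qed.

(** A trace containing a unit forces a summand W t with t = 0, which has one
    generator where the multiplicity asks for e >= 2, while no summand has more
    than e. *)
Lemma Ulrich_trace (R : realType) (M : lmodType A) :
    test_ideal_CM A = maximal_ideal A -> Ulrich R M -> nonzero_module M ->
  trace_ideal M = maximal_ideal A.
Proof.
move=> testE [mcmM ulM] nzM; apply/seteqP; split=> [f trf|f]; last first.
  by rewrite -testE; exact.
have [r [t [iota [r0 dec]]]] := MCM_decomposition mcmM nzM.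
have a0n : (0 < a < n)%N by rewrite a_gt0.
have [e [bp [bq bd]]] := boundary_exists a0n.
apply/maximal_idealE; apply: contrapT => f0.
have [i0 ti0] : exists i, (n %| t i)%N.
  apply: contrapT => nt; apply: f0; apply: (trace_coef dec) trf => i p q.
  rewrite !leqn0 => /eqP -> /eqP ->; rewrite muln0 => ti; apply: nt; exists i.
  by rewrite /dvdn -ti mod0n.
have : (r * e)%:R = (size (outside_list t 1))%:R :> R.
  by rewrite -(multiplicityE bd dec) ulM (min_generatorsE dec).
move/eqP; rewrite eqr_nat size_outside_list (bigD1 i0) //= => /eqP reE.
have h0 := size_outside10 a n_gt0 ti0.
have hs : (\sum_(i < r | i != i0) size (outside n a (t i) 1) <= r.-1 * e)%N.
  have -> : (r.-1 * e = \sum_(i < r | i != i0) e)%N.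
    by rewrite sum_nat_const cardC1 card_ord.
  by apply: leq_sum => i _; exact: size_outside1_le bd n_gt0 (t i).
have := bd_e bd; have : (r * e = e + r.-1 * e)%N by rewrite -mulSn prednK.
have : (r * e <= 1 + r.-1 * e)%N by rewrite reE leq_add.
by move: (r.-1 * e)%N => m; lia.
Qed.

Lemma special_eigenmodule (R : realType) : ~~ (a %| n + 1)%N ->
  exists t, Ulrich R (eigenmodule z a t) /\ trace_ideal (eigenmodule z a t) <> maximal_ideal A.
Proof.
move=> ndiv; have a1 : (1 < a)%N by case: a ndiv a_gt0 => [|[|b]] //; rewrite dvd1n.
have a0n : (0 < a < n)%N by rewrite a_gt0.
have [e [bp [bq bd]]] := boundary_exists a0n.
have [t [x [y [ge_e xy0 nxy nodiv]]]] := special_weight bd a1 a_ltn co_an ndiv.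
have dec := eigenmodule_decomposition t; exists t; split.
  split; first exact: MCM_eigenmodule.
  rewrite (multiplicityE bd dec) (min_generatorsE dec) size_outside_list.
  rewrite big_ord1 mul1n; congr (_%:R); apply/eqP; rewrite eqn_leq ge_e.
  exact: size_outside1_le bd n_gt0 t.
move=> trE; have [vE mE] := max_term xy0 nxy.
move: mE; rewrite -trE => /(trace_coef dec (p := x) (q := y)).
rewrite vE coef2_term !eqxx => one0.
by have /eqP := one0 (fun _ => nodiv); rewrite oner_eq0.
Qed.

End Invariants.

Theorem theorem1p4 (R : realType) (n a : nat) (z : complex R)
    (a_gt0 : (1 <= a)%N) (a_le_n1 : (a <= n - 1)%N) (co_an : coprime a n)
    (prim_z : n.-primitive_root z) :
  let A : comNzRingType := cyclic_quotient z a in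
  [<-> (a %| n + 1)%N;
       test_ideal_CM A = maximal_ideal A;
       forall M : lmodType A, Ulrich R M -> nonzero_module M ->
         trace_ideal M = maximal_ideal A].
Proof.
move=> A; have n_gt1 : (1 < n)%N by lia.
have a_ltn : (a < n)%N by lia.
tfae.
- exact: test_ideal_maximal.
- by move=> testE M ulM nzM; apply: (Ulrich_trace n_gt1 co_an prim_z _ _ testE ulM nzM).
- move=> trE; apply/negPn/negP => ndiv.
  have [t [ulE neq]] := special_eigenmodule n_gt1 co_an prim_z a_gt0 a_ltn R ndiv.
  apply: neq; apply: trE ulE _.
  exact: nonzero_eigenmodule prim_z t.
Qed.
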